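(* Let $\varphi:\mathbb{D}\to\mathbb{D}$ be a parabolic holomorphic self-map of zero hyperbolic step with Koenigs function $h_\varphi$, and let $\psi\in\mathcal{Z}_{\forall}(\varphi)$. Then the following four statements hold. (1) If $\varphi$ is univalent, then so is $\psi$. (2) Let $V\subset\mathbb{D}$ be a simply connected and $\varphi$-absorbing domain. If $\psi(V)\subset V$ and $\varphi$ is univalent in $V$, then $\psi$ is univalent in $V$ as well. (3) There exists $c\in\mathbb{C}$ such that $h_\varphi\circ\psi=h_\varphi+c$. (4) $\mathcal{Z}_{\forall}(\varphi)$ is abelian, i.e., if $\psi_1,\psi_2\in\mathcal{Z}_{\forall}(\varphi)$, then $\psi_1\circ\psi_2=\psi_2\circ\psi_1$.
   Context: $\mathbb{D}=\{z\in\mathbb{C}:|z|<1\}$, and $\rho_{\mathbb{D}}$ denotes the hyperbolic distance in $\mathbb{D}$. ''Univalent'' means holomorphic and injective. The centralizer of $\varphi$ is $\mathcal{Z}_{\forall}(\varphi)=\{\psi:\mathbb{D}\to\mathbb{D}\text{ holomorphic}:\psi\circ\varphi=\varphi\circ\psi\}$. A holomorphic self-map $\varphi$ of $\mathbb{D}$ is parabolic if its iterates converge locally uniformly to a point $\tau\in\partial\mathbb{D}$ (its Denjoy–Wolff point) and the angular derivative satisfies $\varphi'(\tau)=1$. It is of zero hyperbolic step if $\lim_{n\to\infty}\rho_{\mathbb{D}}(\varphi^{\circ n}(z),\varphi^{\circ(n+1)}(z))=0$ for some (equivalently, all) $z\in\mathbb{D}$. A domain $V\subset\mathbb{D}$ is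 $\varphi$-absorbing if $\varphi(V)\subset V$ and $\mathbb{D}=\bigcup_{n\in\mathbb{N}}(\varphi^{\circ n})^{-1}(V)$. Koenigs function (parabolic, zero hyperbolic step): $h_\varphi$ is the unique holomorphic function $h:\mathbb{D}\to\mathbb{C}$ with $h(0)=0$ such that $h\circ\varphi=h+1$, $\mathbb{C}=\bigcup_{n\ge0}(h(\mathbb{D})-n)$, and $h$ is injective on some $\varphi$-absorbing domain. *)

(* Defs.v *)
From Stdlib Require Import Reals.
From Coquelicot Require Import Coquelicot.
Open Scope R_scope.

Definition unit_disc (z : C) : Prop := Cmod z < 1.

(* Functions on the disc are total functions [C -> C]; every condition on them,
   including each equality of compositions, is only imposed on the disc. *)

Definition holomorphic_on (U : C -> Prop) (f : C -> C) : Prop :=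
  forall z : C, U z -> ex_derive (K := C_AbsRing) (V := C_NormedModule) f z.

Definition injective_on (U : C -> Prop) (f : C -> C) : Prop :=
  forall z w : C, U z -> U w -> f z = f w -> z = w.

Definition univalent_on (U : C -> Prop) (f : C -> C) : Prop :=
  holomorphic_on U f /\ injective_on U f.

Definition maps_into (U W : C -> Prop) (f : C -> C) : Prop :=
  forall z : C, U z -> W (f z).

Definition holomorphic_self_map (f : C -> C) : Prop :=
  holomorphic_on unit_disc f /\ maps_into unit_disc unit_disc f.

Definition iterate (f : C -> C) (n : nat) (z : C) : C := Nat.iter n f z.

Definition centralizer (phi psi : C -> C) : Prop :=
  holomorphic_self_map psi /\
  forall z : C, unit_disc z -> psi (phi z) = phi (psi z).

Definition connected_set (V : C -> Prop) : Prop :=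
  forall U W : C -> Prop,
    open U -> open W ->
    (forall z, V z -> U z \/ W z) ->
    (exists z, V z /\ U z) -> (exists z, V z /\ W z) ->
    exists z, V z /\ U z /\ W z.

Definition is_domain (V : C -> Prop) : Prop :=
  open V /\ connected_set V /\ exists z, V z.

Definition unit_interval (t : R) : Prop := 0 <= t <= 1.

Definition unit_square (p : R * R) : Prop :=
  unit_interval (fst p) /\ unit_interval (snd p).

Definition loop_in (V : C -> Prop) (g : R -> C) : Prop :=
  continuous_on unit_interval g /\
  (forall t, unit_interval t -> V (g t)) /\
  g 0 = g 1.

(* [H (s, t)] : [s] runs along the loop, [t] is the time of the homotopy, and
   the base point is kept fixed. *)
Definition null_homotopic_in (V : C -> Prop) (g : R -> C) : Prop :=
  exists H : R * R -> C,
    continuous_on unit_square H /\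
    (forall p, unit_square p -> V (H p)) /\
    (forall s, unit_interval s -> H (s, 0) = g s) /\
    (forall s, unit_interval s -> H (s, 1) = g 0) /\
    (forall t, unit_interval t -> H (0, t) = g 0 /\ H (1, t) = g 0).

Definition simply_connected_domain (V : C -> Prop) : Prop :=
  is_domain V /\ forall g : R -> C, loop_in V g -> null_homotopic_in V g.

Definition absorbing (phi : C -> C) (V : C -> Prop) : Prop :=
  is_domain V /\
  (forall z, V z -> unit_disc z) /\
  maps_into V V phi /\
  forall z, unit_disc z -> exists n : nat, V (iterate phi n z).

(* Hyperbolic distance normalised to curvature -4, i.e. with length element
   |dz| / (1 - |z|^2). *)
Definition hyp_dist (z w : C) : R :=
  let r := Cmod ((z - w) / (1 - Cconj w * z))%C in
  / 2 * ln ((1 + r) / (1 - r)).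

Definition stolz_region (tau : C) (M : R) (z : C) : Prop :=
  unit_disc z /\ Cmod (tau - z)%C < M * (1 - Cmod z).

Definition angular_limit (f : C -> C) (tau l : C) : Prop :=
  forall M : R, 1 < M ->
    filterlim f (within (stolz_region tau M) (locally tau)) (locally l).

Definition angular_derivative (f : C -> C) (tau l : C) : Prop :=
  exists sigma : C,
    angular_limit f tau sigma /\
    angular_limit (fun z => (f z - sigma) / (z - tau))%C tau l.

Definition iterates_converge_loc_unif (phi : C -> C) (tau : C) : Prop :=
  forall z0 : C, unit_disc z0 -> exists delta : posreal, forall eps : posreal,
    eventually (fun n => forall z : C,
      unit_disc z -> Cmod (z - z0)%C < delta ->
      Cmod (iterate phi n z - tau)%C < eps).

Definition parabolic (phi : C -> C) : Prop :=
  holomorphic_self_map phi /\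
  exists tau : C,
    Cmod tau = 1 /\
    iterates_converge_loc_unif phi tau /\
    angular_derivative phi tau 1.

Definition zero_hyperbolic_step (phi : C -> C) : Prop :=
  exists z : C, unit_disc z /\
    is_lim_seq (fun n => hyp_dist (iterate phi n z) (iterate phi (S n) z)) 0.

Definition koenigs_function (phi h : C -> C) : Prop :=
  holomorphic_on unit_disc h /\
  h 0 = 0 /\
  (forall z, unit_disc z -> h (phi z) = (h z + 1)%C) /\
  (forall w : C, exists (n : nat) (z : C),
      unit_disc z /\ w = (h z - RtoC (INR n))%C) /\
  (exists V : C -> Prop, absorbing phi V /\ injective_on V h).

(* Main.v *)
(** Put [k = (h|V)^-1], where [h] is injective on the absorbing domain [V]. Since
    [h (V) - n] increases to the whole plane, [h o psi] factors as [G o h] with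
    [G] entire and [G (w + 1) = G w + 1]. Near [w] and [G w] the branches
    [k_n = k (. + n)] are univalent on discs whose radii tend to infinity, and
    [psi o k_n = k_n o G] there for large [n]. Schwarz-Pick for [psi] and the
    distortion of univalent functions bound [|G'|] by a constant independent of
    [w]; hence [G] is affine, with slope [1] by the functional equation, which is
    the third claim. The other claims follow because [h] takes the same value at
    two points only if their [phi]-orbits eventually coincide.

    The distortion bound comes from Bloch's theorem: if [f] is univalent and
    [f v] is omitted on a disc [B], a logarithm of [f - f v] on [B] covers no disc
    of radius larger than [pi]. Cauchy's theorem is obtained from Goursat's
    bisection, carried out on ruled surfaces [al t + s * be t] so that circles and
    segments are covered at once. *)

(* The obstacle is uniformity: the Schwarz-Pick bound [(1 - |psi a|^2) / (1 - |a|^2)] for [|psi' a|]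
   can be arbitrarily large when [a] is near the unit circle, and [h'] is not controlled either.
   Both are tamed at [a = k_n w], with [n] depending on [w]. In [G' w = psi' a * h' (psi a) / h' a]
   the quotient of the derivatives of [h] equals [k_n' w / k_n' (G w)], the distortion of a single
   univalent map. Moreover [k_n] maps a disc much larger than [|G w - w|] into the unit disc, so
   Schwarz-Pick for [k_n] itself keeps [a] and [psi a] pseudo-hyperbolically close, which bounds the
   remaining factor. The constants are crude: only their independence of [w] matters. Commutativity
   is first obtained near a late orbit point, where both compositions take values in the domain of
   injectivity of [h]; the identity theorem carries it to the whole disc. *)
Require Import Defs.
From Stdlib Require Import Reals Lra Lia ClassicalEpsilon.
From Coquelicot Require Import Coquelicot.
Open Scope R_scope.

(** * Differential calculus *)

(* [i] embeds the parameter space into [C]: with [i] the identity this is complex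
   differentiation, with [i = RtoC] the differentiation of curves. *)
Section Calculus.

Context {T : Type} (i : T -> C).

Definition cont (g : T -> C) (t : T) : Prop :=
  forall eps, 0 < eps -> exists d, 0 < d /\
    forall s, Cmod (i s - i t) < d -> Cmod (g s - g t) < eps.

Definition deriv (g : T -> C) (t : T) (l : C) : Prop :=
  forall eps, 0 < eps -> exists d, 0 < d /\
    forall s, Cmod (i s - i t) < d ->
      Cmod (g s - g t - l * (i s - i t)) <= eps * Cmod (i s - i t).

Lemma Cmod_self (z : C) : Cmod (z - z) = 0.
Proof. replace (z - z)%C with (RtoC 0) by ring. apply Cmod_0. Qed.

Lemma Cmod_sub_sym (z w : C) : Cmod (z - w) = Cmod (w - z).
Proof. rewrite <- Cmod_opp. f_equal. ring. Qed.

Lemma Cmod_pos_neq (z w : C) : z <> w -> 0 < Cmod (z - w).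
Proof.
  intros H. apply Cmod_gt_0. intros E. apply H.
  replace z with (z - w + w)%C by ring. rewrite E. ring.
Qed.

Lemma Cmod_lower (z w : C) : Cmod z - Cmod w <= Cmod (z - w).
Proof.
  replace z with ((z - w) + w)%C at 1 by ring.
  pose proof (Cmod_triangle (z - w) w). lra.
Qed.

Lemma cont_const (c : C) (t : T) : cont (fun _ => c) t.
Proof. intros e He. exists 1. split; [lra|]. intros. rewrite Cmod_self. lra. Qed.

Lemma cont_embed (t : T) : cont i t.
Proof. intros e He. exists e. auto. Qed.

Lemma cont_plus (f g : T -> C) (t : T) :
  cont f t -> cont g t -> cont (fun s => f s + g s)%C t.
Proof.
  intros Hf Hg e He.
  destruct (Hf (e/2)) as [d1 [P1 Q1]]; [lra|].
  destruct (Hg (e/2)) as [d2 [P2 Q2]]; [lra|].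
  exists (Rmin d1 d2). split; [apply Rmin_pos; auto|]. intros s Hs.
  replace (f s + g s - (f t + g t))%C with ((f s - f t) + (g s - g t))%C by ring.
  eapply Rle_lt_trans; [apply Cmod_triangle|].
  assert (Cmod (f s - f t) < e/2) by (apply Q1; eapply Rlt_le_trans; [eassumption|apply Rmin_l]).
  assert (Cmod (g s - g t) < e/2) by (apply Q2; eapply Rlt_le_trans; [eassumption|apply Rmin_r]).
  lra.
Qed.

Lemma cont_mult (f g : T -> C) (t : T) :
  cont f t -> cont g t -> cont (fun s => f s * g s)%C t.
Proof.
  intros Hf Hg e He.
  pose proof (Cmod_ge_0 (f t)) as F0. pose proof (Cmod_ge_0 (g t)) as G0.
  set (m := 1 + Cmod (f t) + Cmod (g t)).
  assert (Hm : 1 <= m) by (unfold m; lra).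
  assert (Hx : 0 < Rmin 1 (e / (2 * m))).
  { apply Rmin_pos; [lra|]. apply Rdiv_lt_0_compat; lra. }
  set (x := Rmin 1 (e / (2 * m))) in *.
  assert (X1 : x <= 1) by apply Rmin_l.
  assert (X2 : x * (2 * m) <= e).
  { apply Rle_trans with (e / (2*m) * (2*m)).
    - apply Rmult_le_compat_r; [lra|apply Rmin_r].
    - right. field. lra. }
  destruct (Hf x) as [d1 [P1 Q1]]; [lra|].
  destruct (Hg x) as [d2 [P2 Q2]]; [lra|].
  exists (Rmin d1 d2). split; [apply Rmin_pos; auto|]. intros s Hs.
  replace (f s * g s - f t * g t)%C
    with ((f s - f t) * (g s - g t) + (f t * (g s - g t) + g t * (f s - f t)))%C by ring.
  assert (A : Cmod (f s - f t) < x) by (apply Q1; eapply Rlt_le_trans; [eassumption|apply Rmin_l]).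
  assert (B : Cmod (g s - g t) < x) by (apply Q2; eapply Rlt_le_trans; [eassumption|apply Rmin_r]).
  eapply Rle_lt_trans; [apply Cmod_triangle|].
  pose proof (Cmod_triangle (f t * (g s - g t)) (g t * (f s - f t))) as Tr.
  rewrite !Cmod_mult in *.
  pose proof (Cmod_ge_0 (f s - f t)). pose proof (Cmod_ge_0 (g s - g t)).
  unfold m in *. nra.
Qed.

Lemma cont_opp (f : T -> C) (t : T) : cont f t -> cont (fun s => - f s)%C t.
Proof.
  intros Hf e He. destruct (Hf e He) as [d [P Q]]. exists d. split; auto. intros s Hs.
  replace (- f s - - f t)%C with (- (f s - f t))%C by ring. rewrite Cmod_opp. auto.
Qed.

Lemma cont_minus (f g : T -> C) (t : T) :
  cont f t -> cont g t -> cont (fun s => f s - g s)%C t.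
Proof. intros. apply cont_plus; auto. apply cont_opp; auto. Qed.

Lemma cont_comp (g : T -> C) (f : C -> C) (t : T) :
  cont g t ->
  (forall eps, 0 < eps -> exists d, 0 < d /\
     forall y, Cmod (y - g t) < d -> Cmod (f y - f (g t)) < eps) ->
  cont (fun s => f (g s)) t.
Proof.
  intros Hg Hf e He. destruct (Hf e He) as [d [P Q]]. destruct (Hg d P) as [d' [P' Q']].
  exists d'. split; auto.
Qed.

Lemma cont_inv (g : T -> C) (t : T) :
  cont g t -> g t <> 0 -> cont (fun s => / g s)%C t.
Proof.
  intros Hg Hn. apply (cont_comp g Cinv); auto.
  set (z := g t) in *. intros e He.
  assert (Hz : 0 < Cmod z) by (apply Cmod_gt_0; auto).
  exists (Rmin (Cmod z / 2) (e * Cmod z * Cmod z / 2)).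
  assert (0 < e * Cmod z * Cmod z / 2) by (repeat apply Rmult_lt_0_compat; lra).
  split; [apply Rmin_pos; lra|]. intros y Hy.
  apply Rmin_Rgt in Hy. destruct Hy as [A B]. apply Rgt_lt in A, B.
  pose proof (Cmod_lower z y) as L. rewrite Cmod_sub_sym in L.
  assert (Hy2 : Cmod z / 2 < Cmod y) by lra.
  assert (Yn : y <> 0) by (apply Cmod_gt_0; lra).
  replace (/ y - / z)%C with (- (y - z) / (y * z))%C by (field; auto).
  rewrite Cmod_div, Cmod_opp, Cmod_mult by (apply Cmult_neq_0; auto).
  apply Rmult_lt_reg_r with (Cmod y * Cmod z); [nra|].
  replace (Cmod (y - z) / (Cmod y * Cmod z) * (Cmod y * Cmod z)) with (Cmod (y - z)) by (field; lra).
  nra.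
Qed.

Lemma cont_ext (f g : T -> C) (t : T) :
  (forall s, f s = g s) -> cont f t -> cont g t.
Proof. intros E H e He. destruct (H e He) as [d [P Q]]. exists d. split; auto. intros. rewrite <- !E. auto. Qed.

(** Carathéodory's form of the derivative: a slope function continuous at the point. Sum, product,
    chain and inverse rules then become algebra on slopes plus continuity. *)
Lemma deriv_factor (g : T -> C) (t : T) (l : C) :
  deriv g t l ->
  exists q : T -> C, q t = l /\ cont q t /\
    forall s, (g s - g t = q s * (i s - i t))%C.
Proof.
  intros H.
  exists (fun s => match excluded_middle_informative (i s = i t) with
                   | left _ => l | right _ => ((g s - g t) / (i s - i t))%C end).
  split; [|split].
  - destruct excluded_middle_informative; tauto.
  - intros e He. destruct (H (e/2)) as [d [P Q]]; [lra|]. exists d. split; auto. intros s Hs.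
    destruct (excluded_middle_informative (i t = i t)) as [_|]; [|tauto].
    destruct excluded_middle_informative as [E|N].
    + rewrite Cmod_self. auto.
    + pose proof (Cmod_pos_neq _ _ N) as N'. specialize (Q s Hs).
      assert (N2 : (i s - i t)%C <> 0) by (apply Cmod_gt_0; auto).
      replace ((g s - g t) / (i s - i t) - l)%C
        with ((g s - g t - l * (i s - i t)) / (i s - i t))%C by (field; auto).
      rewrite Cmod_div by auto. apply Rle_lt_trans with (e/2); [|lra].
      apply Rmult_le_reg_r with (Cmod (i s - i t)); auto.
      eapply Rle_trans; [|exact Q]. right. field. lra.
  - intros s. destruct excluded_middle_informative as [E|N].
    + destruct (H 1) as [d [P Q]]; [lra|]. specialize (Q s). rewrite E, Cmod_self in Q.
      specialize (Q P). rewrite E.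
      assert (Z : Cmod (g s - g t - l * (i t - i t)) = 0).
      { pose proof (Cmod_ge_0 (g s - g t - l * (i t - i t))). lra. }
      apply Cmod_eq_0 in Z. replace (g s - g t)%C with (g s - g t - l * (i t - i t))%C by ring.
      rewrite Z. ring.
    + field. pose proof (Cmod_pos_neq _ _ N). apply Cmod_gt_0; auto.
Qed.

Lemma factor_deriv (g q : T -> C) (t : T) (l : C) :
  q t = l -> cont q t ->
  (exists d, 0 < d /\ forall s, Cmod (i s - i t) < d -> (g s - g t = q s * (i s - i t))%C) ->
  deriv g t l.
Proof.
  intros E Hc [d0 [P0 H]] e He. destruct (Hc e He) as [d [P Q]].
  exists (Rmin d d0). split; [apply Rmin_pos; auto|]. intros s Hs.
  rewrite H by (eapply Rlt_le_trans; [eassumption|apply Rmin_r]). rewrite <- E.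
  replace (q s * (i s - i t) - q t * (i s - i t))%C with ((q s - q t) * (i s - i t))%C by ring.
  rewrite Cmod_mult. apply Rmult_le_compat_r; [apply Cmod_ge_0|].
  apply Rlt_le, Q. eapply Rlt_le_trans; [eassumption|apply Rmin_l].
Qed.

Lemma factor_deriv_all (g q : T -> C) (t : T) (l : C) :
  q t = l -> cont q t -> (forall s, (g s - g t = q s * (i s - i t))%C) -> deriv g t l.
Proof. intros. apply factor_deriv with q; auto. exists 1. split; [lra|auto]. Qed.

Lemma deriv_cont (g : T -> C) (t : T) (l : C) : deriv g t l -> cont g t.
Proof.
  intros H. apply deriv_factor in H. destruct H as [q [E [Hc H]]].
  apply cont_ext with (fun s => g t + q s * (i s - i t))%C.
  - intros s. rewrite <- H. ring.
  - apply cont_plus; [apply cont_const|]. apply cont_mult; auto.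
    apply cont_minus; [apply cont_embed|apply cont_const].
Qed.

Lemma deriv_ext_loc (f g : T -> C) (t : T) (l : C) :
  (exists d, 0 < d /\ forall s, Cmod (i s - i t) < d -> f s = g s) ->
  deriv f t l -> deriv g t l.
Proof.
  intros [d0 [P0 E]] H e He. destruct (H e He) as [d [P Q]].
  exists (Rmin d d0). split; [apply Rmin_pos; auto|]. intros s Hs.
  rewrite <- !E.
  - apply Q. eapply Rlt_le_trans; [eassumption|apply Rmin_l].
  - rewrite Cmod_self. auto.
  - eapply Rlt_le_trans; [eassumption|apply Rmin_r].
Qed.

Lemma deriv_ext (f g : T -> C) (t : T) (l : C) :
  (forall s, f s = g s) -> deriv f t l -> deriv g t l.
Proof. intros E. apply deriv_ext_loc. exists 1. split; [lra|auto]. Qed.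

Lemma deriv_eq (g : T -> C) (t : T) (l m : C) : deriv g t l -> l = m -> deriv g t m.
Proof. intros H <-. auto. Qed.

Lemma deriv_const (c : C) (t : T) : deriv (fun _ => c) t 0.
Proof.
  apply factor_deriv_all with (fun _ => 0%C); auto; [apply cont_const|]. intros; ring.
Qed.

Lemma deriv_embed (t : T) : deriv i t 1.
Proof.
  apply factor_deriv_all with (fun _ => 1%C); auto; [apply cont_const|]. intros; ring.
Qed.

Lemma deriv_plus (f g : T -> C) (t : T) (l m : C) :
  deriv f t l -> deriv g t m -> deriv (fun s => f s + g s)%C t (l + m)%C.
Proof.
  intros Hf Hg. apply deriv_factor in Hf, Hg.
  destruct Hf as [q [E [Hc H]]]. destruct Hg as [p [E' [Hc' H']]].
  apply factor_deriv_all with (fun s => q s + p s)%C; [congruence|apply cont_plus; auto|].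
  intros s. replace (f s + g s - (f t + g t))%C with ((f s - f t) + (g s - g t))%C by ring.
  rewrite H, H'. ring.
Qed.

Lemma deriv_mult (f g : T -> C) (t : T) (l m : C) :
  deriv f t l -> deriv g t m -> deriv (fun s => f s * g s)%C t (l * g t + f t * m)%C.
Proof.
  intros Hf Hg. pose proof (deriv_cont _ _ _ Hg) as Gc. apply deriv_factor in Hf, Hg.
  destruct Hf as [q [E [Hc H]]]. destruct Hg as [p [E' [Hc' H']]].
  apply factor_deriv_all with (fun s => q s * g s + f t * p s)%C.
  - rewrite E, E'. ring.
  - apply cont_plus; apply cont_mult; auto. apply cont_const.
  - intros s. replace (f s * g s - f t * g t)%C with ((f s - f t) * g s + f t * (g s - g t))%C by ring.
    rewrite H, H'. ring.
Qed.

Lemma deriv_scal (c : C) (f : T -> C) (t : T) (l : C) :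
  deriv f t l -> deriv (fun s => c * f s)%C t (c * l)%C.
Proof.
  intros H. replace (c * l)%C with (0 * f t + c * l)%C by ring.
  apply (deriv_mult (fun _ => c)); [apply deriv_const|auto].
Qed.

Lemma deriv_opp (f : T -> C) (t : T) (l : C) :
  deriv f t l -> deriv (fun s => - f s)%C t (- l)%C.
Proof.
  intros H. replace (- l)%C with (- (1) * l)%C by ring.
  apply deriv_ext with (fun s => - (1) * f s)%C; [intros; ring|]. apply deriv_scal; auto.
Qed.

Lemma deriv_minus (f g : T -> C) (t : T) (l m : C) :
  deriv f t l -> deriv g t m -> deriv (fun s => f s - g s)%C t (l - m)%C.
Proof. intros. apply deriv_plus; auto. apply deriv_opp; auto. Qed.

End Calculus.

Definition idC (z : C) : C := z.
Notation ccont := (cont idC).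
Notation cderiv := (deriv idC).
Notation rcont := (cont RtoC).
Notation rderiv := (deriv RtoC).

Lemma deriv_comp {T : Type} (i : T -> C) (g : T -> C) (f : C -> C) (t : T) (l m : C) :
  deriv i g t l -> cderiv f (g t) m -> deriv i (fun s => f (g s)) t (m * l)%C.
Proof.
  intros Hg Hf. pose proof (deriv_cont _ _ _ _ Hg) as Gc.
  apply deriv_factor in Hg. destruct Hg as [q [E [Hc H]]].
  apply deriv_factor in Hf. destruct Hf as [p [E' [Hc' H']]].
  apply factor_deriv_all with (fun s => p (g s) * q s)%C.
  - congruence.
  - apply cont_mult; auto. apply (cont_comp i g p); auto.
  - intros s. rewrite H'. unfold idC. rewrite H. ring.
Qed.

Lemma cont_compose {T : Type} (i : T -> C) (g : T -> C) (f : C -> C) (t : T) :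
  cont i g t -> ccont f (g t) -> cont i (fun s => f (g s)) t.
Proof. intros Hg Hf. apply cont_comp; auto. Qed.

Lemma cderiv_inv (z : C) : z <> 0 -> cderiv Cinv z (- / (z * z))%C.
Proof.
  intros Hz. apply factor_deriv with (fun y => - / (y * z))%C; auto.
  - apply cont_opp. apply cont_inv; [|apply Cmult_neq_0; auto].
    apply cont_mult; [apply (cont_embed idC)|apply cont_const].
  - exists (Cmod z). split; [apply Cmod_gt_0; auto|]. intros y Hy. unfold idC in *.
    assert (y <> 0).
    { intros E. subst. replace (0 - z)%C with (- z)%C in Hy by ring. rewrite Cmod_opp in Hy. lra. }
    field. auto.
Qed.

Lemma deriv_inv {T : Type} (i : T -> C) (g : T -> C) (t : T) (l : C) :
  deriv i g t l -> g t <> 0 -> deriv i (fun s => / g s)%C t (- / (g t * g t) * l)%C.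
Proof. intros H Hn. apply (deriv_comp i g Cinv); auto. apply cderiv_inv; auto. Qed.

(** Bridge to the derivative used in the statement; through it [C_derive] serves as the derivative
    function in everything that follows. *)
Lemma cderiv_iff (f : C -> C) (z l : C) :
  cderiv f z l <-> is_derive (K := C_AbsRing) (V := C_NormedModule) f z l.
Proof.
  split.
  - intros H. split; [apply is_linear_scal_l|].
    intros x Hx. 
    assert (E : z = x) by exact (@is_filter_lim_locally_unique _ (AbsRing_NormedModule C_AbsRing) z x Hx).
    subst x. clear Hx.
    intros eps. destruct (H eps (cond_pos eps)) as [d [P Q]].
    exists (mkposreal d P). intros y Hy.
    change (Cmod (f y - f z - (y - z) * l) <= eps * Cmod (y - z)).
    rewrite (Cmult_comm (y - z) l). apply Q. exact Hy.
  - intros [_ H] e He.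
    destruct (H z (fun P HP => HP) (mkposreal e He)) as [d Q].
    exists d. split; [apply cond_pos|]. intros y Hy.
    specialize (Q y Hy).
    change (Cmod (f y - f z - (y - z) * l) <= e * Cmod (y - z)) in Q.
    rewrite (Cmult_comm (y - z) l) in Q. exact Q.
Qed.

Definition diff_at (f : C -> C) (z : C) : Prop := exists l, cderiv f z l.

Lemma cderiv_D_eq (f : C -> C) (z l : C) : cderiv f z l -> C_derive f z = l.
Proof. intros H. apply is_C_derive_unique. apply cderiv_iff; auto. Qed.

Lemma diff_at_D (f : C -> C) (z : C) : diff_at f z -> cderiv f z (C_derive f z).
Proof. intros [l H]. rewrite (cderiv_D_eq f z l); auto. Qed.

Lemma diff_at_iff (f : C -> C) (z : C) :
  diff_at f z <-> ex_derive (K := C_AbsRing) (V := C_NormedModule) f z.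
Proof. split; intros [l H]; exists l; apply cderiv_iff; auto. Qed.

Lemma diff_at_cont (f : C -> C) (z : C) : diff_at f z -> ccont f z.
Proof. intros [l H]. eapply deriv_cont; eauto. Qed.

Lemma diff_at_const (c z : C) : diff_at (fun _ => c) z.
Proof. eexists. apply deriv_const. Qed.

Lemma diff_at_id (z : C) : diff_at (fun y => y) z.
Proof. eexists. apply (deriv_embed idC). Qed.

Lemma diff_at_minus (f g : C -> C) (z : C) :
  diff_at f z -> diff_at g z -> diff_at (fun y => f y - g y)%C z.
Proof. intros [l H] [m H']. eexists. apply deriv_minus; eauto. Qed.

Lemma diff_at_mult (f g : C -> C) (z : C) :
  diff_at f z -> diff_at g z -> diff_at (fun y => f y * g y)%C z.
Proof. intros [l H] [m H']. eexists. apply deriv_mult; eauto. Qed.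

Lemma diff_at_inv (f : C -> C) (z : C) :
  diff_at f z -> f z <> 0 -> diff_at (fun y => / f y)%C z.
Proof. intros [l H] Hn. eexists. apply deriv_inv; eauto. Qed.

Lemma diff_at_div (f g : C -> C) (z : C) :
  diff_at f z -> diff_at g z -> g z <> 0 -> diff_at (fun y => f y / g y)%C z.
Proof. intros. apply diff_at_mult; auto. apply diff_at_inv; auto. Qed.

Lemma diff_at_comp (f g : C -> C) (z : C) :
  diff_at g z -> diff_at f (g z) -> diff_at (fun y => f (g y)) z.
Proof. intros [l H] [m H']. eexists. apply deriv_comp; eauto. Qed.

Lemma diff_at_pow (f : C -> C) (n : nat) (z : C) :
  diff_at f z -> diff_at (fun y => f y ^ n)%C z.
Proof.
  intros H. induction n; simpl; [apply diff_at_const|]. apply diff_at_mult; auto.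
Qed.

Lemma diff_at_ext_loc (f g : C -> C) (z : C) :
  (exists d, 0 < d /\ forall y, Cmod (y - z) < d -> f y = g y) ->
  diff_at f z -> diff_at g z.
Proof. intros E [l H]. exists l. eapply deriv_ext_loc; eauto. Qed.

(** * Integrals of curves *)

Definition contin (f : R -> C) (a b : R) : Prop := forall t, a <= t <= b -> rcont f t.

Definition Cint (f : R -> C) (a b : R) : C :=
  (RInt (fun t => Re (f t)) a b, RInt (fun t => Im (f t)) a b).

Definition is_Cint (f : R -> C) (a b : R) (l : C) : Prop :=
  is_RInt (fun t => Re (f t)) a b (Re l) /\ is_RInt (fun t => Im (f t)) a b (Im l).

Lemma Cmod_RtoC_minus (s t : R) : Cmod (RtoC s - RtoC t) = Rabs (s - t).
Proof. rewrite <- RtoC_minus. apply Cmod_R. Qed.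

Lemma im_le_Cmod (c : C) : Rabs (Im c) <= Cmod c.
Proof. eapply Rle_trans; [apply Rmax_r|apply Rmax_Cmod]. Qed.

Lemma Cmod_le_Re_Im (c : C) : Cmod c <= Rabs (Re c) + Rabs (Im c).
Proof.
  destruct c as [x y]. unfold Cmod; simpl.
  pose proof (Rabs_pos x). pose proof (Rabs_pos y).
  rewrite <- (sqrt_Rsqr (Rabs x + Rabs y)) by lra. apply sqrt_le_1_alt. unfold Rsqr.
  pose proof (Rsqr_abs x). pose proof (Rsqr_abs y). unfold Rsqr in *. nra.
Qed.

Lemma rcont_re (f : R -> C) (t : R) : rcont f t -> continuous (fun s => Re (f s)) t.
Proof.
  intros H. apply continuity_pt_filterlim. intros e He. destruct (H e He) as [d [P Q]].
  exists d. split; auto. intros x [_ Hx].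
  eapply Rle_lt_trans; [|apply Q; rewrite Cmod_RtoC_minus; exact Hx].
  exact (re_le_Cmod (f x - f t)).
Qed.

Lemma rcont_im (f : R -> C) (t : R) : rcont f t -> continuous (fun s => Im (f s)) t.
Proof.
  intros H. apply continuity_pt_filterlim. intros e He. destruct (H e He) as [d [P Q]].
  exists d. split; auto. intros x [_ Hx].
  eapply Rle_lt_trans; [|apply Q; rewrite Cmod_RtoC_minus; exact Hx].
  exact (im_le_Cmod (f x - f t)).
Qed.

Lemma is_Cint_Cint (f : R -> C) (a b : R) : a <= b -> contin f a b -> is_Cint f a b (Cint f a b).
Proof.
  intros Hab H.
  split; refine (RInt_correct (V := R_CompleteNormedModule) _ _ _ _);
    apply (ex_RInt_continuous (V := R_CompleteNormedModule)); intros t Ht;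
    rewrite Rmin_left, Rmax_right in Ht by auto; [apply rcont_re|apply rcont_im]; auto.
Qed.

Lemma Cint_unique (f : R -> C) (a b : R) (l : C) : is_Cint f a b l -> Cint f a b = l.
Proof.
  intros [H1 H2]. unfold Cint. rewrite (is_RInt_unique _ _ _ _ H1), (is_RInt_unique _ _ _ _ H2).
  symmetry. apply surjective_pairing.
Qed.

Lemma is_Cint_plus (f g : R -> C) (a b : R) (l m : C) :
  is_Cint f a b l -> is_Cint g a b m -> is_Cint (fun t => f t + g t)%C a b (l + m)%C.
Proof.
  intros [H1 H2] [H3 H4]. split.
  - exact (is_RInt_plus _ _ _ _ _ _ H1 H3).
  - exact (is_RInt_plus _ _ _ _ _ _ H2 H4).
Qed.

Lemma is_Cint_scal (c : C) (f : R -> C) (a b : R) (l : C) :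
  is_Cint f a b l -> is_Cint (fun t => c * f t)%C a b (c * l)%C.
Proof.
  intros [H1 H2]. split.
  - exact (is_RInt_minus _ _ _ _ _ _ (is_RInt_scal _ _ _ (Re c) _ H1) (is_RInt_scal _ _ _ (Im c) _ H2)).
  - exact (is_RInt_plus _ _ _ _ _ _ (is_RInt_scal _ _ _ (Re c) _ H2) (is_RInt_scal _ _ _ (Im c) _ H1)).
Qed.

Lemma is_Cint_bound (f : R -> C) (a b M : R) (l : C) :
  a <= b -> (forall t, a <= t <= b -> Cmod (f t) <= M) -> is_Cint f a b l ->
  Cmod l <= (b - a) * M.
Proof.
  intros Hab HM H.
  destruct (Req_dec (Cmod l) 0) as [E|N].
  - rewrite E. apply Rmult_le_pos; [lra|].
    eapply Rle_trans; [apply Cmod_ge_0|apply (HM a); lra].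
  - pose proof (Cmod_ge_0 l) as P.
    (* rotating the integral onto the positive real axis reduces to the real case *)
    set (u := (Cconj l / Cmod l)%C).
    assert (Cmod l <> 0%C :> C) by (intros E; apply N; injection E; auto).
    assert (U : Cmod u = 1).
    { unfold u. rewrite Cmod_div, Cmod_conj, Cmod_R, Rabs_pos_eq by auto. field; auto. }
    assert (UL : (u * l)%C = RtoC (Cmod l)).
    { unfold u. transitivity ((l * Cconj l) / Cmod l)%C; [field; auto|].
      rewrite <- Cmod2_conj. simpl. rewrite RtoC_mult, RtoC_mult. field; auto. }
    destruct (is_Cint_scal u _ _ _ _ H) as [H1 _]. rewrite UL in H1.
    assert (H2 : is_RInt (fun _ : R => M) a b ((b - a) * M)) by apply (is_RInt_const (V := R_NormedModule) a b M).
    refine (is_RInt_le _ _ _ _ _ _ Hab H1 H2 _).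
    intros t Ht. eapply Rle_trans; [apply Rle_abs|].
    eapply Rle_trans; [apply (re_le_Cmod (u * f t))|]. rewrite Cmod_mult, U, Rmult_1_l.
    apply HM. lra.
Qed.

Lemma Cint_ext (f g : R -> C) (a b : R) :
  a <= b -> (forall t, a <= t <= b -> f t = g t) -> Cint f a b = Cint g a b.
Proof.
  intros Hab E. unfold Cint. f_equal; apply RInt_ext; intros t Ht;
    rewrite Rmin_left, Rmax_right in Ht by auto; rewrite E; auto; lra.
Qed.

Lemma Cint_plus (f g : R -> C) (a b : R) :
  a <= b -> contin f a b -> contin g a b ->
  Cint (fun t => f t + g t)%C a b = (Cint f a b + Cint g a b)%C.
Proof. intros. apply Cint_unique, is_Cint_plus; apply is_Cint_Cint; auto. Qed.

Lemma Cint_scal (c : C) (f : R -> C) (a b : R) :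
  a <= b -> contin f a b -> Cint (fun t => c * f t)%C a b = (c * Cint f a b)%C.
Proof. intros. apply Cint_unique, is_Cint_scal; apply is_Cint_Cint; auto. Qed.

Lemma contin_scal (c : C) (f : R -> C) (a b : R) : contin f a b -> contin (fun t => c * f t)%C a b.
Proof. intros H t Ht. apply cont_mult; auto. apply cont_const. Qed.

Lemma Cint_minus (f g : R -> C) (a b : R) :
  a <= b -> contin f a b -> contin g a b ->
  Cint (fun t => f t - g t)%C a b = (Cint f a b - Cint g a b)%C.
Proof.
  intros Hab Hf Hg. rewrite (Cint_ext _ (fun t => f t + (- (1)) * g t)%C) by (auto; intros; ring).
  rewrite Cint_plus, Cint_scal; auto; [ring|]. apply contin_scal; auto.
Qed.

Lemma Cint_bound (f : R -> C) (a b M : R) :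
  a <= b -> contin f a b -> (forall t, a <= t <= b -> Cmod (f t) <= M) ->
  Cmod (Cint f a b) <= (b - a) * M.
Proof. intros. eapply is_Cint_bound; eauto. apply is_Cint_Cint; auto. Qed.

Lemma Cint_Chasles (f : R -> C) (a b c : R) :
  a <= b <= c -> contin f a c -> Cint f a c = (Cint f a b + Cint f b c)%C.
Proof.
  intros Hab H. apply Cint_unique.
  destruct (is_Cint_Cint f a b) as [H1 H2]; [lra|intros t Ht; apply H; lra|].
  destruct (is_Cint_Cint f b c) as [H3 H4]; [lra|intros t Ht; apply H; lra|].
  split; [exact (is_RInt_Chasles _ _ _ _ _ _ H1 H3)|exact (is_RInt_Chasles _ _ _ _ _ _ H2 H4)].
Qed.

Lemma rderiv_re (f : R -> C) (t : R) (l : C) : rderiv f t l -> is_derive (fun s => Re (f s)) t (Re l).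
Proof.
  intros H. apply is_derive_Reals. intros e He. destruct (H (e/2)) as [d [P Q]]; [lra|].
  exists (mkposreal d P). intros h Hh Hd. simpl in Hd.
  specialize (Q (t + h)). rewrite Cmod_RtoC_minus in Q. replace (t + h - t) with h in Q by ring.
  specialize (Q Hd).
  pose proof (re_le_Cmod (f (t + h)%R - f t - l * (RtoC (t + h)%R - RtoC t))%C) as B.
  assert (E : Re (f (t + h)%R - f t - l * (RtoC (t + h)%R - RtoC t))%C = Re (f (t+h)%R) - Re (f t) - Re l * h).
  { unfold Re. simpl. ring. }
  rewrite E in B.
  replace ((Re (f (t + h)) - Re (f t)) / h - Re l)
    with ((Re (f (t + h)) - Re (f t) - Re l * h) / h) by (field; auto).
  unfold Rdiv. rewrite Rabs_mult, Rabs_inv.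
  assert (Hp : 0 < Rabs h) by (apply Rabs_pos_lt; auto).
  apply Rle_lt_trans with (e / 2); [|lra]. apply Rmult_le_reg_r with (Rabs h); auto.
  rewrite Rmult_assoc, Rinv_l, Rmult_1_r by lra. lra.
Qed.

Lemma rderiv_im (f : R -> C) (t : R) (l : C) : rderiv f t l -> is_derive (fun s => Im (f s)) t (Im l).
Proof.
  intros H. assert (H' : rderiv (fun s => - Ci * f s)%C t (- Ci * l)%C) by (apply deriv_scal; auto).
  apply rderiv_re in H'. simpl in H'.
  replace (Im l) with (- 0 * fst l - - (1) * snd l) by (unfold Im; ring).
  eapply is_derive_ext; [|exact H']. intros s. simpl. unfold Im. ring.
Qed.

Lemma rderiv_of (f g : R -> R) (t l m : R) :
  is_derive f t l -> is_derive g t m -> rderiv (fun s => (f s, g s)) t (l, m).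
Proof.
  intros Hf Hg e He. apply is_derive_Reals in Hf, Hg.
  destruct (Hf (e/2)) as [[d P] Q]; [lra|]. destruct (Hg (e/2)) as [[d' P'] Q']; [lra|].
  simpl in *.
  exists (Rmin d d'). split; [apply Rmin_pos; auto|]. intros s Hs.
  rewrite Cmod_RtoC_minus in Hs. apply Rmin_Rgt in Hs. destruct Hs as [H1 H2].
  eapply Rle_trans; [apply Cmod_le_Re_Im|]. rewrite Cmod_RtoC_minus. simpl.
  destruct (Req_dec s t) as [E|N].
  { subst. rewrite !Rminus_diag. replace (f t + - f t + - (l * (t + - t) - m * (0 + - 0))) with 0 by ring.
    replace (g t + - g t + - (l * (0 + - 0) + m * (t + - t))) with 0 by ring. rewrite Rabs_R0. lra. }
  assert (N' : s - t <> 0) by lra. assert (Hp := Rabs_pos_lt _ N').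
  specialize (Q (s - t) N' H1). specialize (Q' (s - t) N' H2).
  replace (t + (s - t)) with s in * by ring.
  replace (f s + - f t + - (l * (s + - t) - m * (0 + - 0))) with (((f s - f t) / (s - t) - l) * (s - t)) by (field; auto).
  replace (g s + - g t + - (l * (0 + - 0) + m * (s + - t))) with (((g s - g t) / (s - t) - m) * (s - t)) by (field; auto).
  rewrite !Rabs_mult. nra.
Qed.

Lemma Cint_derive (f df : R -> C) (a b : R) :
  a <= b -> (forall t, a <= t <= b -> rderiv f t (df t)) -> contin df a b ->
  Cint df a b = (f b - f a)%C.
Proof.
  intros Hab H Hc. apply Cint_unique. split.
  - apply (is_RInt_derive (fun t => Re (f t)) (fun t => Re (df t)));
      rewrite Rmin_left, Rmax_right by auto; intros t Ht; [apply rderiv_re; auto|apply rcont_re; auto].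
  - apply (is_RInt_derive (fun t => Im (f t)) (fun t => Im (df t)));
      rewrite Rmin_left, Rmax_right by auto; intros t Ht; [apply rderiv_im; auto|apply rcont_im; auto].
Qed.

Lemma contin_bounded (f : R -> C) (a b : R) :
  a <= b -> contin f a b -> exists M, 0 < M /\ forall t, a <= t <= b -> Cmod (f t) <= M.
Proof.
  intros Hab H.
  destruct (continuity_ab_maj (fun t => Cmod (f t)) a b) as [x [Hx _]]; auto.
  - intros t Ht e He. destruct (H t Ht e He) as [d [P Q]]. exists d. split; auto.
    intros s [_ Hs]. eapply Rle_lt_trans; [|apply Q; rewrite Cmod_RtoC_minus; exact Hs].
    unfold dist; simpl. unfold R_dist. apply Rabs_le. split.
    + pose proof (Cmod_lower (f t) (f s)). rewrite Cmod_sub_sym in H0. lra.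
    + apply Cmod_lower.
  - exists (Cmod (f x) + 1). pose proof (Cmod_ge_0 (f x)). split; [lra|].
    intros t Ht. specialize (Hx t Ht). simpl in Hx. lra.
Qed.

Lemma contin_bounded_below (f : R -> C) (a b : R) :
  a <= b -> contin f a b -> (forall t, a <= t <= b -> f t <> 0) ->
  exists m, 0 < m /\ forall t, a <= t <= b -> m <= Cmod (f t).
Proof.
  intros Hab H N. destruct (contin_bounded (fun t => / f t)%C a b) as [M [P Q]]; auto.
  - intros t Ht. apply cont_inv; auto.
  - exists (/ M). split; [apply Rinv_0_lt_compat; auto|]. intros t Ht. specialize (Q t Ht).
    rewrite Cmod_inv in Q by auto.
    assert (0 < Cmod (f t)) by (apply Cmod_gt_0; auto).
    rewrite <- (Rinv_inv (Cmod (f t))). apply Rinv_le_contravar; auto.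
    apply Rinv_0_lt_compat; auto.
Qed.

(** * Goursat's theorem and Cauchy's formula *)

Lemma nested_point (s : nat -> R) (l : nat -> R) :
  (forall n, s n <= s (S n)) -> (forall n, s (S n) + l (S n) <= s n + l n) ->
  (forall n, 0 <= l n) ->
  exists x, forall n, s n <= x <= s n + l n.
Proof.
  intros Hs Hl Hp.
  assert (A : forall m k, s m <= s (m + k)%nat).
  { intros m k. induction k. { rewrite Nat.add_0_r. lra. }
    rewrite Nat.add_succ_r. eapply Rle_trans; [exact IHk|apply Hs]. }
  assert (B : forall m k, s (m + k)%nat + l (m + k)%nat <= s m + l m).
  { intros m k. induction k. { rewrite Nat.add_0_r. lra. }
    rewrite Nat.add_succ_r. eapply Rle_trans; [apply Hl|exact IHk]. }
  assert (U : forall m n, s m <= s n + l n).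
  { intros m n. destruct (Nat.le_ge_cases m n) as [L|L].
    - replace n with (m + (n - m))%nat by lia. pose proof (A m (n - m)%nat). pose proof (Hp (m + (n-m))%nat). lra.
    - replace m with (n + (m - n))%nat by lia. pose proof (B n (m - n)%nat). pose proof (Hp (n + (m-n))%nat). lra. }
  destruct (completeness (fun y => exists n, y = s n)) as [x [X1 X2]].
  - exists (s 0%nat + l 0%nat). intros y [n ->]. apply U.
  - exists (s 0%nat), 0%nat. reflexivity.
  - exists x. intros n. split; [apply X1; eauto|]. apply X2. intros y [m ->]. apply U.
Qed.

(** Goursat's argument with the integral abstracted: [J s t l] stands for a quantity attached to the
    square of corner [(s, t)] and side [l]. If [J] does not vanish on the unit square, repeated
    quartering keeps the ratio of modulus to area bounded below, against the smallness of [J] around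
    the limit point. *)
Lemma bisection_vanishing (J : R -> R -> R -> C) :
  (forall s t l, 0 <= s -> 0 <= t -> 0 < l -> s + 2 * l <= 1 -> t + 2 * l <= 1 ->
     J s t (2 * l) = (J s t l + J (s + l)%R t l + J s (t + l)%R l + J (s + l)%R (t + l)%R l)%C) ->
  (forall x y eps, 0 <= x <= 1 -> 0 <= y <= 1 -> 0 < eps -> exists d, 0 < d /\
     forall s t l, 0 <= s -> s + l <= 1 -> 0 <= t -> t + l <= 1 -> 0 < l < d ->
       s <= x <= s + l -> t <= y <= t + l -> Cmod (J s t l) <= eps * (l * l)) ->
  J 0 0 1 = 0%C.
Proof.
  intros Hadd Hloc. apply Cmod_eq_0. apply NNPP. intros N.
  set (c := Cmod (J 0 0 1)) in *.
  assert (Hc : 0 < c) by (pose proof (Cmod_ge_0 (J 0 0 1)); fold c in H; lra).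
  set (l := fun n => (/ 2) ^ n).
  assert (lp : forall n, 0 < l n) by (intros; apply pow_lt; lra).
  assert (lS : forall n, l n = 2 * l (S n)) by (intros; unfold l; simpl; field).
  set (big := fun n (p : R * R) => c * (l n * l n) <= Cmod (J (fst p) (snd p) (l n))).
  (* The fourth square is chosen by default: when the other three fail [big], the triangle
     inequality forces it. *)
  set (next := fun n (p : R * R) =>
    if excluded_middle_informative (big (S n) p) then p
    else if excluded_middle_informative (big (S n) (fst p + l (S n), snd p)) then (fst p + l (S n), snd p)
    else if excluded_middle_informative (big (S n) (fst p, snd p + l (S n))) then (fst p, snd p + l (S n))
    else (fst p + l (S n), snd p + l (S n))).
  set (q := fix q n := match n with O => (0, 0) | S n => next n (q n) end).
  assert (Q1 : forall n, (fst (q (S n)) = fst (q n) \/ fst (q (S n)) = fst (q n) + l (S n)) /\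
                         (snd (q (S n)) = snd (q n) \/ snd (q (S n)) = snd (q n) + l (S n))).
  { intros n. simpl. unfold next.
    repeat destruct excluded_middle_informative; simpl; auto. }
  assert (Q2 : forall n, (0 <= fst (q n) /\ fst (q n) + l n <= 1 /\
                          0 <= snd (q n) /\ snd (q n) + l n <= 1) /\ big n (q n)).
  { induction n as [|n [IH1 IH2]].
    - unfold big, l. simpl. fold c. split; lra.
    - destruct (Q1 n) as [A B]. pose proof (lS n). pose proof (lp (S n)). split; [lra|].
      clear A B. unfold big in IH2. rewrite (lS n) in IH2, IH1. rewrite Hadd in IH2; try lra.
      change (q (S n)) with (next n (q n)). set (p := q n) in *. unfold next.
      destruct excluded_middle_informative as [|N1]; auto.
      destruct excluded_middle_informative as [|N2]; auto.
      destruct excluded_middle_informative as [|N3]; auto.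
      unfold big in *. simpl in N1, N2, N3 |- *. apply Rnot_le_lt in N1, N2, N3.
      set (a := J (fst p) (snd p) (l (S n))) in *.
      set (b := J (fst p + l (S n)) (snd p) (l (S n))) in *.
      set (e := J (fst p) (snd p + l (S n)) (l (S n))) in *.
      set (g := J (fst p + l (S n)) (snd p + l (S n)) (l (S n))) in *.
      pose proof (Cmod_triangle (a + b + e) g). pose proof (Cmod_triangle (a + b) e).
      pose proof (Cmod_triangle a b). lra. }
  destruct (nested_point (fun n => fst (q n)) l) as [x Hx].
  { intros n. destruct (Q1 n) as [A _]. pose proof (lp (S n)). lra. }
  { intros n. destruct (Q1 n) as [A _]. pose proof (lS n). pose proof (lp (S n)). lra. }
  { intros n. apply Rlt_le, lp. }
  destruct (nested_point (fun n => snd (q n)) l) as [y Hy].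
  { intros n. destruct (Q1 n) as [_ A]. pose proof (lp (S n)). lra. }
  { intros n. destruct (Q1 n) as [_ A]. pose proof (lS n). pose proof (lp (S n)). lra. }
  { intros n. apply Rlt_le, lp. }
  destruct (Hloc x y (c / 2)) as [d [P Q]].
  { pose proof (Hx 0%nat) as H. unfold l in H; simpl in H. lra. }
  { pose proof (Hy 0%nat) as H. unfold l in H; simpl in H. lra. }
  { lra. }
  destruct (pow_lt_1_zero (/ 2)) with (y := d) as [n Hn]; auto.
  { rewrite Rabs_pos_eq; lra. }
  specialize (Hn n (Nat.le_refl n)). change ((/ 2) ^ n) with (l n) in Hn.
  pose proof (lp n) as Hln. rewrite Rabs_pos_eq in Hn by lra.
  destruct (Q2 n) as [Q3 Q4]. unfold big in Q4.
  specialize (Q (fst (q n)) (snd (q n)) (l n)).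
  pose proof (Hx n). pose proof (Hy n).
  assert (Cmod (J (fst (q n)) (snd (q n)) (l n)) <= c / 2 * (l n * l n)) by (apply Q; simpl in *; lra).
  assert (0 < c * (l n * l n)) by (repeat apply Rmult_lt_0_compat; auto). lra.
Qed.

(* The surface [al t + s * be t] covers annuli, cones over segments and homotopies
   between circles. *)
Section Goursat.

Variables (al be al' be' : R -> C) (f : C -> C).
Hypothesis Hal : forall t, rderiv al t (al' t).
Hypothesis Hbe : forall t, rderiv be t (be' t).
Hypothesis Cal : forall t, rcont al' t.
Hypothesis Cbe : forall t, rcont be' t.
Let G (s t : R) : C := (al t + s * be t)%C.
Let Gt (s t : R) : C := (al' t + s * be' t)%C.
Hypothesis Hf : forall s t, 0 <= s <= 1 -> 0 <= t <= 1 -> diff_at f (G s t).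

(** Integrals of [f dz] over the images of edges with [t] constant and with [s] constant. [J] is the
    integral around the boundary of a parameter square, taken counterclockwise. *)
Let EH (t s0 s1 : R) : C := Cint (fun s => f (G s t) * be t)%C s0 s1.
Let EV (s t0 t1 : R) : C := Cint (fun t => f (G s t) * Gt s t)%C t0 t1.
Let J (s t l : R) : C := (EH t s (s + l) + EV (s + l) t (t + l) - EH (t + l) s (s + l) - EV s t (t + l))%C.

Lemma ruled_deriv_s (s t : R) : rderiv (fun s => G s t) s (be t).
Proof.
  unfold G. eapply deriv_eq.
  - apply (deriv_plus RtoC); [apply deriv_const|].
    apply (deriv_mult RtoC RtoC (fun _ => be t)); [apply deriv_embed|apply deriv_const].
  - ring.
Qed.

Lemma ruled_deriv_t (s t : R) : rderiv (fun t => G s t) t (Gt s t).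
Proof. unfold G, Gt. apply (deriv_plus RtoC); auto. apply deriv_scal; auto. Qed.

Lemma ruled_cont_Gt (s t : R) : rcont (fun t => Gt s t) t.
Proof. unfold Gt. apply cont_plus; auto. apply cont_mult; auto. apply cont_const. Qed.

Lemma ruled_contin_s (t s0 s1 : R) :
  0 <= t <= 1 -> 0 <= s0 -> s1 <= 1 -> contin (fun s => f (G s t) * be t)%C s0 s1.
Proof.
  intros Ht H0 H1 s Hs. apply cont_mult; [|apply cont_const].
  apply (cont_compose RtoC (fun s => G s t) f); [eapply deriv_cont; apply ruled_deriv_s|].
  apply diff_at_cont, Hf; lra.
Qed.

Lemma ruled_contin_t (s t0 t1 : R) :
  0 <= s <= 1 -> 0 <= t0 -> t1 <= 1 -> contin (fun t => f (G s t) * Gt s t)%C t0 t1.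
Proof.
  intros Ht H0 H1 t Hs. apply cont_mult; [|apply ruled_cont_Gt].
  apply (cont_compose RtoC (fun t => G s t) f); [eapply deriv_cont; apply ruled_deriv_t|].
  apply diff_at_cont, Hf; lra.
Qed.

(** Near [z0] the function [f] is affine up to an error [rho]. The affine part has the primitive
    [P], whose increments cancel around the square; the error is at most a small multiple of [l], on
    edges of length at most [l * M]. *)
Lemma ruled_loc (x y eps : R) :
  0 <= x <= 1 -> 0 <= y <= 1 -> 0 < eps -> exists d, 0 < d /\
     forall s t l, 0 <= s -> s + l <= 1 -> 0 <= t -> t + l <= 1 -> 0 < l < d ->
       s <= x <= s + l -> t <= y <= t + l -> Cmod (J s t l) <= eps * (l * l).
Proof.
  intros Hx Hy He.
  destruct (contin_bounded al' 0 1) as [M1 [M1p B1]]; [lra|intros t _; auto|].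
  destruct (contin_bounded be' 0 1) as [M2 [M2p B2]]; [lra|intros t _; auto|].
  destruct (contin_bounded be 0 1) as [M3 [M3p B3]]; [lra|intros t _; eapply deriv_cont; apply Hbe|].
  set (M := M1 + M2 + M3).
  assert (Mp : 0 < M) by (unfold M; lra).
  assert (BGt : forall s t, 0 <= s <= 1 -> 0 <= t <= 1 -> Cmod (Gt s t) <= M).
  { intros s t Hs Ht. unfold Gt. eapply Rle_trans; [apply Cmod_triangle|].
    rewrite Cmod_mult, Cmod_R, Rabs_pos_eq by lra.
    specialize (B1 t Ht). specialize (B2 t Ht). pose proof (Cmod_ge_0 (be' t)). unfold M. nra. }
  assert (Bbe : forall t, 0 <= t <= 1 -> Cmod (be t) <= M).
  { intros t Ht. specialize (B3 t Ht). unfold M. lra. }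
  assert (LipT : forall s a b, 0 <= s <= 1 -> 0 <= a <= b -> b <= 1 -> Cmod (G s b - G s a) <= (b - a) * M).
  { intros s a b Hs Ha Hb. rewrite <- (Cint_derive (fun t => G s t) (fun t => Gt s t)).
    - apply Cint_bound; [lra| |intros t Ht; apply BGt; lra]. intros t _; apply ruled_cont_Gt.
    - lra.
    - intros; apply ruled_deriv_t.
    - intros t _; apply ruled_cont_Gt. }
  set (z0 := G x y).
  set (A := f z0).
  destruct (Hf x y Hx Hy) as [B HB]. fold z0 in HB.
  (* Each of the four edges contributes at most [l * (e * (2 * M * l) * M)], hence the factor
     [8 * M * M]. *)
  set (e := eps / (8 * M * M)).
  assert (ep : 0 < e) by (apply Rdiv_lt_0_compat; nra).
  destruct (HB e ep) as [d [dp Hd]]. unfold idC in Hd. fold A in Hd.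
  exists (d / (2 * M)). split; [apply Rdiv_lt_0_compat; lra|].
  intros s t l Hs Hsl Ht Htl Hl Hxs Hyt.
  assert (Hl2 : 2 * M * l < d).
  { replace d with (2 * M * (d / (2 * M))) by (field; lra). apply Rmult_lt_compat_l; lra. }
  assert (Dist : forall u v, s <= u <= s + l -> t <= v <= t + l -> Cmod (G u v - z0) <= 2 * M * l).
  { intros u v Hu Hv. unfold z0.
    replace (G u v - G x y)%C with ((u - x) * be v + (G x v - G x y))%C by (unfold G; ring).
    eapply Rle_trans; [apply Cmod_triangle|].
    assert (C1 : Cmod ((u - x) * be v) <= l * M).
    { rewrite Cmod_mult, <- RtoC_minus, Cmod_R.
      apply Rmult_le_compat; [apply Rabs_pos|apply Cmod_ge_0|apply Rabs_le; lra|apply Bbe; lra]. }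
    assert (C2 : Cmod (G x v - G x y) <= l * M).
    { destruct (Rle_dec y v).
      - eapply Rle_trans; [apply LipT; lra|]. apply Rmult_le_compat_r; lra.
      - rewrite Cmod_sub_sym. eapply Rle_trans; [apply LipT; lra|]. apply Rmult_le_compat_r; lra. }
    lra. }
  set (rho := fun z => (f z - (A + B * (z - z0)))%C).
  assert (Rho : forall u v, s <= u <= s + l -> t <= v <= t + l -> Cmod (rho (G u v)) <= e * (2 * M * l)).
  { intros u v Hu Hv. pose proof (Dist u v Hu Hv).
    unfold rho. replace (f (G u v) - (A + B * (G u v - z0)))%C with (f (G u v) - A - B * (G u v - z0))%C by ring.
    eapply Rle_trans; [apply Hd; lra|]. apply Rmult_le_compat_l; lra. }
  set (P := fun z => (A * z + B * ((z - z0) * (z - z0)) * / 2)%C).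
  assert (DP : forall z, cderiv P z (A + B * (z - z0))%C).
  { intros z. unfold P.
    assert (D1 : cderiv (fun z => z - z0)%C z (1 - 0)).
    { apply deriv_minus; [apply (deriv_embed idC)|apply deriv_const]. }
    eapply deriv_eq.
    - apply deriv_plus; [apply deriv_scal; apply (deriv_embed idC)|].
      apply (deriv_mult idC _ (fun _ => / 2)%C); [|apply deriv_const].
      apply deriv_scal, deriv_mult; exact D1.
    - cbv beta. field. }
  assert (CP : forall z, ccont (fun z => A + B * (z - z0))%C z).
  { intros z. apply cont_plus; [apply cont_const|]. apply cont_mult; [apply cont_const|].
    apply cont_minus; [apply (cont_embed idC)|apply cont_const]. }
  assert (HEH : forall v, t <= v <= t + l ->
     Cmod (EH v s (s + l) - (P (G (s + l) v) - P (G s v))) <= l * (e * (2 * M * l) * M)).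
  { intros v Hv.
    assert (CI : contin (fun u => (A + B * (G u v - z0)) * be v)%C s (s + l)).
    { intros u _. apply cont_mult; [|apply cont_const].
      apply (cont_compose RtoC (fun u => G u v) (fun z => A + B * (z - z0))%C); [eapply deriv_cont; apply ruled_deriv_s|apply CP]. }
    rewrite <- (Cint_derive (fun u => P (G u v)) (fun u => (A + B * (G u v - z0)) * be v)%C); auto; [|lra|].
    2:{ intros u _. apply (deriv_comp RtoC (fun u => G u v) P); [apply ruled_deriv_s|apply DP]. }
    unfold EH. rewrite <- Cint_minus; auto; [|lra|apply ruled_contin_s; lra].
    replace (l * (e * (2 * M * l) * M)) with ((s + l - s) * (e * (2 * M * l) * M)) by ring.
    apply Cint_bound; [lra| |].
    - intros u Hu. apply (cont_minus RtoC); [exact (ruled_contin_s v s (s + l) ltac:(lra) Hs Hsl u Hu)|apply CI; lra].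
    - intros u Hu. replace (f (G u v) * be v - (A + B * (G u v - z0)) * be v)%C with (rho (G u v) * be v)%C by (unfold rho; ring).
      rewrite Cmod_mult. apply Rmult_le_compat; try apply Cmod_ge_0; [apply Rho; lra|apply Bbe; lra]. }
  assert (HEV : forall u, s <= u <= s + l ->
     Cmod (EV u t (t + l) - (P (G u (t + l)) - P (G u t))) <= l * (e * (2 * M * l) * M)).
  { intros u Hu.
    assert (CI : contin (fun v => (A + B * (G u v - z0)) * Gt u v)%C t (t + l)).
    { intros v _. apply cont_mult; [|apply ruled_cont_Gt].
      apply (cont_compose RtoC (fun v => G u v) (fun z => A + B * (z - z0))%C); [eapply deriv_cont; apply ruled_deriv_t|apply CP]. }
    rewrite <- (Cint_derive (fun v => P (G u v)) (fun v => (A + B * (G u v - z0)) * Gt u v)%C); auto; [|lra|].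
    2:{ intros v _. apply (deriv_comp RtoC (fun v => G u v) P); [apply ruled_deriv_t|apply DP]. }
    unfold EV. rewrite <- Cint_minus; auto; [|lra|apply ruled_contin_t; lra].
    replace (l * (e * (2 * M * l) * M)) with ((t + l - t) * (e * (2 * M * l) * M)) by ring.
    apply Cint_bound; [lra| |].
    - intros v Hv. apply (cont_minus RtoC); [exact (ruled_contin_t u t (t + l) ltac:(lra) Ht Htl v Hv)|apply CI; lra].
    - intros v Hv. replace (f (G u v) * Gt u v - (A + B * (G u v - z0)) * Gt u v)%C with (rho (G u v) * Gt u v)%C by (unfold rho; ring).
      rewrite Cmod_mult. apply Rmult_le_compat; try apply Cmod_ge_0; [apply Rho; lra|apply BGt; lra]. }
  pose proof (HEH t ltac:(lra)) as E1. pose proof (HEH (t + l) ltac:(lra)) as E2.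
  pose proof (HEV s ltac:(lra)) as E3. pose proof (HEV (s + l) ltac:(lra)) as E4.
  replace (eps * (l * l)) with (4 * (l * (e * (2 * M * l) * M))) by (unfold e; field; lra).
  set (K := l * (e * (2 * M * l) * M)) in *.
  unfold J.
  set (X1 := (EH t s (s + l) - (P (G (s + l) t) - P (G s t)))%C) in *.
  set (X2 := (EH (t + l) s (s + l) - (P (G (s + l) (t + l)) - P (G s (t + l))))%C) in *.
  set (X3 := (EV s t (t + l) - (P (G s (t + l)) - P (G s t)))%C) in *.
  set (X4 := (EV (s + l) t (t + l) - (P (G (s + l) (t + l)) - P (G (s + l) t)))%C) in *.
  (* The values of [P] at the four corners cancel in pairs, so only the four edge errors are
     left. *)
  match goal with |- Cmod ?w <= _ => replace w with ((X1 + X4) + - (X2 + X3))%C by (unfold X1, X2, X3, X4; ring) end.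
  pose proof (Cmod_triangle (X1 + X4) (- (X2 + X3))) as T1. rewrite Cmod_opp in T1.
  pose proof (Cmod_triangle X1 X4). pose proof (Cmod_triangle X2 X3). lra.
Qed.

(** For closed [al] and [be] the two edges in [s] coincide and cancel, which equates the integrals
    over the curves [al] and [al + be]. For constant [al] and a segment [be] the formula is Cauchy's
    theorem for a triangle. *)
Theorem goursat_ruled :
  (Cint (fun s => f (al 0 + s * be 0) * be 0)%C 0 1
   + Cint (fun t => f (al t + be t) * (al' t + be' t))%C 0 1
   = Cint (fun s => f (al 1 + s * be 1) * be 1)%C 0 1
   + Cint (fun t => f (al t) * al' t)%C 0 1)%C.
Proof.
  assert (H : J 0 0 1 = 0%C).
  { apply bisection_vanishing; [|apply ruled_loc].
    intros s t l Hs Ht Hl Hsl Htl. unfold J.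
    replace (s + 2 * l) with (s + l + l) by ring. replace (t + 2 * l) with (t + l + l) by ring.
    assert (CH : forall v, 0 <= v <= 1 -> EH v s (s + l + l) = (EH v s (s + l) + EH v (s + l) (s + l + l))%C).
    { intros v Hv. apply Cint_Chasles; [lra|]. apply ruled_contin_s; lra. }
    assert (CV : forall u, 0 <= u <= 1 -> EV u t (t + l + l) = (EV u t (t + l) + EV u (t + l) (t + l + l))%C).
    { intros u Hv. apply Cint_Chasles; [lra|]. apply ruled_contin_t; lra. }
    rewrite !CH, !CV by lra. ring. }
  unfold J in H. rewrite !Rplus_0_l in H. unfold EH, EV in H.
  rewrite (Cint_ext (fun t => f (al t + be t) * (al' t + be' t))%C (fun t => f (G 1 t) * Gt 1 t)%C);
    [|lra|intros; unfold G, Gt; rewrite !Cmult_1_l; reflexivity].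
  rewrite (Cint_ext (fun t => f (al t) * al' t)%C (fun t => f (G 0 t) * Gt 0 t)%C);
    [|lra|intros; unfold G, Gt; rewrite !Cmult_0_l, !Cplus_0_r; reflexivity].
  unfold G in *.
  match goal with |- (?a + ?b = ?c + ?d)%C => set (w1 := a) in *; set (w2 := b) in *; set (w3 := c) in *; set (w4 := d) in * end.
  replace (w1 + w2)%C with ((w1 + w2 - w3 - w4) + (w3 + w4))%C by ring. rewrite H. ring.
Qed.

End Goursat.

(** * Circles and Cauchy's integral formula *)

Definition cis (t : R) : C := (cos (2 * PI * t), sin (2 * PI * t)).
Definition circ (c : C) (r : R) (t : R) : C := (c + r * cis t)%C.

Lemma Cmod_cis (t : R) : Cmod (cis t) = 1.
Proof.
  unfold cis, Cmod, fst, snd. rewrite <- sqrt_1. f_equal.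
  rewrite <- (sin2_cos2 (2 * PI * t)). unfold Rsqr. ring.
Qed.

Lemma cis_0 : cis 0 = 1%C.
Proof. unfold cis. rewrite Rmult_0_r, cos_0, sin_0. reflexivity. Qed.

Lemma cis_1 : cis 1 = 1%C.
Proof. unfold cis. rewrite Rmult_1_r, cos_2PI, sin_2PI. reflexivity. Qed.

Lemma rderiv_cis (t : R) : rderiv cis t (2 * PI * Ci * cis t)%C.
Proof.
  eapply deriv_eq.
  - apply (rderiv_of (fun t => cos (2 * PI * t)) (fun t => sin (2 * PI * t)) t
      (- (2 * PI) * sin (2 * PI * t)) (2 * PI * cos (2 * PI * t))); auto_derive; auto; ring.
  - unfold cis. apply injective_projections; simpl; ring.
Qed.

Lemma rcont_cis (t : R) : rcont cis t.
Proof. eapply deriv_cont. apply rderiv_cis. Qed.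

Lemma Cmod_circ (c : C) (r t : R) : 0 <= r -> Cmod (circ c r t - c) = r.
Proof.
  intros H. unfold circ. replace (c + r * cis t - c)%C with (r * cis t)%C by ring.
  rewrite Cmod_mult, Cmod_R, Cmod_cis, Rabs_pos_eq by auto. ring.
Qed.

Lemma rderiv_circ (c : C) (r t : R) : rderiv (circ c r) t (2 * PI * Ci * (r * cis t))%C.
Proof.
  eapply deriv_eq.
  - apply (deriv_plus RtoC); [apply deriv_const|]. apply deriv_scal, rderiv_cis.
  - ring.
Qed.

Lemma rcont_circ (c : C) (r t : R) : rcont (circ c r) t.
Proof. eapply deriv_cont. apply rderiv_circ. Qed.

Lemma rcont_circ' (r t : R) : rcont (fun t => 2 * PI * Ci * (r * cis t))%C t.
Proof.
  apply cont_mult; [apply cont_const|]. apply cont_mult; [apply cont_const|apply rcont_cis].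
Qed.

Lemma circ_0_1 (c : C) (r : R) : circ c r 0 = circ c r 1.
Proof. unfold circ. rewrite cis_0, cis_1. reflexivity. Qed.

Lemma circ_far (c z : C) (r t : R) : 0 <= r -> r - Cmod (z - c) <= Cmod (circ c r t - z).
Proof.
  intros H. rewrite <- (Cmod_circ c r t) at 1 by auto.
  replace (circ c r t - z)%C with ((circ c r t - c) - (z - c))%C by ring. apply Cmod_lower.
Qed.

Lemma circ_neq (c z : C) (r t : R) : 0 <= r -> Cmod (z - c) < r -> (circ c r t - z)%C <> 0.
Proof. intros H1 H2. apply Cmod_gt_0. pose proof (circ_far c z r t H1). lra. Qed.

Lemma RtoC_neq (x : R) : x <> 0 -> RtoC x <> 0%C.
Proof. intros H E. apply H. injection E. auto. Qed.

Lemma two_pi_i_neq : (2 * PI * Ci)%C <> 0%C.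
Proof.
  pose proof PI_RGT_0. apply Cmult_neq_0; [apply Cmult_neq_0; apply RtoC_neq; lra|].
  apply Cmod_gt_0. rewrite Cmod_Ci. lra.
Qed.

(** Goursat for [Cinv] along the translation of the circle centred at [0] by [- s * (z - c)]: since
    [|z - c| < r] no translate meets [0]. On the centred circle the integrand is the constant
    [2 * PI * Ci]. *)
Lemma winding_integral (c z : C) (r : R) : 0 < r -> Cmod (z - c) < r ->
  Cint (fun t => / (circ c r t - z) * (2 * PI * Ci * (r * cis t)))%C 0 1 = (2 * PI * Ci)%C.
Proof.
  intros Hr Hz.
  pose proof (goursat_ruled (fun t => circ c r t - c)%C (fun _ => - (z - c))%C
    (fun t => 2 * PI * Ci * (r * cis t))%C (fun _ => 0)%C Cinv) as H.
  cbv beta in H. rewrite <- circ_0_1 in H.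
  assert (X : forall a b d : C, (a + b = a + d)%C -> b = d).
  { intros a b d E. replace b with (a + b - a)%C by ring. rewrite E. ring. }
  apply X in H.
  - transitivity (Cint (fun t => / (circ c r t - c + - (z - c)) * (2 * PI * Ci * (r * cis t) + 0))%C 0 1).
    + apply Cint_ext; [lra|]. intros t _. rewrite Cplus_0_r. do 2 f_equal. ring.
    + rewrite H.
      rewrite (Cint_ext _ (fun t => (2 * PI * Ci) * 1)%C).
      * rewrite (Cint_derive (fun t => (2 * PI * Ci) * t)%C); [ring|lra| |].
        -- intros t _. apply deriv_scal, (deriv_embed RtoC).
        -- intros t _. apply cont_const.
      * lra.
      * intros t _. replace (circ c r t - c)%C with (r * cis t)%C by (unfold circ; ring).
        field. split; [apply Cmod_gt_0; rewrite Cmod_cis; lra|apply RtoC_neq; lra].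
  - intros t. eapply deriv_eq; [apply (deriv_minus RtoC); [apply rderiv_circ|apply deriv_const]|ring].
  - intros t. apply deriv_const.
  - intros t. apply rcont_circ'.
  - intros t. apply cont_const.
  - intros s t Hs Ht. eexists. apply cderiv_inv. apply Cmod_gt_0.
    pose proof (Cmod_lower (circ c r t - c) (s * (z - c))) as L.
    rewrite Cmod_circ, Cmod_mult, Cmod_R, Rabs_pos_eq in L by lra.
    replace (circ c r t - c + s * - (z - c))%C with (circ c r t - c - s * (z - c))%C by ring.
    pose proof (Cmod_ge_0 (z - c)). nra.
Qed.

Lemma Cmod_small_0 (z : C) (K e0 : R) :
  0 < e0 -> (forall e, 0 < e < e0 -> Cmod z <= K * e) -> z = 0%C.
Proof.
  intros He H. apply Cmod_eq_0. apply NNPP. intros N. pose proof (Cmod_ge_0 z).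
  assert (KP : 0 < Rabs K + 1) by (pose proof (Rabs_pos K); lra).
  set (e := Rmin (e0 / 2) (Cmod z / (2 * (Rabs K + 1)))).
  assert (E1 : e <= e0 / 2) by apply Rmin_l.
  assert (E2 : e <= Cmod z / (2 * (Rabs K + 1))) by apply Rmin_r.
  assert (E3 : 0 < e) by (apply Rmin_pos; [lra|apply Rdiv_lt_0_compat; lra]).
  specialize (H e ltac:(lra)).
  assert (K * e <= (Rabs K + 1) * e) by (pose proof (Rle_abs K); nra).
  assert ((Rabs K + 1) * e <= Cmod z / 2).
  { replace (Cmod z / 2) with ((Rabs K + 1) * (Cmod z / (2 * (Rabs K + 1)))) by (field; lra).
    apply Rmult_le_compat_l; lra. }
  lra.
Qed.

Definition diff_on_cdisc (f : C -> C) (c : C) (r : R) : Prop :=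
  forall z, Cmod (z - c) <= r -> diff_at f z.

Lemma contin_circ (f : C -> C) (c : C) (r : R) :
  0 <= r -> diff_on_cdisc f c r -> contin (fun t => f (circ c r t)) 0 1.
Proof.
  intros Hr Hf t _. apply cont_compose; [apply rcont_circ|].
  apply diff_at_cont, Hf. rewrite Cmod_circ; lra.
Qed.

(** The difference quotient [g] has integral [0] over the circle: contracting the circle towards [z]
    does not change the integral, [g] stays bounded near [z], and the length of the contracted
    circle tends to [0]. Splitting [g] then leaves [winding_integral]. *)
Lemma cauchy_formula (f : C -> C) (c z : C) (r : R) :
  0 < r -> diff_on_cdisc f c r -> Cmod (z - c) < r ->
  f z = Cint (fun t => f (circ c r t) * (r * cis t) / (circ c r t - z))%C 0 1.
Proof.
  intros Hr Hf Hz.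
  set (ga := circ c r). set (dga := fun t => (2 * PI * Ci * (r * cis t))%C).
  set (g := fun y => ((f y - f z) / (y - z))%C).
  assert (Hn : forall t, (ga t - z)%C <> 0) by (intros; apply circ_neq; lra).
  assert (Cg : contin (fun t => g (ga t) * dga t)%C 0 1).
  { intros t Ht. apply cont_mult; [|apply rcont_circ'].
    apply cont_mult; [apply cont_minus; [exact (contin_circ f c r ltac:(lra) Hf t Ht)|apply cont_const]|].
    apply cont_inv; [apply cont_minus; [apply rcont_circ|apply cont_const]|apply Hn]. }
  assert (Z : Cint (fun t => g (ga t) * dga t)%C 0 1 = 0%C).
  { destruct (Hf z ltac:(lra)) as [l Hl]. destruct (Hl 1 ltac:(lra)) as [d [dp Hd]]. unfold idC in Hd.
    set (K := Cmod l + 1).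
    assert (HK : forall y, Cmod (y - z) < d -> y <> z -> Cmod (g y) <= K).
    { intros y Hy N. specialize (Hd y Hy). pose proof (Cmod_pos_neq _ _ N) as P.
      unfold g. rewrite Cmod_div by (apply Cmod_gt_0; auto).
      apply Rmult_le_reg_r with (Cmod (y - z)); auto. unfold Rdiv. rewrite Rmult_assoc, Rinv_l, Rmult_1_r by lra.
      replace (f y - f z)%C with ((f y - f z - l * (y - z)) + l * (y - z))%C by ring.
      eapply Rle_trans; [apply Cmod_triangle|]. rewrite Cmod_mult. unfold K. lra. }
    (* Points of the circle are at distance less than [2 * r] from [z], so contraction by
       [e < d / (2 * r)] brings them into the disc of radius [d] where [g] is bounded by [K]. *)
    apply Cmod_small_0 with (K * (2 * PI * r)) (Rmin 1 (d / (2 * r))).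
    { apply Rmin_pos; [lra|apply Rdiv_lt_0_compat; lra]. }
    intros e [e0 e1]. apply Rmin_Rgt in e1. destruct e1 as [e1 e2]. apply Rgt_lt in e1, e2.
    assert (e3 : e * (2 * r) < d).
    { replace d with (d / (2 * r) * (2 * r)) by (field; lra). apply Rmult_lt_compat_r; lra. }
    (* The surface between the contracted circle and the original one avoids [z], the only point
       where [g] may fail to be differentiable. *)
    pose proof (goursat_ruled (fun t => z + e * (ga t - z))%C (fun t => (1 - e) * (ga t - z))%C
      (fun t => e * dga t)%C (fun t => (1 - e) * dga t)%C g) as H.
    cbv beta in H. replace (ga 1) with (ga 0) in H by apply circ_0_1.
    assert (X : forall a b d : C, (a + b = a + d)%C -> b = d).
    { intros a b dd E. replace b with (a + b - a)%C by ring. rewrite E. ring. }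
    assert (Hga : forall t, 0 <= t <= 1 -> Cmod (ga t - z) < 2 * r).
    { intros t _. replace (ga t - z)%C with ((ga t - c) - (z - c))%C by ring.
      eapply Rle_lt_trans; [apply Cmod_triangle|]. rewrite Cmod_opp. unfold ga. rewrite Cmod_circ; lra. }
    assert (D1 : forall t, rderiv (fun t => ga t - z)%C t (dga t)).
    { intros t. eapply deriv_eq; [apply (deriv_minus RtoC); [apply rderiv_circ|apply deriv_const]|unfold dga; ring]. }
    apply X in H.
    - rewrite (Cint_ext _ (fun t => g (z + e * (ga t - z) + (1 - e) * (ga t - z)) * (e * dga t + (1 - e) * dga t))%C).
      2: lra. 2:{ intros t _. f_equal; [f_equal|]; ring. }
      rewrite H. replace (K * (2 * PI * r) * e) with ((1 - 0) * (K * (e * (2 * PI * r)))) by ring.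
      assert (NZ : forall t, (z + e * (ga t - z))%C <> z).
      { intros t E. apply (Cmult_neq_0 e (ga t - z)); [apply RtoC_neq; lra|apply Hn|].
        replace (e * (ga t - z))%C with (z + e * (ga t - z) - z)%C by ring. rewrite E. ring. }
      assert (Small : forall t, 0 <= t <= 1 -> Cmod (z + e * (ga t - z) - z) < d).
      { intros t Ht. replace (z + e * (ga t - z) - z)%C with (e * (ga t - z))%C by ring.
        rewrite Cmod_mult, Cmod_R, Rabs_pos_eq by lra. specialize (Hga t Ht).
        pose proof (Cmod_ge_0 (ga t - z)). nra. }
      apply Cint_bound; [lra| |].
      + intros t Ht. apply cont_mult.
        * apply (cont_compose RtoC (fun t => z + e * (ga t - z))%C g).
          -- apply cont_plus; [apply cont_const|]. apply cont_mult; [apply cont_const|].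
             eapply deriv_cont; apply D1.
          -- apply diff_at_cont. apply (diff_at_div (fun y => f y - f z)%C (fun y => y - z)%C).
             ++ apply diff_at_minus; [|apply diff_at_const]. apply Hf.
                replace (z + e * (ga t - z) - c)%C with ((1 - e)%R * (z - c) + e * (ga t - c))%C by (rewrite RtoC_minus; ring).
                eapply Rle_trans; [apply Cmod_triangle|]. rewrite !Cmod_mult, !Cmod_R, !Rabs_pos_eq by lra.
                unfold ga; rewrite Cmod_circ by lra. pose proof (Cmod_ge_0 (z-c)). nra.
             ++ apply diff_at_minus; [apply diff_at_id|apply diff_at_const].
             ++ apply Cmod_gt_0, Cmod_pos_neq, NZ.
        * apply cont_mult; [apply cont_const|apply rcont_circ'].
      + intros t Ht. rewrite Cmod_mult. apply Rmult_le_compat; try apply Cmod_ge_0.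
        * apply HK; auto.
        * unfold dga. pose proof PI_RGT_0.
          rewrite !Cmod_mult, !Cmod_R, Cmod_Ci, Cmod_cis, !Rabs_pos_eq by lra. right; ring.
    - intros t. eapply deriv_eq; [apply (deriv_plus RtoC); [apply deriv_const|apply deriv_scal, D1]|ring].
    - intros t. apply deriv_scal, D1.
    - intros t. apply cont_mult; [apply cont_const|apply rcont_circ'].
    - intros t. apply cont_mult; [apply cont_const|apply rcont_circ'].
    - intros s t Hs Ht.
      replace (z + e * (ga t - z) + s * ((1 - e) * (ga t - z)))%C with (z + (e + s * (1 - e))%R * (ga t - z))%C
        by (rewrite RtoC_plus, RtoC_mult, RtoC_minus; ring).
      set (v := e + s * (1 - e)).
      assert (Hv : 0 < v <= 1) by (unfold v; nra).
      apply (diff_at_div (fun y => f y - f z)%C (fun y => y - z)%C).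
      + apply diff_at_minus; [|apply diff_at_const]. apply Hf.
        replace (z + v * (ga t - z) - c)%C with ((1 - v)%R * (z - c) + v * (ga t - c))%C by (rewrite RtoC_minus; ring).
        eapply Rle_trans; [apply Cmod_triangle|]. rewrite !Cmod_mult, !Cmod_R, !Rabs_pos_eq by lra.
        unfold ga; rewrite Cmod_circ by lra. pose proof (Cmod_ge_0 (z-c)). nra.
      + apply diff_at_minus; [apply diff_at_id|apply diff_at_const].
      + replace (z + v * (ga t - z) - z)%C with (v * (ga t - z))%C by ring.
        apply Cmult_neq_0; [apply RtoC_neq; lra|apply Hn]. }
  assert (C1 : contin (fun t => f (ga t) * (r * cis t) / (ga t - z))%C 0 1).
  { intros t Ht. apply cont_mult.
    - apply cont_mult; [exact (contin_circ f c r ltac:(lra) Hf t Ht)|].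
      apply cont_mult; [apply cont_const|apply rcont_cis].
    - apply cont_inv; [apply cont_minus; [apply rcont_circ|apply cont_const]|apply Hn]. }
  assert (C2 : contin (fun t => / (ga t - z) * dga t)%C 0 1).
  { intros t Ht. apply cont_mult; [|apply rcont_circ'].
    apply cont_inv; [apply cont_minus; [apply rcont_circ|apply cont_const]|apply Hn]. }
  rewrite (Cint_ext _ (fun t => (2 * PI * Ci) * (f (ga t) * (r * cis t) / (ga t - z))
                       - f z * (/ (ga t - z) * dga t))%C) in Z; [|lra|].
  2:{ intros t _. unfold g, dga. field. apply Hn. }
  rewrite Cint_minus, !Cint_scal in Z; auto; try lra; try (apply contin_scal; auto).
  assert (W0 : Cint (fun t => / (ga t - z) * dga t)%C 0 1 = (2 * PI * Ci)%C) by exact (winding_integral c z r Hr Hz).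
  rewrite W0 in Z. fold ga. pose proof two_pi_i_neq as W.
  set (I := Cint (fun t : R => (f (ga t) * (r * cis t) / (ga t - z))%C) 0 1) in *.
  set (w := (2 * PI * Ci)%C) in *.
  replace (f z) with (f z * w / w)%C by (field; auto).
  replace (f z * w)%C with (w * I - (w * I - f z * w))%C by ring. rewrite Z. field; auto.
Qed.

(** * Consequences of Cauchy's formula *)

(** The remainder is assumed quadratic uniformly in [t]; this explicit bound takes the place of a
    uniform continuity argument for differentiating under the integral. *)
Lemma cderiv_Cint_param (K : C -> R -> C) (K' : R -> C) (z : C) (M d : R) :
  0 < d ->
  (forall y, Cmod (y - z) < d -> contin (K y) 0 1) -> contin K' 0 1 ->
  (forall y t, Cmod (y - z) < d -> 0 <= t <= 1 ->
     Cmod (K y t - K z t - K' t * (y - z)) <= M * (Cmod (y - z) * Cmod (y - z))) ->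
  cderiv (fun y => Cint (K y) 0 1) z (Cint K' 0 1).
Proof.
  intros Hd HK HK' HM e He.
  assert (MP : 0 < Rabs M + 1) by (pose proof (Rabs_pos M); lra).
  exists (Rmin d (e / (Rabs M + 1))). split; [apply Rmin_pos; auto; apply Rdiv_lt_0_compat; auto|].
  unfold idC. intros y Hy. apply Rmin_Rgt in Hy. destruct Hy as [H1 H2]. apply Rgt_lt in H1, H2.
  assert (Hz : Cmod (z - z) < d) by (rewrite Cmod_self; auto).
  assert (E : (Cint (K y) 0 1 - Cint (K z) 0 1 - Cint K' 0 1 * (y - z)
     = Cint (fun t => K y t - K z t - (y - z) * K' t) 0 1)%C).
  { rewrite (Cint_minus (fun t => K y t - K z t)%C), Cint_minus, Cint_scal; auto; try lra.
    - ring.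
    - intros t Ht. apply cont_minus; [exact (HK y H1 t Ht)|exact (HK z Hz t Ht)].
    - apply contin_scal; auto. }
  rewrite E. apply Rle_trans with ((1 - 0) * (M * (Cmod (y - z) * Cmod (y - z)))).
  - apply Cint_bound; [lra| |].
    + intros t Ht. apply cont_minus; [apply cont_minus; [exact (HK y H1 t Ht)|exact (HK z Hz t Ht)]|].
      exact (contin_scal _ _ _ _ HK' t Ht).
    + intros t Ht. rewrite (Cmult_comm (y - z)). auto.
  - pose proof (Cmod_ge_0 (y - z)). pose proof (Rle_abs M).
    assert (Cmod (y - z) * (Rabs M + 1) <= e).
    { replace e with (e / (Rabs M + 1) * (Rabs M + 1)) by (field; lra). apply Rmult_le_compat_r; lra. }
    replace ((1 - 0) * (M * (Cmod (y - z) * Cmod (y - z)))) with ((M * Cmod (y - z)) * Cmod (y - z)) by ring.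
    apply Rmult_le_compat_r; auto. nra.
Qed.

Section CauchyType.

Variables (c : C) (r : R) (phi : R -> C).
Hypothesis Hr : 0 < r.
Hypothesis Hphi : contin phi 0 1.
Let k (y : C) (t : R) : C := (/ (circ c r t - y))%C.

Lemma kernel_cont (y : C) (t : R) : Cmod (y - c) < r -> rcont (k y) t.
Proof.
  intros Hy. apply cont_inv; [apply cont_minus; [apply rcont_circ|apply cont_const]|].
  apply circ_neq; lra.
Qed.

Lemma kernel_bound (z y : C) (t : R) :
  Cmod (y - z) < (r - Cmod (z - c)) / 2 -> Cmod (k y t) <= 2 / (r - Cmod (z - c)).
Proof.
  intros Hy. set (d := r - Cmod (z - c)) in *.
  assert (0 < d) by (pose proof (Cmod_ge_0 (y - z)); lra).
  assert (H1 : d / 2 <= Cmod (circ c r t - y)).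
  { pose proof (circ_far c y r t ltac:(lra)).
    pose proof (Cmod_triangle (y - z) (z - c)) as T. replace (y - z + (z - c))%C with (y - c)%C in T by ring.
    unfold d in *. lra. }
  unfold k. rewrite Cmod_inv by (apply Cmod_gt_0; lra).
  replace (2 / d) with (/ (d / 2)) by (field; lra). apply Rinv_le_contravar; lra.
Qed.

Lemma kernel_inside (z y : C) :
  Cmod (z - c) < r -> Cmod (y - z) < (r - Cmod (z - c)) / 2 -> Cmod (y - c) < r.
Proof.
  intros Hz Hy. pose proof (Cmod_triangle (y - z) (z - c)) as T.
  replace (y - z + (z - c))%C with (y - c)%C in T by ring. lra.
Qed.

(** The density [phi] is any continuous function on the circle: it is instantiated with
    [f * (r * cis)] to differentiate Cauchy's formula, and with [f] alone to remove the singularity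
    of a difference quotient. *)
Lemma cderiv_cauchy_type_1 (z : C) : Cmod (z - c) < r ->
  cderiv (fun y => Cint (fun t => phi t * k y t)%C 0 1) z (Cint (fun t => phi t * (k z t * k z t))%C 0 1).
Proof.
  intros Hz. destruct (contin_bounded phi 0 1 ltac:(lra) Hphi) as [B [BP HB]].
  set (q := 2 / (r - Cmod (z - c))).
  assert (qp : 0 < q) by (apply Rdiv_lt_0_compat; lra).
  apply cderiv_Cint_param with (B * (q * (q * q))) ((r - Cmod (z - c)) / 2); [lra| | |].
  - intros y Hy t Ht. apply cont_mult; auto. apply kernel_cont. apply kernel_inside with z; auto.
  - intros t Ht. apply cont_mult; auto. apply cont_mult; apply kernel_cont; auto.
  - intros y t Hy Ht.
    assert (N1 : (circ c r t - y)%C <> 0) by (apply circ_neq; [lra|apply kernel_inside with z; auto]).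
    assert (N2 : (circ c r t - z)%C <> 0) by (apply circ_neq; lra).
    replace (phi t * k y t - phi t * k z t - phi t * (k z t * k z t) * (y - z))%C
      with (phi t * (k y t * (k z t * k z t)) * ((y - z) * (y - z)))%C by (unfold k; field; auto).
    rewrite !Cmod_mult. apply Rmult_le_compat_r; [apply Rmult_le_pos; apply Cmod_ge_0|].
    assert (b1 : Cmod (k y t) <= q) by (apply kernel_bound; auto).
    assert (b2 : Cmod (k z t) <= q) by (apply kernel_bound; rewrite Cmod_self; lra).
    repeat apply Rmult_le_compat; auto; repeat apply Rmult_le_pos; try apply Cmod_ge_0.
Qed.

Lemma cderiv_cauchy_type_2 (z : C) : Cmod (z - c) < r ->
  diff_at (fun y => Cint (fun t => phi t * (k y t * k y t))%C 0 1) z.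
Proof.
  intros Hz. destruct (contin_bounded phi 0 1 ltac:(lra) Hphi) as [B [BP HB]].
  set (q := 2 / (r - Cmod (z - c))).
  assert (qp : 0 < q) by (apply Rdiv_lt_0_compat; lra).
  exists (Cint (fun t => phi t * (2 * (k z t * (k z t * k z t))))%C 0 1).
  apply cderiv_Cint_param with (B * (q * (q * q)) * (3 * q)) ((r - Cmod (z - c)) / 2); [lra| | |].
  - intros y Hy t Ht. assert (Cmod (y - c) < r) by (apply kernel_inside with z; auto).
    apply cont_mult; auto. apply cont_mult; apply kernel_cont; auto.
  - intros t Ht. apply cont_mult; auto. apply cont_mult; [apply cont_const|].
    repeat apply cont_mult; apply kernel_cont; auto.
  - intros y t Hy Ht.
    assert (N1 : (circ c r t - y)%C <> 0) by (apply circ_neq; [lra|apply kernel_inside with z; auto]).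
    assert (N2 : (circ c r t - z)%C <> 0) by (apply circ_neq; lra).
    replace (phi t * (k y t * k y t) - phi t * (k z t * k z t) - phi t * (2 * (k z t * (k z t * k z t))) * (y - z))%C
      with (phi t * (k y t * (k z t * k z t)) * (k y t + 2 * k z t) * ((y - z) * (y - z)))%C by (unfold k; field; auto).
    assert (b1 : Cmod (k y t) <= q) by (apply kernel_bound; auto).
    assert (b2 : Cmod (k z t) <= q) by (apply kernel_bound; rewrite Cmod_self; lra).
    assert (b3 : Cmod (k y t + 2 * k z t) <= 3 * q).
    { eapply Rle_trans; [apply Cmod_triangle|]. rewrite Cmod_mult, Cmod_R, Rabs_pos_eq by lra. lra. }
    rewrite !Cmod_mult. apply Rmult_le_compat_r; [apply Rmult_le_pos; apply Cmod_ge_0|].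
    repeat apply Rmult_le_compat; auto; repeat apply Rmult_le_pos; try apply Cmod_ge_0.
Qed.

End CauchyType.

Lemma circ_diff_contin (f : C -> C) (c : C) (r : R) :
  0 < r -> diff_on_cdisc f c r -> contin (fun t => f (circ c r t) * (r * cis t))%C 0 1.
Proof.
  intros Hr Hf t Ht. apply cont_mult; [exact (contin_circ f c r ltac:(lra) Hf t Ht)|].
  apply cont_mult; [apply cont_const|apply rcont_cis].
Qed.

Lemma near_in_disc (c z : C) (r : R) : Cmod (z - c) < r ->
  exists d, 0 < d /\ forall y, Cmod (y - z) < d -> Cmod (y - c) < r.
Proof.
  intros Hz. exists (r - Cmod (z - c)). split; [lra|]. intros y Hy.
  pose proof (Cmod_triangle (y - z) (z - c)) as T.
  replace (y - z + (z - c))%C with (y - c)%C in T by ring. lra.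
Qed.

Lemma cauchy_formula_D (f : C -> C) (c z : C) (r : R) :
  0 < r -> diff_on_cdisc f c r -> Cmod (z - c) < r ->
  C_derive f z = Cint (fun t => f (circ c r t) * (r * cis t) * (/ (circ c r t - z) * / (circ c r t - z)))%C 0 1.
Proof.
  intros Hr Hf Hz. apply cderiv_D_eq.
  eapply deriv_ext_loc; [|apply cderiv_cauchy_type_1; auto; apply circ_diff_contin; auto].
  destruct (near_in_disc c z r Hz) as [d [P Q]]. exists d. split; auto. intros y Hy. symmetry.
  apply (cauchy_formula f c y r); auto.
Qed.

Lemma diff_at_D_disc (f : C -> C) (c z : C) (r : R) :
  0 < r -> diff_on_cdisc f c r -> Cmod (z - c) < r -> diff_at (C_derive f) z.
Proof.
  intros Hr Hf Hz.
  eapply diff_at_ext_loc; [|apply (cderiv_cauchy_type_2 c r _ Hr (circ_diff_contin f c r Hr Hf) z Hz)].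
  destruct (near_in_disc c z r Hz) as [d [P Q]]. exists d. split; auto. intros y Hy. symmetry.
  apply cauchy_formula_D; auto.
Qed.

(** Openness phrased with closed discs, so that the bounding circle of a chosen disc lies in the set
    too. *)
Definition nbhd_set (U : C -> Prop) : Prop :=
  forall z, U z -> exists r, 0 < r /\ forall y, Cmod (y - z) <= r -> U y.

Definition hol (U : C -> Prop) (f : C -> C) : Prop := forall z, U z -> diff_at f z.

Definition odisc (c : C) (r : R) : C -> Prop := fun z => Cmod (z - c) < r.

Lemma nbhd_odisc (c : C) (r : R) : nbhd_set (odisc c r).
Proof.
  intros z Hz. destruct (near_in_disc c z r Hz) as [d [P Q]]. exists (d / 2). split; [lra|].
  intros y Hy. apply Q. lra.
Qed.

Lemma hol_D (U : C -> Prop) (f : C -> C) : nbhd_set U -> hol U f -> hol U (C_derive f).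
Proof.
  intros HU Hf z Hz. destruct (HU z Hz) as [r [P Q]].
  apply (diff_at_D_disc f z z r); auto; [|rewrite Cmod_self; auto]. intros y Hy. auto.
Qed.

(** Division of [f - f a] by [z - a] with the singularity filled in. Its holomorphy replaces power
    series in Schwarz's lemma, in the Hurwitz argument and in Liouville's theorem. *)
Definition quot (f : C -> C) (a z : C) : C :=
  if excluded_middle_informative (z = a) then C_derive f a else ((f z - f a) / (z - a))%C.

Lemma quot_self (f : C -> C) (a : C) : quot f a a = C_derive f a.
Proof. unfold quot. destruct excluded_middle_informative; tauto. Qed.

Lemma quot_neq (f : C -> C) (a z : C) : z <> a -> quot f a z = ((f z - f a) / (z - a))%C.
Proof. intros. unfold quot. destruct excluded_middle_informative; tauto. Qed.

Lemma Cminus_neq (z a : C) : z <> a -> (z - a)%C <> 0%C.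
Proof. intros N. apply Cmod_gt_0, Cmod_pos_neq, N. Qed.

Lemma quot_spec (f : C -> C) (a z : C) : f z = (f a + (z - a) * quot f a z)%C.
Proof.
  destruct (excluded_middle_informative (z = a)) as [->|N].
  - ring.
  - rewrite quot_neq by auto. field. apply Cminus_neq; auto.
Qed.

Lemma quot_diff_other (f : C -> C) (a z : C) : z <> a -> diff_at f z -> diff_at (quot f a) z.
Proof.
  intros N H. apply diff_at_ext_loc with (fun y => (f y - f a) / (y - a))%C.
  - exists (Cmod (z - a)). split; [apply Cmod_pos_neq; auto|]. intros y Hy. rewrite quot_neq; auto.
    intros ->. rewrite Cmod_sub_sym in Hy. lra.
  - apply (diff_at_div (fun y => f y - f a)%C (fun y => y - a)%C).
    + apply diff_at_minus; [auto|apply diff_at_const].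
    + apply diff_at_minus; [apply diff_at_id|apply diff_at_const].
    + apply Cminus_neq; auto.
Qed.

(** On a circle centred at [a] the factor [r * cis t] of Cauchy's formula equals [circ a r t - a]
    and cancels. What remains is a Cauchy-type integral with density [f], regular at [z = a] as
    well. *)
Lemma quot_cauchy (f : C -> C) (a z : C) (r : R) :
  0 < r -> diff_on_cdisc f a r -> Cmod (z - a) < r ->
  quot f a z = Cint (fun t => f (circ a r t) * / (circ a r t - z))%C 0 1.
Proof.
  intros Hr Hf Hz.
  assert (Ha : Cmod (a - a) < r) by (rewrite Cmod_self; auto).
  assert (NC : forall t, (r * cis t)%C <> 0).
  { intros t. apply Cmult_neq_0; [apply RtoC_neq; lra|]. apply Cmod_gt_0. rewrite Cmod_cis. lra. }
  assert (EC : forall t, (circ a r t - a = r * cis t)%C) by (intros; unfold circ; ring).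
  destruct (excluded_middle_informative (z = a)) as [->|N].
  - rewrite quot_self, (cauchy_formula_D f a a r) by auto.
    apply Cint_ext; [lra|]. intros t _. rewrite EC. specialize (NC t).
    replace (f (circ a r t) * (r * cis t) * (/ (r * cis t) * / (r * cis t)))%C
      with (f (circ a r t) * ((r * cis t) * / (r * cis t)) * / (r * cis t))%C by ring.
    rewrite Cinv_r by auto. ring.
  - rewrite quot_neq, (cauchy_formula f a z r), (cauchy_formula f a a r) by auto.
    pose proof (Cminus_neq _ _ N) as N'.
    assert (CT : forall y, Cmod (y - a) < r -> contin (fun t => f (circ a r t) * (r * cis t) / (circ a r t - y))%C 0 1).
    { intros y Hy t Ht. apply cont_mult; [exact (circ_diff_contin f a r Hr Hf t Ht)|apply kernel_cont; auto]. }
    rewrite <- Cint_minus; auto; [|lra].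
    rewrite (Cint_ext _ (fun t => (z - a) * (f (circ a r t) * / (circ a r t - z)))%C); [|lra|].
    2:{ intros t _. rewrite EC. pose proof (NC t) as N1. pose proof (circ_neq a z r t ltac:(lra) Hz) as N2.
        replace (r * cis t)%C with (circ a r t - a)%C in N1 |- * by (unfold circ; ring).
        field. auto. }
    rewrite Cint_scal; [field; auto|lra|].
    intros t Ht. apply cont_mult; [exact (contin_circ f a r ltac:(lra) Hf t Ht)|apply kernel_cont; auto].
Qed.

Lemma hol_quot (U : C -> Prop) (f : C -> C) (a : C) : nbhd_set U -> hol U f -> hol U (quot f a).
Proof.
  intros HU Hf z Hz. destruct (excluded_middle_informative (z = a)) as [->|N].
  - destruct (HU a Hz) as [r [P Q]].
    assert (Hd : diff_on_cdisc f a r) by (intros y Hy; auto).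
    eapply diff_at_ext_loc.
    2:{ eexists. apply (cderiv_cauchy_type_1 a r (fun t => f (circ a r t))); auto.
        - apply contin_circ; auto; lra.
        - rewrite Cmod_self. auto. }
    exists r. split; auto. intros y Hy. symmetry. apply quot_cauchy; auto.
  - apply quot_diff_other; auto.
Qed.

(** * Maximum modulus, Schwarz's lemma and primitives *)

Lemma max_modulus_circ (f : C -> C) (c z : C) (r M : R) :
  0 < r -> diff_on_cdisc f c r -> (forall t, 0 <= t <= 1 -> Cmod (f (circ c r t)) <= M) ->
  Cmod (z - c) < r -> Cmod (f z) <= M.
Proof.
  intros Hr Hf HM Hz. apply Rnot_lt_le. intros Hlt.
  assert (M0 : 0 <= M) by (eapply Rle_trans; [apply Cmod_ge_0|apply (HM 0); lra]).
  set (d := r - Cmod (z - c)). assert (dp : 0 < d) by (unfold d; lra).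
  (* Cauchy's formula for f^n loses a factor r / d independent of n *)
  assert (HP : forall n, Cmod (f z) ^ n * d <= M ^ n * r).
  { intros n.
    assert (Hfn : diff_on_cdisc (fun y => f y ^ n)%C c r) by (intros y Hy; apply diff_at_pow; auto).
    rewrite <- Cmod_pow, (cauchy_formula (fun y => f y ^ n)%C c z r); auto.
    apply Rmult_le_reg_r with (/ d); [apply Rinv_0_lt_compat; auto|].
    rewrite Rmult_assoc, Rinv_r, Rmult_1_r by lra.
    replace (M ^ n * r * / d) with ((1 - 0) * (M ^ n * r * / d)) by ring.
    apply Cint_bound; [lra| |].
    - intros t Ht. apply cont_mult; [exact (circ_diff_contin _ c r Hr Hfn t Ht)|apply kernel_cont; auto].
    - intros t Ht. pose proof (circ_far c z r t ltac:(lra)) as F. fold d in F.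
      rewrite Cmod_div by (apply circ_neq; lra).
      rewrite !Cmod_mult, Cmod_R, Cmod_cis, Rabs_pos_eq, Rmult_1_r, Cmod_pow by lra.
      apply Rmult_le_compat.
      + apply Rmult_le_pos; [apply pow_le, Cmod_ge_0|lra].
      + apply Rlt_le, Rinv_0_lt_compat. lra.
      + apply Rmult_le_compat_r; [lra|]. apply pow_incr. split; [apply Cmod_ge_0|auto].
      + apply Rinv_le_contravar; auto. }
  set (x := Cmod (f z)) in *. set (y := (M + x) / 2).
  assert (Hy : 0 < y < x) by (unfold y; lra).
  destruct (pow_lt_1_zero (y / x)) with (y := d / r) as [n Hn].
  { rewrite Rabs_pos_eq; [|apply Rlt_le, Rdiv_lt_0_compat; lra].
    apply Rmult_lt_reg_r with x; [lra|]. unfold Rdiv. rewrite Rmult_assoc, Rinv_l by lra. lra. }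
  { apply Rdiv_lt_0_compat; lra. }
  specialize (Hn n (Nat.le_refl n)). rewrite Rabs_pos_eq in Hn by (apply pow_le, Rlt_le, Rdiv_lt_0_compat; lra).
  specialize (HP n).
  assert (xn : 0 < x ^ n) by (apply pow_lt; lra).
  assert (A : M ^ n <= y ^ n) by (apply pow_incr; unfold y; lra).
  unfold Rdiv in Hn. rewrite Rpow_mult_distr, pow_inv in Hn.
  assert (B : y ^ n * r < d * x ^ n).
  { apply (Rmult_lt_compat_r (x ^ n * r)) in Hn; [|nra].
    replace (y ^ n * / x ^ n * (x ^ n * r)) with (y ^ n * r) in Hn by (field; lra).
    replace (d * / r * (x ^ n * r)) with (d * x ^ n) in Hn by (field; lra). exact Hn. }
  nra.
Qed.

Lemma disc_closed_diff (f : C -> C) (c : C) (r R0 : R) :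
  r < R0 -> hol (odisc c R0) f -> diff_on_cdisc f c r.
Proof. intros H Hf z Hz. apply Hf. unfold odisc. lra. Qed.

Lemma max_modulus (f : C -> C) (c z : C) (r M : R) :
  0 < r -> diff_on_cdisc f c r -> (forall y, Cmod (y - c) = r -> Cmod (f y) <= M) ->
  Cmod (z - c) <= r -> Cmod (f z) <= M.
Proof.
  intros Hr Hf HM Hz. destruct (Rle_lt_or_eq_dec _ _ Hz) as [L|E]; auto.
  apply (max_modulus_circ f c z r M); auto. intros t _. apply HM. apply Cmod_circ. lra.
Qed.

Lemma min_modulus_center (f : C -> C) (c : C) (r m : R) :
  0 < r -> 0 < m -> diff_on_cdisc f c r -> (forall y, Cmod (y - c) <= r -> f y <> 0%C) ->
  (forall t, 0 <= t <= 1 -> m <= Cmod (f (circ c r t))) -> m <= Cmod (f c).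
Proof.
  intros Hr Hm Hf N H.
  assert (Hc : Cmod (c - c) < r) by (rewrite Cmod_self; auto).
  assert (B : Cmod (/ f c) <= / m).
  { apply (max_modulus_circ (fun y => / f y)%C c c r); auto.
    - intros y Hy. apply diff_at_inv; auto.
    - intros t Ht. rewrite Cmod_inv.
      + apply Rinv_le_contravar; auto.
      + apply N. rewrite Cmod_circ; lra. }
  assert (N0 : f c <> 0%C) by (apply N; lra).
  rewrite Cmod_inv in B by auto. assert (0 < Cmod (f c)) by (apply Cmod_gt_0; auto).
  rewrite <- (Rinv_inv m), <- (Rinv_inv (Cmod (f c))). apply Rinv_le_contravar; auto.
  apply Rinv_0_lt_compat; auto.
Qed.

Lemma cdisc_bounded (f : C -> C) (c : C) (r : R) :
  0 < r -> diff_on_cdisc f c r -> exists M, 0 < M /\ forall z, Cmod (z - c) < r -> Cmod (f z) <= M.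
Proof.
  intros Hr Hf. destruct (contin_bounded (fun t => f (circ c r t)) 0 1) as [M [P Q]]; [lra|apply contin_circ; auto; lra|].
  exists M. split; auto. intros z Hz. apply (max_modulus_circ f c z r M); auto.
Qed.

(** Passage to the limit [r -> R0], used to reach the full radius in Schwarz's lemma. *)
Lemma mult_le_at_sup (x y rho R0 : R) :
  0 <= x -> rho < R0 -> (forall r, rho < r < R0 -> x * r <= y) -> x * R0 <= y.
Proof.
  intros Hx Hr H. apply Rnot_lt_le. intros L.
  destruct (Req_dec x 0) as [->|N].
  - specialize (H ((rho + R0) / 2) ltac:(lra)). lra.
  - set (e := Rmin ((x * R0 - y) / (2 * x)) ((R0 - rho) / 2)).
    assert (E1 : e <= (x * R0 - y) / (2 * x)) by apply Rmin_l.
    assert (E2 : e <= (R0 - rho) / 2) by apply Rmin_r.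
    assert (E3 : 0 < e) by (apply Rmin_pos; [apply Rdiv_lt_0_compat; lra|lra]).
    specialize (H (R0 - e) ltac:(lra)).
    assert (x * e <= (x * R0 - y) / 2).
    { replace ((x * R0 - y) / 2) with (x * ((x * R0 - y) / (2 * x))) by (field; auto).
      apply Rmult_le_compat_l; auto. }
    nra.
Qed.

Lemma schwarz (f : C -> C) (c z : C) (R0 M : R) :
  hol (odisc c R0) f -> (forall y, odisc c R0 y -> Cmod (f y) <= M) -> f c = 0%C ->
  odisc c R0 z -> Cmod (f z) * R0 <= M * Cmod (z - c).
Proof.
  intros Hf HM H0 Hz. unfold odisc in *.
  apply mult_le_at_sup with (Cmod (z - c)); auto; [apply Cmod_ge_0|].
  intros r [r1 r2].
  assert (rp : 0 < r) by (pose proof (Cmod_ge_0 (z - c)); lra).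
  assert (Hq : Cmod (quot f c z) <= M / r).
  { apply (max_modulus (quot f c) c z r); auto; [| |lra].
    - apply disc_closed_diff with R0; auto. apply hol_quot; auto. apply nbhd_odisc.
    - intros y Hy. rewrite quot_neq.
      + rewrite H0, Cmod_div, Hy by (apply Cmod_gt_0; lra).
        replace (f y - 0)%C with (f y) by ring.
        apply Rmult_le_compat_r; [apply Rlt_le, Rinv_0_lt_compat; auto|]. apply HM. lra.
      + intros ->. rewrite Cmod_self in Hy. lra. }
  rewrite (quot_spec f c z), H0, Cplus_0_l, Cmod_mult.
  apply Rle_trans with (Cmod (z - c) * (M / r) * r).
  - apply Rmult_le_compat_r; [lra|]. apply Rmult_le_compat_l; [apply Cmod_ge_0|auto].
  - right. field. lra.
Qed.

Lemma mean_value_ineq (f : C -> C) (U : C -> Prop) (a b : C) (M : R) :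
  nbhd_set U -> hol U f ->
  (forall t, 0 <= t <= 1 -> U (a + t * (b - a))%C /\ Cmod (C_derive f (a + t * (b - a))%C) <= M) ->
  Cmod (f b - f a) <= M * Cmod (b - a).
Proof.
  intros HU Hf H.
  assert (Dg : forall t, rderiv (fun t => a + t * (b - a))%C t (b - a)%C).
  { intros t. eapply deriv_eq.
    - apply (deriv_plus RtoC); [apply deriv_const|].
      apply (deriv_mult RtoC RtoC (fun _ => b - a)%C); [apply deriv_embed|apply deriv_const].
    - ring. }
  assert (Cg : contin (fun t => C_derive f (a + t * (b - a)) * (b - a))%C 0 1).
  { intros t Ht. apply cont_mult; [|apply cont_const].
    apply (cont_compose RtoC (fun t => a + t * (b - a))%C (C_derive f)); [eapply deriv_cont; apply Dg|].
    apply diff_at_cont. apply (hol_D U f HU Hf). apply H; auto. }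
  replace (f b - f a)%C with (f (a + 1 * (b - a)) - f (a + 0 * (b - a)))%C by (f_equal; [f_equal|f_equal; f_equal]; ring).
  rewrite <- (Cint_derive (fun t => f (a + t * (b - a)))%C (fun t => C_derive f (a + t * (b - a)) * (b - a))%C); auto; [|lra|].
  - replace (M * Cmod (b - a)) with ((1 - 0) * (M * Cmod (b - a))) by ring.
    apply Cint_bound; [lra|auto|]. intros t Ht. rewrite Cmod_mult.
    apply Rmult_le_compat_r; [apply Cmod_ge_0|]. apply H; auto.
  - intros t Ht. apply (deriv_comp RtoC (fun t => a + t * (b - a))%C f); auto.
    apply diff_at_D, Hf, H; auto.
Qed.

Lemma disc_convex (c a b : C) (r t : R) :
  odisc c r a -> odisc c r b -> 0 <= t <= 1 -> odisc c r (a + t * (b - a))%C.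
Proof.
  unfold odisc. intros Ha Hb Ht.
  replace (a + t * (b - a) - c)%C with ((1 - t)%R * (a - c) + t * (b - c))%C by (rewrite RtoC_minus; ring).
  eapply Rle_lt_trans; [apply Cmod_triangle|]. rewrite !Cmod_mult, !Cmod_R, !Rabs_pos_eq by lra.
  destruct (Req_dec t 0) as [->|]; [lra|]. nra.
Qed.

Lemma rderiv_segment (a b : C) (t : R) : rderiv (fun t => a + t * b)%C t b.
Proof.
  eapply deriv_eq.
  - apply (deriv_plus RtoC); [apply deriv_const|].
    apply (deriv_mult RtoC RtoC (fun _ => b)%C); [apply deriv_embed|apply deriv_const].
  - ring.
Qed.

(** The primitive is the integral along the radius from [c]. By Goursat on the triangle [c], [a],
    [b], its increment from [a] to [b] is the integral over the segment from [a] to [b]. *)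
Lemma hol_primitive (f : C -> C) (c : C) (R0 : R) :
  hol (odisc c R0) f -> exists F : C -> C, forall z, odisc c R0 z -> cderiv F z (f z).
Proof.
  intros Hf. exists (fun z => Cint (fun s => f (c + s * (z - c)) * (z - c))%C 0 1).
  intros a Ha.
  assert (Hc : odisc c R0 c).
  { unfold odisc in *. rewrite Cmod_self. pose proof (Cmod_ge_0 (a - c)). lra. }
  assert (Seg : forall b, odisc c R0 b ->
    (Cint (fun s => f (c + s * (b - c)) * (b - c))%C 0 1 - Cint (fun s => f (c + s * (a - c)) * (a - c))%C 0 1
     = Cint (fun t => f (a + t * (b - a)) * (b - a))%C 0 1)%C).
  { intros b Hb.
    (* With [al] constant the edge [s = 0] degenerates to the vertex [c] and contributes [0]. *)
    pose proof (goursat_ruled (fun _ => c) (fun t => (a - c) + t * (b - a))%C (fun _ => 0%C) (fun _ => (b - a)%C) f) as H.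
    cbv beta in H. specialize (H ltac:(intros; apply deriv_const) ltac:(intros; apply rderiv_segment)
      ltac:(intros; apply cont_const) ltac:(intros; apply cont_const)).
    replace (a - c + 0 * (b - a))%C with (a - c)%C in H by ring.
    replace (a - c + 1 * (b - a))%C with (b - c)%C in H by ring.
    rewrite (Cint_ext (fun t => f c * 0)%C (fun _ => 0%C)) in H by (try lra; intros; ring).
    assert (Z : Cint (fun _ => 0%C) 0 1 = 0%C).
    { rewrite (Cint_derive (fun _ => 0%C) (fun _ => 0%C)); [ring|lra| |].
      - intros; apply deriv_const.
      - intros t _; apply cont_const. }
    rewrite Z, Cplus_0_r in H.
    rewrite (Cint_ext (fun t => f (a + t * (b - a)) * (b - a))%C
       (fun t => f (c + (a - c + t * (b - a))) * (0 + (b - a)))%C); [|lra|].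
    2:{ intros t _. f_equal; [f_equal|]; ring. }
    rewrite <- H; [ring|].
    intros s t Hs Ht. apply Hf.
    replace (c + s * (a - c + t * (b - a)))%C with (c + s * ((a + t * (b - a)) - c))%C by ring.
    apply disc_convex; auto. apply disc_convex; auto. }
  intros e He. unfold idC.
  destruct (diff_at_cont f a (Hf a Ha) e He) as [d1 [P1 Q1]]. unfold idC in Q1.
  destruct (near_in_disc c a R0 Ha) as [d2 [P2 Q2]].
  exists (Rmin d1 d2). split; [apply Rmin_pos; auto|]. intros b Hb.
  apply Rmin_Rgt in Hb. destruct Hb as [B1 B2]. apply Rgt_lt in B1, B2.
  assert (Hb : odisc c R0 b) by (apply Q2; auto).
  rewrite Seg by auto.
  assert (CI : contin (fun t => f (a + t * (b - a)) * (b - a))%C 0 1).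
  { intros t Ht. apply cont_mult; [|apply cont_const].
    apply (cont_compose RtoC (fun t => a + t * (b - a))%C f); [eapply deriv_cont; apply rderiv_segment|].
    apply diff_at_cont, Hf. apply disc_convex; auto. }
  assert (E : (f a * (b - a) = Cint (fun _ => f a * (b - a)) 0 1)%C).
  { rewrite (Cint_derive (fun t => 0 + t * (f a * (b - a)))%C); [ring|lra| |].
    - intros; apply rderiv_segment.
    - intros t _; apply cont_const. }
  rewrite E, <- Cint_minus; auto; [|lra|intros t _; apply cont_const].
  replace (e * Cmod (b - a)) with ((1 - 0) * (e * Cmod (b - a))) by ring.
  apply Cint_bound; [lra| |].
  - intros t Ht. apply cont_minus; [exact (CI t Ht)|apply cont_const].
  - intros t Ht. replace (f (a + t * (b - a)) * (b - a) - f a * (b - a))%C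
      with ((f (a + t * (b - a)) - f a) * (b - a))%C by ring.
    rewrite Cmod_mult. apply Rmult_le_compat_r; [apply Cmod_ge_0|]. apply Rlt_le, Q1.
    replace (a + t * (b - a) - a)%C with (t * (b - a))%C by ring.
    rewrite Cmod_mult, Cmod_R, Rabs_pos_eq by lra. pose proof (Cmod_ge_0 (b - a)). nra.
Qed.

(** * Bloch's theorem and univalent functions *)

Definition cexp (z : C) : C := (exp (Re z) * cos (Im z), exp (Re z) * sin (Im z)).

Lemma cexp_plus (z w : C) : cexp (z + w) = (cexp z * cexp w)%C.
Proof.
  destruct z as [x y], w as [u v]. unfold cexp, Re, Im. simpl.
  rewrite exp_plus, cos_plus, sin_plus. apply injective_projections; simpl; ring.
Qed.

Lemma cexp_0 : cexp 0 = 1%C.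
Proof. unfold cexp, Re, Im. simpl. rewrite exp_0, cos_0, sin_0. apply injective_projections; simpl; ring. Qed.

Lemma cexp_opp_mult (z : C) : (cexp z * cexp (- z))%C = 1%C.
Proof. rewrite <- cexp_plus. replace (z + - z)%C with (RtoC 0) by ring. apply cexp_0. Qed.

Lemma Cmod_cexp (z : C) : Cmod (cexp z) = exp (Re z).
Proof.
  transitivity (sqrt (exp (Re z) ^ 2)); [|apply sqrt_pow2, Rlt_le, exp_pos].
  unfold cexp, Cmod, fst, snd. f_equal.
  transitivity (exp (Re z) ^ 2 * (Rsqr (sin (Im z)) + Rsqr (cos (Im z)))); [unfold Rsqr; ring|].
  rewrite sin2_cos2. ring.
Qed.

Lemma cexp_period (z : C) : cexp (z + PI * Ci) = cexp (z - PI * Ci).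
Proof.
  unfold cexp.
  replace (Re (z + PI * Ci)) with (Re z) by (destruct z; unfold Re; simpl; ring).
  replace (Re (z - PI * Ci)) with (Re z) by (destruct z; unfold Re; simpl; ring).
  replace (Im (z + PI * Ci)) with (Im z + PI) by (destruct z; unfold Im; simpl; ring).
  replace (Im (z - PI * Ci)) with (Im z - PI) by (destruct z; unfold Im; simpl; ring).
  rewrite cos_plus, sin_plus, cos_minus, sin_minus, cos_PI, sin_PI.
  apply injective_projections; simpl; ring.
Qed.

Lemma real_deriv_bound (f : R -> R) (l : R) : derivable_pt_lim f 0 l ->
  forall e, 0 < e -> exists d, 0 < d /\ forall h, Rabs h < d -> Rabs (f h - f 0 - l * h) <= e * Rabs h.
Proof.
  intros H e He. destruct (H e He) as [[d P] Q]. exists d. split; auto. intros h Hh.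
  destruct (Req_dec h 0) as [->|N].
  - replace (f 0 - f 0 - l * 0) with 0 by ring. rewrite Rabs_R0. lra.
  - specialize (Q h N Hh). rewrite Rplus_0_l in Q.
    replace (f h - f 0 - l * h) with (((f h - f 0) / h - l) * h) by (field; auto).
    rewrite Rabs_mult. apply Rmult_le_compat_r; [apply Rabs_pos|lra].
Qed.

Lemma cderiv_cexp (z : C) : cderiv cexp z (cexp z).
Proof.
  assert (H0 : cderiv cexp 0 1).
  (* Real and imaginary parts are bounded by [3 * (e' * m)] and [5 * (e' * m)], the latter using
     [e' <= 1]; the sum explains the [8]. *)
  { intros e He. set (e' := Rmin 1 (e / 8)).
    assert (e1 : 0 < e') by (apply Rmin_pos; lra).
    assert (e2 : e' <= 1) by apply Rmin_l. assert (e3 : e' <= e / 8) by apply Rmin_r.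
    destruct (real_deriv_bound exp 1) with (e := e') as [d1 [P1 Q1]]; auto.
    { rewrite <- exp_0. apply derivable_pt_lim_exp. }
    destruct (real_deriv_bound cos 0) with (e := e') as [d2 [P2 Q2]]; auto.
    { replace (derivable_pt_lim cos 0 0) with (derivable_pt_lim cos 0 (- sin 0))
        by (rewrite sin_0, Ropp_0; reflexivity). apply derivable_pt_lim_cos. }
    destruct (real_deriv_bound sin 1) with (e := e') as [d3 [P3 Q3]]; auto.
    { rewrite <- cos_0. apply derivable_pt_lim_sin. }
    exists (Rmin (Rmin d1 d2) (Rmin d3 e')). split; [apply Rmin_pos; apply Rmin_pos; auto|].
    unfold idC. intros h Hh. replace (h - 0)%C with h in * by ring.
    apply Rmin_Rgt in Hh. destruct Hh as [A B].
    apply Rmin_Rgt in A, B. destruct A as [A1 A2], B as [A3 A4]. apply Rgt_lt in A1, A2, A3, A4.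
    pose proof (re_le_Cmod h) as X. pose proof (im_le_Cmod h) as Y.
    rewrite cexp_0. eapply Rle_trans; [apply Cmod_le_Re_Im|].
    destruct h as [x y]. set (m := Cmod (x, y)) in *.
    unfold Re, Im in X, Y. simpl in X, Y.
    specialize (Q1 x ltac:(lra)). specialize (Q2 y ltac:(lra)). specialize (Q3 y ltac:(lra)).
    rewrite exp_0 in Q1. rewrite cos_0 in Q2. rewrite sin_0 in Q3.
    unfold cexp, Re, Im. simpl.
    replace (exp x * cos y + - (1) + - (1 * x - 0 * y))
      with ((exp x - 1 - 1 * x) * cos y + (1 + x) * (cos y - 1 - 0 * y)) by ring.
    replace (exp x * sin y + - 0 + - (1 * y + 0 * x))
      with (exp x * (sin y - 0 - 1 * y) + ((exp x - 1 - 1 * x) + x) * y) by ring.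
    set (u := exp x - 1 - 1 * x) in *. set (v := cos y - 1 - 0 * y) in *. set (w := sin y - 0 - 1 * y) in *.
    assert (Ex : exp x = 1 + x + u) by (unfold u; ring).
    assert (Cy : Rabs (cos y) <= 1) by (apply Rabs_le, COS_bound).
    assert (Hm : m < 1) by lra.
    assert (U : Rabs u <= e' * m) by nra. assert (V : Rabs v <= e' * m) by nra. assert (W : Rabs w <= e' * m) by nra.
    assert (mp : 0 <= m) by (unfold m; apply Cmod_ge_0).
    assert (T1 : Rabs (u * cos y + (1 + x) * v) <= e' * m * 1 + 2 * (e' * m)).
    { eapply Rle_trans; [apply Rabs_triang|]. rewrite !Rabs_mult. apply Rplus_le_compat.
      - apply Rmult_le_compat; auto using Rabs_pos.
      - apply Rmult_le_compat; auto using Rabs_pos. pose proof (Rabs_triang 1 x). rewrite Rabs_R1 in H. lra. }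
    assert (T2 : Rabs (exp x * w + (u + x) * y) <= 3 * (e' * m) + (e' * m + m) * e').
    { eapply Rle_trans; [apply Rabs_triang|]. rewrite !Rabs_mult. apply Rplus_le_compat.
      - apply Rmult_le_compat; auto using Rabs_pos. rewrite Ex.
        pose proof (Rabs_triang (1 + x) u). pose proof (Rabs_triang 1 x). rewrite Rabs_R1 in H0. nra.
      - apply Rmult_le_compat; auto using Rabs_pos; [|lra].
        pose proof (Rabs_triang u x). lra. }
    assert (0 <= e' * m) by nra. nra. }
  apply deriv_ext with (fun y => cexp z * cexp (y - z))%C.
  { intros y. rewrite <- cexp_plus. f_equal. ring. }
  eapply deriv_eq.
  - apply deriv_scal. apply (deriv_comp idC (fun y => y - z)%C cexp).
    + apply deriv_minus; [apply (deriv_embed idC)|apply deriv_const].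
    + replace (z - z)%C with (RtoC 0) by ring. exact H0.
  - ring.
Qed.

(** [l] is the primitive of [f' / f] vanishing at [c], and [f * cexp (- l)] has zero derivative.
    Keeping the factor [f c] outside spares the choice of a logarithm of a number. *)
Lemma hol_log (f : C -> C) (c : C) (R0 : R) :
  0 < R0 -> hol (odisc c R0) f -> (forall z, odisc c R0 z -> f z <> 0%C) ->
  exists l : C -> C, l c = 0 /\ (forall z, odisc c R0 z -> cderiv l z (C_derive f z / f z)%C) /\
    forall z, odisc c R0 z -> f z = (f c * cexp (l z))%C.
Proof.
  intros HR Hf N.
  assert (Hc : odisc c R0 c) by (unfold odisc; rewrite Cmod_self; auto).
  destruct (hol_primitive (fun z => C_derive f z / f z)%C c R0) as [F HF].
  { intros z Hz. apply diff_at_div; auto. apply (hol_D (odisc c R0)); auto. apply nbhd_odisc. }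
  exists (fun z => F z - F c)%C.
  assert (HL : forall z, odisc c R0 z -> cderiv (fun z => F z - F c)%C z (C_derive f z / f z)%C).
  { intros z Hz. eapply deriv_eq; [apply deriv_minus; [apply HF; auto|apply deriv_const]|ring]. }
  split; [ring|split; auto].
  set (l := fun z => (F z - F c)%C) in *.
  set (g := fun z => (f z * cexp (- l z))%C).
  assert (Hg : forall z, odisc c R0 z -> cderiv g z 0).
  { intros z Hz. eapply deriv_eq.
    - apply deriv_mult; [apply diff_at_D; auto|].
      apply (deriv_comp idC (fun z => - l z)%C cexp); [apply deriv_opp, HL; auto|apply cderiv_cexp].
    - cbv beta. field. auto. }
  intros z Hz.
  assert (E : g z = g c).
  { assert (X : Cmod (g z - g c) <= 0 * Cmod (z - c)).
    { apply (mean_value_ineq g (odisc c R0)); [apply nbhd_odisc|intros y Hy; eexists; apply Hg; auto|].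
      intros t Ht. assert (Y : odisc c R0 (c + t * (z - c))%C) by (apply disc_convex; auto).
      split; auto. rewrite (cderiv_D_eq g _ 0%C) by auto. rewrite Cmod_0. lra. }
    rewrite Rmult_0_l in X. pose proof (Cmod_ge_0 (g z - g c)).
    assert (Z : (g z - g c)%C = 0%C) by (apply Cmod_eq_0; lra).
    replace (g z) with (g z - g c + g c)%C by ring. rewrite Z. ring. }
  unfold g in E. replace (l c) with (RtoC 0) in E by (unfold l; ring).
  replace (- RtoC 0)%C with (RtoC 0) in E by ring. rewrite cexp_0, Cmult_1_r in E.
  rewrite <- E, <- Cmult_assoc, (Cmult_comm (cexp (- l z))), cexp_opp_mult. ring.
Qed.

(** If [w] were omitted, [f - w] would have no zero in the disc and modulus at least [d / 2] on the
    circle, hence also at the centre by the minimum principle. *)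
Lemma covering (f : C -> C) (a w : C) (r d : R) :
  0 < r -> 0 < d -> diff_on_cdisc f a r ->
  (forall t, 0 <= t <= 1 -> d <= Cmod (f (circ a r t) - f a)) ->
  Cmod (w - f a) < d / 2 -> exists z, Cmod (z - a) <= r /\ f z = w.
Proof.
  intros Hr Hd Hf H Hw. apply NNPP. intros N.
  assert (X : d / 2 <= Cmod (f a - w)).
  { apply (min_modulus_center (fun z => f z - w)%C a r); auto; [lra| | |].
    - intros y Hy. apply diff_at_minus; [auto|apply diff_at_const].
    - intros y Hy E. apply N. exists y. split; auto.
      replace (f y) with (f y - w + w)%C by ring. rewrite E. ring.
    - intros t Ht. specialize (H t Ht).
      pose proof (Cmod_lower (f (circ a r t) - f a) (w - f a)) as L.
      replace (f (circ a r t) - f a - (w - f a))%C with (f (circ a r t) - w)%C in L by ring. lra. }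
  rewrite Cmod_sub_sym in X. lra.
Qed.

(* Landau: near a point [a] almost maximising [(r - |z - c|) |f' z|] the derivative
   is bounded by a multiple of [|f' a|], so [f] is nearly linear there. *)
Lemma bloch (f : C -> C) (c : C) (R0 : R) :
  0 < R0 -> hol (odisc c R0) f ->
  exists b, forall w, Cmod (w - b) < R0 * Cmod (C_derive f c) / 320 ->
    exists z, odisc c R0 z /\ f z = w.
Proof.
  intros HR Hf. set (r := R0 / 2).
  assert (HD : hol (odisc c R0) (C_derive f)) by (apply hol_D; auto; apply nbhd_odisc).
  destruct (Req_dec (Cmod (C_derive f c)) 0) as [Z|NZ].
  { exists 0%C. intros w Hw. rewrite Z in Hw. pose proof (Cmod_ge_0 (w - 0)). lra. }
  assert (DP : 0 < Cmod (C_derive f c)) by (pose proof (Cmod_ge_0 (C_derive f c)); lra).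
  (* Halving the radius makes [f'] bounded, so that the supremum [S] below is finite. *)
  destruct (cdisc_bounded (C_derive f) c r) as [M [MP HM]].
  { unfold r; lra. } { apply disc_closed_diff with R0; auto. unfold r; lra. }
  set (E := fun x => exists z, Cmod (z - c) < r /\ x = (r - Cmod (z - c)) * Cmod (C_derive f z)).
  assert (E0 : E (r * Cmod (C_derive f c))).
  { exists c. rewrite Cmod_self. split; [unfold r; lra|ring]. }
  destruct (completeness E) as [S [S1 S2]].
  { exists (r * M). intros x [z [Hz ->]]. pose proof (Cmod_ge_0 (z - c)).
    apply Rmult_le_compat; auto; try apply Cmod_ge_0; lra. }
  { eexists. exact E0. }
  assert (SP : r * Cmod (C_derive f c) <= S) by (apply S1; auto).
  assert (m0 : 0 < r * Cmod (C_derive f c)) by (apply Rmult_lt_0_compat; unfold r; lra).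
  assert (HA : exists a, Cmod (a - c) < r /\ S / 2 <= (r - Cmod (a - c)) * Cmod (C_derive f a)).
  { apply NNPP. intros N. assert (S <= S / 2); [|lra]. apply S2. intros x [z [Hz ->]].
    apply Rnot_lt_le. intros L. apply N. exists z. split; auto. lra. }
  destruct HA as [a [Ha Sa]].
  (* On the disc of radius [t] around [a] the weight [r - |z - c|] is at least [t], half its value
     at [a]. Hence [t * |f' z| <= S <= 4 * t * A], which is the bound [B4]. *)
  set (t := (r - Cmod (a - c)) / 2). set (A := Cmod (C_derive f a)) in *.
  assert (tp : 0 < t) by (unfold t; lra).
  assert (AP : 0 < A) by (pose proof (Cmod_ge_0 (C_derive f a)); unfold t, A in *; nra).
  assert (tA : S / 4 <= t * A) by (unfold t; lra).
  assert (Sub : forall z, odisc a t z -> Cmod (z - c) < r /\ t <= r - Cmod (z - c)).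
  { intros z Hz. unfold odisc in Hz. pose proof (Cmod_triangle (z - a) (a - c)) as T.
    replace (z - a + (a - c))%C with (z - c)%C in T by ring. unfold t in *. lra. }
  assert (Hfa : hol (odisc a t) f).
  { intros z Hz. apply Hf. destruct (Sub z Hz). unfold odisc, r in *. lra. }
  assert (B4 : forall z, odisc a t z -> Cmod (C_derive f z) <= 4 * A).
  { intros z Hz. destruct (Sub z Hz) as [z1 z2].
    assert (X : (r - Cmod (z - c)) * Cmod (C_derive f z) <= S) by (apply S1; exists z; auto).
    pose proof (Cmod_ge_0 (C_derive f z)). apply Rmult_le_reg_l with t; auto. nra. }
  assert (Hat : odisc a t a) by (unfold odisc; rewrite Cmod_self; auto).
  assert (Hq : hol (odisc a t) (quot f a)) by (apply hol_quot; auto; apply nbhd_odisc).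
  assert (Q4 : forall z, odisc a t z -> Cmod (quot f a z) <= 4 * A).
  { intros z Hz. destruct (excluded_middle_informative (z = a)) as [->|N].
    - rewrite quot_self. apply B4; auto.
    - rewrite quot_neq by auto. rewrite Cmod_div by (apply Cminus_neq; auto).
      pose proof (Cmod_pos_neq _ _ N). apply Rmult_le_reg_r with (Cmod (z - a)); auto.
      unfold Rdiv. rewrite Rmult_assoc, Rinv_l, Rmult_1_r by lra.
      apply (mean_value_ineq f (odisc a t)); auto; [apply nbhd_odisc|].
      intros s Hs. assert (odisc a t (a + s * (z - a))%C) by (apply disc_convex; auto). auto. }
  assert (Q5 : forall z, odisc a t z -> Cmod (quot f a z - quot f a a) * t <= 5 * A * Cmod (z - a)).
  { intros z Hz. apply (schwarz (fun z => quot f a z - quot f a a)%C a z t (5 * A)); auto; [| |ring].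
    - intros y Hy. apply diff_at_minus; [auto|apply diff_at_const].
    - intros y Hy. eapply Rle_trans; [apply Cmod_triangle|]. rewrite Cmod_opp, quot_self.
      specialize (Q4 y Hy). fold A. lra. }
  exists (f a). intros w Hw.
  assert (P10 : 0 < t / 10) by lra.
  (* At distance [t / 10] the quotient differs from [f' a] by at most [A / 2], so [f] moves by at
     least [t * A / 20]. The covered radius [t * A / 40] is at least [R0 * |f' c| / 320], because
     [t * A >= S / 4] and [S >= R0 * |f' c| / 2]. *)
  destruct (covering f a w (t / 10) (t * A / 20)) as [z [Hz Ez]]; auto.
  - assert (0 < t * A) by (apply Rmult_lt_0_compat; auto). lra.
  - apply disc_closed_diff with t; auto; lra.
  - intros s Hs. set (z := circ a (t / 10) s).
    assert (Hz : Cmod (z - a) = t / 10) by (apply Cmod_circ; lra).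
    rewrite (quot_spec f a z). replace (f a + (z - a) * quot f a z - f a)%C with ((z - a) * quot f a z)%C by ring.
    rewrite Cmod_mult, Hz.
    specialize (Q5 z ltac:(unfold odisc; lra)). rewrite Hz in Q5.
    assert (X : Cmod (quot f a z - quot f a a) <= A / 2).
    { apply Rmult_le_reg_r with t; auto. lra. }
    pose proof (Cmod_lower (quot f a a) (quot f a a - quot f a z)) as L.
    replace (quot f a a - (quot f a a - quot f a z))%C with (quot f a z) in L by ring.
    rewrite (Cmod_sub_sym (quot f a a)) in L. rewrite quot_self in L, X. fold A in L. nra.
  - eapply Rlt_le_trans; [exact Hw|]. unfold r in *. lra.
  - exists z. split; auto. destruct (Sub z ltac:(unfold odisc; lra)). unfold odisc, r in *. lra.
Qed.

(* An injective [f] omits [f v] on a disc [B] around [w] avoiding [v], and a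
   logarithm of [f - f v] on [B] never takes two values differing by [2 i pi],
   so its image contains no odisc of radius [4]. *)
Lemma univalent_growth (U : C -> Prop) (f : C -> C) (w v : C) (r : R) :
  0 < r -> hol U f -> injective_on U f -> (forall z, odisc w r z -> U z) ->
  U v -> r <= Cmod (v - w) ->
  Cmod (C_derive f w) * r <= 1280 * Cmod (f w - f v).
Proof.
  intros Hr Hf Hi HU Hv Hvw.
  assert (Hw : odisc w r w) by (unfold odisc; rewrite Cmod_self; auto).
  assert (N : forall z, odisc w r z -> (f z - f v)%C <> 0%C).
  { intros z Hz. apply Cminus_neq. intros E. apply Hi in E; auto. subst. unfold odisc in Hz. lra. }
  assert (Hg : hol (odisc w r) (fun z => f z - f v)%C).
  { intros z Hz. apply diff_at_minus; [auto|apply diff_at_const]. }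
  destruct (hol_log (fun z => f z - f v)%C w r Hr Hg N) as [l [l0 [l1 l2]]].
  assert (ED : C_derive (fun z => f z - f v)%C w = C_derive f w).
  { apply cderiv_D_eq. eapply deriv_eq; [apply deriv_minus; [apply diff_at_D; auto|apply deriv_const]|ring]. }
  assert (EL : C_derive l w = (C_derive f w / (f w - f v))%C).
  { rewrite <- ED. apply cderiv_D_eq, l1, Hw. }
  destruct (bloch l w r Hr) as [b Hb]; [intros z Hz; eexists; apply l1; auto|].
  pose proof (N w Hw) as Nw. assert (P : 0 < Cmod (f w - f v)) by (apply Cmod_gt_0; auto).
  (* A disc of radius greater than [4 >= PI] in the image of [l] would contain [b + PI * Ci] and
     [b - PI * Ci], which have the same exponential. The final constant is [1280 = 4 * 320]. *)
  assert (X : r * Cmod (C_derive l w) / 320 <= 4).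
  { apply Rnot_lt_le. intros L.
    assert (PC : Cmod (PI * Ci) <= 4).
    { pose proof PI_RGT_0. rewrite Cmod_mult, Cmod_R, Cmod_Ci, Rabs_pos_eq by lra. pose proof PI_4. lra. }
    destruct (Hb (b + PI * Ci)%C) as [z1 [Z1 E1]].
    { replace (b + PI * Ci - b)%C with (PI * Ci)%C by ring. lra. }
    destruct (Hb (b - PI * Ci)%C) as [z2 [Z2 E2]].
    { replace (b - PI * Ci - b)%C with (- (PI * Ci))%C by ring. rewrite Cmod_opp. lra. }
    assert (E : z1 = z2).
    { apply Hi; auto. pose proof (l2 z1 Z1) as F1. pose proof (l2 z2 Z2) as F2. cbv beta in F1, F2.
      rewrite E1, cexp_period, <- E2, <- F2 in F1.
      replace (f z1) with (f z1 - f v + f v)%C by ring. rewrite F1. ring. }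
    rewrite E, E2 in E1.
    assert (K : (2 * PI * Ci)%C = 0%C).
    { replace (2 * PI * Ci)%C with ((b + PI * Ci) - (b - PI * Ci))%C by ring. rewrite E1. ring. }
    exact (two_pi_i_neq K). }
  rewrite EL, Cmod_div in X by auto.
  apply Rmult_le_reg_r with (/ Cmod (f w - f v)); [apply Rinv_0_lt_compat; auto|].
  rewrite (Rmult_assoc 1280), Rinv_r by lra. unfold Rdiv in X. lra.
Qed.

(* Hurwitz: the difference quotients of [f] based at [v] do not vanish on the
   odisc, so neither does their limit as [v] tends to [a]. *)
Lemma univalent_derive_neq_0 (U : C -> Prop) (f : C -> C) (a : C) :
  nbhd_set U -> hol U f -> injective_on U f -> U a -> C_derive f a <> 0%C.
Proof.
  intros HU Hf Hi Ha Z.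
  destruct (HU a Ha) as [r [Hr Hd]].
  assert (Hcd : diff_on_cdisc f a r) by (intros z Hz; auto).
  destruct (contin_bounded_below (fun t => f (circ a r t) - f a)%C 0 1) as [m [mp Hm]]; [lra| | |].
  { intros t Ht. apply cont_minus; [exact (contin_circ f a r ltac:(lra) Hcd t Ht)|apply cont_const]. }
  { intros t Ht. apply Cminus_neq. intros E. apply Hi in E; auto.
    - pose proof (Cmod_circ a r t ltac:(lra)) as F. rewrite E, Cmod_self in F. lra.
    - apply Hd. rewrite Cmod_circ; lra. }
  destruct (diff_at_cont f a (Hf a Ha) (m / 2) ltac:(lra)) as [d1 [P1 Q1]]. unfold idC in Q1.
  destruct (diff_at_D f a (Hf a Ha) (m / (8 * r))) as [d2 [P2 Q2]]; [apply Rdiv_lt_0_compat; lra|].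
  unfold idC in Q2. rewrite Z in Q2.
  set (d := Rmin (Rmin d1 d2) r).
  assert (dp : 0 < d) by (repeat apply Rmin_pos; auto).
  (* If [f' v] were nonzero, [quot f v] would have no zero, not even at its base point, and the
     minimum principle would make it at least [m / (4 * r)] at [a]; but [f' a = 0] makes it at most
     [m / (8 * r)] there. So [f'] vanishes near [a], and [f] is constant there, against
     injectivity. *)
  assert (V : forall v, Cmod (v - a) < d -> C_derive f v = 0%C).
  { intros v Hv. apply Rmin_Rgt in Hv. destruct Hv as [Hv H3]. apply Rmin_Rgt in Hv. destruct Hv as [H1 H2].
    apply Rgt_lt in H1, H2, H3. apply NNPP. intros Nv.
    assert (va : v <> a) by (intros ->; auto).
    assert (Uv : U v) by (apply Hd; lra).
    specialize (Q1 v H1). specialize (Q2 v H2).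
    replace (f v - f a - 0 * (v - a))%C with (f v - f a)%C in Q2 by ring.
    assert (B : m / (4 * r) <= Cmod (quot f v a)).
    { apply (min_modulus_center (quot f v) a r); auto.
      - apply Rdiv_lt_0_compat; lra.
      - intros y Hy. apply (hol_quot U f v HU Hf). auto.
      - intros y Hy. destruct (excluded_middle_informative (y = v)) as [->|Ny].
        + rewrite quot_self. auto.
        + rewrite quot_neq by auto. intros E. apply Ny. apply Hi; auto.
          pose proof (quot_spec f v y) as S. rewrite quot_neq, E in S by auto. rewrite S. ring.
      - intros t Ht. set (y := circ a r t).
        assert (Hy : Cmod (y - a) = r) by (apply Cmod_circ; lra).
        assert (Ny : y <> v) by (intros E; rewrite E in Hy; lra).
        rewrite quot_neq, Cmod_div by (auto; apply Cminus_neq; auto).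
        specialize (Hm t Ht). fold y in Hm.
        pose proof (Cmod_lower (f y - f a) (f v - f a)) as L.
        replace (f y - f a - (f v - f a))%C with (f y - f v)%C in L by ring.
        pose proof (Cmod_pos_neq _ _ Ny) as Py.
        assert (Cmod (y - v) <= 2 * r).
        { replace (y - v)%C with ((y - a) - (v - a))%C by ring.
          eapply Rle_trans; [apply Cmod_triangle|]. rewrite Cmod_opp. lra. }
        apply Rle_trans with (m / 2 / (2 * r)); [right; field; lra|].
        apply Rmult_le_compat; try lra.
        + apply Rlt_le, Rinv_0_lt_compat; lra.
        + apply Rinv_le_contravar; lra. }
    rewrite quot_neq, Cmod_div in B by (auto; apply Cminus_neq; auto).
    rewrite (Cmod_sub_sym (f a)), (Cmod_sub_sym a) in B.
    pose proof (Cmod_pos_neq _ _ va) as Pv.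
    assert (X : m / (4 * r) <= m / (8 * r)).
    { eapply Rle_trans; [exact B|]. apply Rmult_le_reg_r with (Cmod (v - a)); auto.
      unfold Rdiv at 1. rewrite Rmult_assoc, Rinv_l, Rmult_1_r by lra. auto. }
    assert (0 < m / (8 * r)) by (apply Rdiv_lt_0_compat; lra).
    replace (m / (4 * r)) with (2 * (m / (8 * r))) in X by (field; lra). lra. }
  set (v := (a + (d / 2)%R)%C).
  assert (Hv : Cmod (v - a) = d / 2).
  { unfold v. replace (a + (d / 2)%R - a)%C with (RtoC (d / 2)) by ring. rewrite Cmod_R. apply Rabs_pos_eq. lra. }
  assert (dr : d <= r) by apply Rmin_r.
  assert (E : v = a).
  { apply Hi; auto; [apply Hd; lra|].
    assert (X : Cmod (f v - f a) <= 0 * Cmod (v - a)).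
    { apply (mean_value_ineq f U); auto. intros t Ht.
      assert (Y : Cmod (a + t * (v - a) - a) < d).
      { replace (a + t * (v - a) - a)%C with (t * (v - a))%C by ring.
        rewrite Cmod_mult, Cmod_R, Rabs_pos_eq, Hv by lra. nra. }
      split; [apply Hd; lra|]. rewrite V by auto. rewrite Cmod_0. lra. }
    pose proof (Cmod_ge_0 (f v - f a)).
    assert (W : (f v - f a)%C = 0%C) by (apply Cmod_eq_0; lra).
    replace (f v) with (f v - f a + f a)%C by ring. rewrite W. ring. }
  rewrite E, Cmod_self in Hv. lra.
Qed.

(* With [S = |w - w'|] and [q] the difference quotient of [f] at [w'],
   [univalent_growth] bounds [q' / q] by [1281 / S] on the circle [|u - w'| = S],
   hence inside it. *)
Lemma univalent_distortion (f : C -> C) (R0 : R) (w w' : C) :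
  hol (odisc 0 R0) f -> injective_on (odisc 0 R0) f ->
  Cmod w < R0 / 8 -> Cmod w' < R0 / 8 ->
  Cmod (C_derive f w) <= 1280 * exp 1281 * Cmod (C_derive f w').
Proof.
  intros Hf Hi Hw Hw'.
  assert (E1 : 1 <= exp 1281) by (pose proof (exp_ineq1_le 1281); lra).
  pose proof (Cmod_ge_0 (C_derive f w')) as D0. pose proof (Cmod_ge_0 w) as w0. pose proof (Cmod_ge_0 w') as w0'.
  destruct (excluded_middle_informative (w = w')) as [->|N]; [nra|].
  set (S := Cmod (w - w')). assert (SP : 0 < S) by (apply Cmod_pos_neq; auto).
  assert (HS : S < R0 / 4).
  { unfold S. eapply Rle_lt_trans; [apply Cmod_triangle|]. rewrite Cmod_opp. lra. }
  (* Room of radius [2 * S] around [w'] is needed: [univalent_growth] is applied on discs of radius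
     [S] centred on the circle [|u - w'| = S]. *)
  assert (Sub : forall z, odisc w' (2 * S) z -> odisc 0 R0 z).
  { intros z Hz. unfold odisc in *. pose proof (Cmod_triangle (z - w') w') as T.
    replace (z - w' + w')%C with (z - 0)%C in T by ring. lra. }
  assert (H0 : odisc w' (2 * S) w') by (unfold odisc; rewrite Cmod_self; lra).
  set (q := quot f w').
  assert (Hq : hol (odisc w' (2 * S)) q).
  { apply hol_quot; [apply nbhd_odisc|]. intros z Hz. auto. }
  assert (Nq : forall z, odisc w' (2 * S) z -> q z <> 0%C).
  { intros z Hz. unfold q. destruct (excluded_middle_informative (z = w')) as [->|Nz].
    - rewrite quot_self. apply univalent_derive_neq_0 with (odisc 0 R0); auto. apply nbhd_odisc.
    - intros E. apply Nz, Hi; auto. pose proof (quot_spec f w' z) as X. rewrite E in X. rewrite X. ring. }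
  destruct (hol_log q w' (2 * S) ltac:(lra) Hq Nq) as [l [l0 [l1 l2]]].
  assert (Grow : forall u, Cmod (u - w') = S -> Cmod (C_derive f u) * S <= 1280 * Cmod (f u - f w')).
  { intros u Hu. apply univalent_growth with (odisc 0 R0); auto.
    - intros z Hz. apply Sub. unfold odisc in *. pose proof (Cmod_triangle (z - u) (u - w')) as T.
      replace (z - u + (u - w'))%C with (z - w')%C in T by ring. lra.
    - rewrite Cmod_sub_sym. lra. }
  assert (Hl : hol (odisc w' (2 * S)) l) by (intros z Hz; eexists; apply l1; auto).
  assert (Bl : forall u, Cmod (u - w') <= S -> Cmod (C_derive l u) <= 1281 / S).
  { intros u Hu. apply (max_modulus (C_derive l) w' u S); auto.
    - apply disc_closed_diff with (2 * S); [lra|]. apply hol_D; auto. apply nbhd_odisc.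
    - clear u Hu. intros u Hu.
      assert (Du : odisc w' (2 * S) u) by (unfold odisc; lra).
      assert (Nu : u <> w') by (intros E; rewrite E, Cmod_self in Hu; lra).
      pose proof (Cminus_neq _ _ Nu) as Nu'.
      rewrite (cderiv_D_eq l u _ (l1 u Du)).
      assert (ED : C_derive f u = (q u + (u - w') * C_derive q u)%C).
      { apply cderiv_D_eq. apply deriv_ext with (fun z => f w' + (z - w') * q z)%C.
        { intros z. symmetry. apply quot_spec. }
        eapply deriv_eq.
        - apply deriv_plus; [apply deriv_const|]. apply deriv_mult; [|apply diff_at_D; auto].
          apply deriv_minus; [apply (deriv_embed idC)|apply deriv_const].
        - cbv beta. ring. }
      pose proof (Nq u Du) as Nqu.
      assert (EF : (f u - f w' = (u - w') * q u)%C) by (rewrite (quot_spec f w' u); unfold q; ring).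
      assert (NF : (f u - f w')%C <> 0%C) by (rewrite EF; apply Cmult_neq_0; auto).
      (* The logarithmic derivative of [q] is that of [f - f w'] minus [1 / (u - w')]; the second
         term turns [1280] into [1281]. *)
      replace (C_derive q u / q u)%C with (C_derive f u / (f u - f w') - / (u - w'))%C
        by (rewrite EF, ED; field; auto).
      eapply Rle_trans; [apply Cmod_triangle|].
      rewrite Cmod_opp, Cmod_div, Cmod_inv, Hu by auto.
      assert (PF : 0 < Cmod (f u - f w')) by (apply Cmod_gt_0; auto).
      assert (X : Cmod (C_derive f u) / Cmod (f u - f w') <= 1280 / S).
      { apply Rmult_le_reg_r with (Cmod (f u - f w') * S); [apply Rmult_lt_0_compat; auto|].
        replace (Cmod (C_derive f u) / Cmod (f u - f w') * (Cmod (f u - f w') * S))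
          with (Cmod (C_derive f u) * S) by (field; lra).
        replace (1280 / S * (Cmod (f u - f w') * S)) with (1280 * Cmod (f u - f w')) by (field; lra).
        apply Grow; auto. }
      replace (1281 / S) with (1280 / S + / S) by (field; lra). lra. }
  assert (LW : Cmod (l w) <= 1281).
  { replace (l w) with (l w - l w')%C by (rewrite l0; ring).
    apply Rle_trans with (1281 / S * S); [|right; field; lra].
    apply (mean_value_ineq l (odisc w' (2 * S))); auto; [apply nbhd_odisc|].
    intros t Ht.
    assert (X : Cmod (w' + t * (w - w') - w') <= S).
    { replace (w' + t * (w - w') - w')%C with (t * (w - w'))%C by ring.
      rewrite Cmod_mult, Cmod_R, Rabs_pos_eq by lra. fold S. nra. }
    split; [unfold odisc; lra|auto]. }
  assert (Qw : Cmod (q w) <= Cmod (C_derive f w') * exp 1281).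
  { rewrite (l2 w) by (unfold odisc; fold S; lra). unfold q at 1. rewrite quot_self, Cmod_mult, Cmod_cexp.
    apply Rmult_le_compat_l; auto.
    assert (Y : Re (l w) <= 1281) by (pose proof (re_le_Cmod (l w)); pose proof (Rle_abs (Re (l w))); lra).
    destruct Y as [Y|Y]; [left; apply exp_increasing; auto|rewrite Y; lra]. }
  (* [univalent_growth] is used once more, at [w] itself, to pass from the bound on the quotient
     [q w] to one on [f' w]. *)
  specialize (Grow w eq_refl).
  rewrite (quot_spec f w' w) in Grow at 1.
  replace (f w' + (w - w') * quot f w' w - f w')%C with ((w - w') * q w)%C in Grow by (unfold q; ring).
  rewrite Cmod_mult in Grow. fold S in Grow.
  apply Rmult_le_reg_r with S; auto. nra.
Qed.

(** * The Schwarz-Pick lemma, the identity theorem and inverse functions *)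

Lemma open_nbhd (U : C -> Prop) : open U -> nbhd_set U.
Proof.
  intros H z Hz. destruct (H z Hz) as [e He]. exists (e / 2). pose proof (cond_pos e).
  split; [lra|]. intros y Hy. apply He. apply C_NormedModule_mixin_compat1.
  change (Cmod (y - z) < e). lra.
Qed.

Lemma holomorphic_on_hol (U : C -> Prop) (f : C -> C) : holomorphic_on U f <-> hol U f.
Proof. split; intros H z Hz; apply diff_at_iff, H, Hz. Qed.

Lemma unit_disc_odisc (z : C) : unit_disc z <-> odisc 0 1 z.
Proof. unfold unit_disc, odisc. replace (z - 0)%C with z by ring. tauto. Qed.

Lemma nbhd_unit_disc : nbhd_set unit_disc.
Proof.
  intros z Hz. apply unit_disc_odisc in Hz. destruct (nbhd_odisc 0 1 z Hz) as [r [P Q]].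
  exists r. split; auto. intros y Hy. apply unit_disc_odisc; auto.
Qed.

(** The involutive automorphism of the disc that exchanges [a] and [0]. *)
Definition mob (a z : C) : C := ((a - z) / (1 - Cconj a * z))%C.

Lemma mob_den_neq (a z : C) : unit_disc a -> unit_disc z -> (1 - Cconj a * z)%C <> 0%C.
Proof.
  unfold unit_disc. intros Ha Hz. apply Cmod_gt_0.
  pose proof (Cmod_lower 1 (Cconj a * z)) as L. rewrite Cmod_1, Cmod_mult, Cmod_conj in L.
  pose proof (Cmod_ge_0 a). pose proof (Cmod_ge_0 z). nra.
Qed.

Lemma mob_identity (a z : C) :
  Cmod (1 - Cconj a * z) ^ 2 - Cmod (a - z) ^ 2 = (1 - Cmod a ^ 2) * (1 - Cmod z ^ 2).
Proof.
  rewrite !Cmod2_alt. destruct a as [x y], z as [u v]. unfold Re, Im. simpl. ring.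
Qed.

Lemma mob_unit_disc (a z : C) : unit_disc a -> unit_disc z -> unit_disc (mob a z).
Proof.
  intros Ha Hz. pose proof (mob_den_neq a z Ha Hz) as N. pose proof (mob_identity a z) as I.
  unfold unit_disc, mob in *. rewrite Cmod_div by auto.
  assert (P : 0 < Cmod (1 - Cconj a * z)) by (apply Cmod_gt_0; auto).
  apply Rmult_lt_reg_r with (Cmod (1 - Cconj a * z)); auto.
  unfold Rdiv. rewrite Rmult_assoc, Rinv_l, Rmult_1_r, Rmult_1_l by lra.
  pose proof (Cmod_ge_0 a). pose proof (Cmod_ge_0 z). pose proof (Cmod_ge_0 (a - z)).
  assert (0 < (1 - Cmod a ^ 2) * (1 - Cmod z ^ 2)) by (apply Rmult_lt_0_compat; nra).
  nra.
Qed.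

Lemma mob_deriv (a z : C) : unit_disc a -> unit_disc z ->
  cderiv (mob a) z ((a * Cconj a - 1) / ((1 - Cconj a * z) * (1 - Cconj a * z)))%C.
Proof.
  intros Ha Hz. pose proof (mob_den_neq a z Ha Hz) as N. unfold mob. eapply deriv_eq.
  - apply deriv_mult.
    + apply deriv_minus; [apply deriv_const|apply (deriv_embed idC)].
    + apply deriv_inv; auto.
      apply deriv_minus; [apply deriv_const|]. apply deriv_scal, (deriv_embed idC).
  - cbv beta. unfold idC. field. auto.
Qed.

Lemma mob_self (a : C) : mob a a = 0%C.
Proof. unfold mob. replace (a - a)%C with (RtoC 0) by ring. unfold Cdiv. ring. Qed.

Lemma mob_0 (a : C) : mob a 0 = a.
Proof. unfold mob. replace (1 - Cconj a * 0)%C with (RtoC 1) by ring. field. Qed.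

Lemma mob_invol (a z : C) : unit_disc a -> unit_disc z -> mob a (mob a z) = z.
Proof.
  intros Ha Hz. pose proof (mob_den_neq a z Ha Hz) as N.
  pose proof (mob_den_neq a a Ha Ha) as N2.
  assert (E1 : (a - mob a z = z * (1 - Cconj a * a) / (1 - Cconj a * z))%C) by (unfold mob; field; auto).
  assert (E2 : (1 - Cconj a * mob a z = (1 - Cconj a * a) / (1 - Cconj a * z))%C) by (unfold mob; field; auto).
  unfold mob at 1. rewrite E1, E2. field. auto.
Qed.

(** Schwarz's lemma for [mob (k c)] after [k]: the pseudo-hyperbolic distance of [k c] and [k w] is
    at most [|w - c| / R0]. Divisions are cleared on both sides. *)
Lemma schwarz_pick_center (k : C -> C) (c w : C) (R0 : R) :
  hol (odisc c R0) k -> (forall z, odisc c R0 z -> unit_disc (k z)) -> odisc c R0 w ->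
  Cmod (k c - k w) * R0 <= Cmod (1 - Cconj (k c) * k w) * Cmod (w - c).
Proof.
  intros Hk HD Hw.
  assert (Hc : odisc c R0 c).
  { unfold odisc in *. rewrite Cmod_self. pose proof (Cmod_ge_0 (w - c)). lra. }
  assert (S : Cmod (mob (k c) (k w)) * R0 <= 1 * Cmod (w - c)).
  { apply (schwarz (fun z => mob (k c) (k z)) c w R0 1); auto.
    - intros z Hz. apply (diff_at_comp (mob (k c)) k); auto. eexists. apply mob_deriv; auto.
    - intros z Hz. apply Rlt_le, mob_unit_disc; auto.
    - apply mob_self. }
  pose proof (mob_den_neq (k c) (k w) (HD c Hc) (HD w Hw)) as N.
  assert (P : 0 < Cmod (1 - Cconj (k c) * k w)) by (apply Cmod_gt_0; auto).
  unfold mob in S. rewrite Cmod_div in S by auto.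
  apply (Rmult_le_compat_l _ _ _ (Rlt_le _ _ P)) in S.
  replace (Cmod (1 - Cconj (k c) * k w) * (Cmod (k c - k w) / Cmod (1 - Cconj (k c) * k w) * R0))
    with (Cmod (k c - k w) * R0) in S by (field; lra). lra.
Qed.

Lemma Cmod_conj_mult (a : C) : (a * Cconj a)%C = RtoC (Cmod a ^ 2).
Proof. symmetry. apply Cmod2_conj. Qed.

(** Conjugation by disc automorphisms gives a self-map [F] fixing [0], with [|F' 0| <= 1] by
    Schwarz; the derivatives of [mob a] at [0] and of [mob b] at [b] supply the two weights. *)
Lemma schwarz_pick_deriv (psi : C -> C) (a : C) :
  hol unit_disc psi -> maps_into unit_disc unit_disc psi -> unit_disc a ->
  Cmod (C_derive psi a) * (1 - Cmod a ^ 2) <= 1 - Cmod (psi a) ^ 2.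
Proof.
  intros Hp HD Ha. set (b := psi a). assert (Hb : unit_disc b) by (apply HD; auto).
  set (F := fun z => mob b (psi (mob a z))).
  assert (H01 : odisc 0 1 0) by (unfold odisc; rewrite Cmod_self; lra).
  assert (HF : hol (odisc 0 1) F).
  { intros z Hz. apply unit_disc_odisc in Hz.
    assert (M : unit_disc (mob a z)) by (apply mob_unit_disc; auto).
    apply (diff_at_comp (mob b) (fun z => psi (mob a z))).
    - apply (diff_at_comp psi (mob a)); auto. eexists. apply mob_deriv; auto.
    - eexists. apply mob_deriv; auto. }
  assert (F0 : F 0 = 0%C) by (unfold F; rewrite mob_0; apply mob_self).
  assert (B : Cmod (C_derive F 0) <= 1).
  { rewrite <- (quot_self F 0).
    apply (max_modulus (quot F 0) 0 0 (1 / 2)); [lra| | |rewrite Cmod_self; lra].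
    - apply disc_closed_diff with 1; [lra|]. apply hol_quot; auto. apply nbhd_odisc.
    - intros y Hy. assert (Ny : y <> 0%C) by (intros ->; rewrite Cmod_self in Hy; lra).
      rewrite quot_neq, F0, Cmod_div by (auto; apply Cminus_neq; auto).
      replace (F y - 0)%C with (F y) by ring. rewrite Hy.
      assert (S : Cmod (F y) * 1 <= 1 * Cmod (y - 0)).
      { apply (schwarz F 0 y 1 1); auto; [|unfold odisc; lra].
        intros z Hz. apply unit_disc_odisc in Hz. apply Rlt_le. apply mob_unit_disc; auto.
        apply HD, mob_unit_disc; auto. }
      lra. }
  assert (Pa : 0 < 1 - Cmod a ^ 2) by (unfold unit_disc in Ha; pose proof (Cmod_ge_0 a); nra).
  assert (Pb : 0 < 1 - Cmod b ^ 2) by (unfold unit_disc in Hb; pose proof (Cmod_ge_0 b); nra).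
  assert (H0 : unit_disc 0) by (unfold unit_disc; rewrite Cmod_0; lra).
  assert (E : C_derive F 0 = (- / (1 - Cmod b ^ 2)%R * (C_derive psi a * (- (1 - Cmod a ^ 2)%R)))%C).
  { apply cderiv_D_eq. eapply deriv_eq.
    - apply (deriv_comp idC (fun z => psi (mob a z)) (mob b)).
      + apply (deriv_comp idC (mob a) psi); [apply mob_deriv; auto|].
        rewrite mob_0. apply diff_at_D, Hp, Ha.
      + cbv beta. rewrite mob_0. apply mob_deriv; auto.
    - fold b. rewrite (Cmult_comm (Cconj b)), !Cmod_conj_mult.
      assert (N : RtoC (1 - Cmod b ^ 2) <> 0%C) by (apply RtoC_neq; lra).
      rewrite !RtoC_minus in *. field. auto. }
  rewrite E in B.
  rewrite !Cmod_mult, !Cmod_opp, Cmod_inv, !Cmod_R, !Rabs_pos_eq in B by (try lra; apply RtoC_neq; lra).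
  apply (Rmult_le_compat_l _ _ _ (Rlt_le _ _ Pb)) in B.
  rewrite <- Rmult_assoc, Rinv_r in B by lra. lra.
Qed.

(** Both sides are compared with [X]. Closeness absorbs half of [X] in [X1], giving
    [X <= 2 * (1 - |a|^2)], while [1 - |b|^2 <= 2 * (1 - |a| * |b|) <= 2 * X]. Combined with
    Schwarz-Pick this bounds [|psi' a|] by [4] when [a] and [psi a] are close. *)
Lemma pseudo_close_ratio (a b : C) :
  unit_disc a -> unit_disc b -> Cmod (a - b) <= / 2 * Cmod (1 - Cconj a * b) ->
  1 - Cmod b ^ 2 <= 4 * (1 - Cmod a ^ 2).
Proof.
  unfold unit_disc. intros Ha Hb H. set (X := Cmod (1 - Cconj a * b)) in *.
  pose proof (Cmod_ge_0 a). pose proof (Cmod_ge_0 b). pose proof (Cmod_ge_0 (a - b)).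
  assert (X1 : X <= (1 - Cmod a ^ 2) + Cmod a * Cmod (a - b)).
  { unfold X. replace (1 - Cconj a * b)%C with ((1 - a * Cconj a) + Cconj a * (a - b))%C by ring.
    eapply Rle_trans; [apply Cmod_triangle|].
    rewrite Cmod_mult, Cmod_conj, Cmod_conj_mult, <- RtoC_minus, Cmod_R, Rabs_pos_eq; [lra|nra]. }
  assert (X2 : 1 - Cmod a * Cmod b <= X).
  { unfold X. pose proof (Cmod_lower 1 (Cconj a * b)) as L. rewrite Cmod_1, Cmod_mult, Cmod_conj in L. exact L. }
  nra.
Qed.

Lemma zero_near_center (f : C -> C) (d : R) :
  0 < d -> hol (odisc 0 1) f -> (forall z, odisc 0 d z -> f z = 0%C) ->
  forall z, odisc 0 1 z -> f z = 0%C.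
Proof.
  intros Hd Hf H0 z Hz.
  destruct (excluded_middle_informative (z = 0%C)) as [->|Nz].
  { apply H0. unfold odisc. rewrite Cmod_self. auto. }
  apply unit_disc_odisc in Hz. unfold unit_disc in Hz.
  assert (Pz : 0 < Cmod z) by (apply Cmod_gt_0; auto).
  set (r := (1 + Cmod z) / 2). assert (Hr : Cmod z < r < 1) by (unfold r; lra).
  assert (Hcd : diff_on_cdisc f 0 r) by (apply disc_closed_diff with 1; auto; lra).
  destruct (contin_bounded (fun t => f (circ 0 r t)) 0 1) as [M [MP HM]]; [lra|apply contin_circ; auto; lra|].
  (* [f y / y ^ n] is holomorphic for every [n]: the junk value at [0] is right since [f] vanishes there *)
  assert (HB : forall n, Cmod (f z) * (/ Cmod z) ^ n <= M * (/ r) ^ n).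
  { intros n. rewrite <- Cmod_inv, <- Cmod_pow, <- Cmod_mult by auto.
    apply (max_modulus_circ (fun y => f y * (/ y) ^ n)%C 0 z r); [lra| | |replace (z - 0)%C with z by ring; lra].
    - intros y Hy. destruct (excluded_middle_informative (y = 0%C)) as [->|Ny].
      + apply diff_at_ext_loc with (fun _ => 0%C); [|apply diff_at_const].
        exists d. split; auto. intros y Hy'. rewrite (H0 y Hy'). ring.
      + apply diff_at_mult; auto. apply (diff_at_pow Cinv). eexists. apply cderiv_inv; auto.
    - intros t Ht. assert (Cr : Cmod (circ 0 r t) = r).
      { replace (circ 0 r t) with (circ 0 r t - 0)%C by ring. apply Cmod_circ. lra. }
      assert (Nc : circ 0 r t <> 0%C) by (apply Cmod_gt_0; lra).
      rewrite Cmod_mult, Cmod_pow, Cmod_inv, Cr by auto.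
      apply Rmult_le_compat_r; auto. apply pow_le, Rlt_le, Rinv_0_lt_compat. lra. }
  apply Cmod_eq_0. apply NNPP. intros N.
  assert (FP : 0 < Cmod (f z)) by (pose proof (Cmod_ge_0 (f z)); lra).
  destruct (pow_lt_1_zero (Cmod z / r)) with (y := Cmod (f z) / M) as [n Hn].
  { rewrite Rabs_pos_eq; [|apply Rlt_le, Rdiv_lt_0_compat; lra].
    apply Rmult_lt_reg_r with r; [lra|]. unfold Rdiv. rewrite Rmult_assoc, Rinv_l; lra. }
  { apply Rdiv_lt_0_compat; auto. }
  specialize (Hn n (Nat.le_refl n)). rewrite Rabs_pos_eq in Hn by (apply pow_le, Rlt_le, Rdiv_lt_0_compat; lra).
  specialize (HB n). unfold Rdiv in Hn. rewrite Rpow_mult_distr in Hn. rewrite pow_inv in HB.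
  assert (zn : 0 < Cmod z ^ n) by (apply pow_lt; lra).
  apply (Rmult_le_compat_r (Cmod z ^ n)) in HB; [|lra].
  rewrite Rmult_assoc, Rinv_l, Rmult_1_r in HB by lra.
  apply (Rmult_lt_compat_r M) in Hn; auto. rewrite (Rmult_assoc (Cmod (f z))), Rinv_l in Hn by lra. lra.
Qed.

(** Composition with [mob a] moves the base point to the centre, where one disc covers everything;
    no chain of discs is needed. *)
Lemma identity_unit_disc (f : C -> C) (a : C) (d : R) :
  0 < d -> hol unit_disc f -> unit_disc a -> (forall z, Cmod (z - a) < d -> f z = 0%C) ->
  forall z, unit_disc z -> f z = 0%C.
Proof.
  intros Hd Hf Ha H0 z Hz.
  assert (Z0 : unit_disc 0) by (unfold unit_disc; rewrite Cmod_0; lra).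
  assert (Hm : hol (odisc 0 1) (fun w => f (mob a w))).
  { intros w Hw. apply unit_disc_odisc in Hw. apply (diff_at_comp f (mob a)).
    - eexists. apply mob_deriv; auto.
    - apply Hf, mob_unit_disc; auto. }
  destruct (deriv_cont idC (mob a) 0 _ (mob_deriv a 0 Ha Z0) d Hd) as [e [ep He]].
  rewrite mob_0 in He.
  rewrite <- (mob_invol a z Ha Hz).
  apply (zero_near_center (fun w => f (mob a w)) e ep Hm).
  - intros w Hw. apply H0, He, Hw.
  - apply -> unit_disc_odisc. apply mob_unit_disc; auto.
Qed.

(** * Inverses of univalent functions and Liouville's theorem *)

Definition inverse_on (V : C -> Prop) (h : C -> C) (w : C) : C :=
  epsilon (inhabits (RtoC 0)) (fun z => V z /\ h z = w).

Lemma inverse_on_spec (V : C -> Prop) (h : C -> C) (z : C) :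
  injective_on V h -> V z -> inverse_on V h (h z) = z.
Proof.
  intros Hi Hz. destruct (epsilon_spec (inhabits (RtoC 0)) (fun y => V y /\ h y = h z)) as [H1 H2]; [eauto|].
  apply Hi; auto.
Qed.

(** Injectivity keeps [h - h z0] away from [0] on a small circle, so [covering] applies. Locating
    the preimage within [e] of [z0] yields continuity of the inverse besides openness of the
    image. *)
Lemma univalent_open (V : C -> Prop) (h : C -> C) (z0 : C) (e : R) :
  nbhd_set V -> hol V h -> injective_on V h -> V z0 -> 0 < e ->
  exists d, 0 < d /\ forall w, Cmod (w - h z0) < d -> exists z, V z /\ Cmod (z - z0) < e /\ h z = w.
Proof.
  intros HV Hh Hi Hz He. destruct (HV z0 Hz) as [r0 [P0 Q0]].
  set (r := Rmin r0 (e / 2)). assert (rp : 0 < r) by (apply Rmin_pos; lra).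
  assert (r1 : r <= r0) by apply Rmin_l. assert (r2 : r <= e / 2) by apply Rmin_r.
  assert (Hcd : diff_on_cdisc h z0 r) by (intros y Hy; apply Hh, Q0; lra).
  destruct (contin_bounded_below (fun t => h (circ z0 r t) - h z0)%C 0 1) as [m [mp Hm]]; [lra| | |].
  { intros t Ht. apply cont_minus; [exact (contin_circ h z0 r ltac:(lra) Hcd t Ht)|apply cont_const]. }
  { intros t Ht. apply Cminus_neq. pose proof (Cmod_circ z0 r t ltac:(lra)) as F.
    intros E. apply Hi in E; auto.
    - rewrite E, Cmod_self in F. lra.
    - apply Q0. lra. }
  exists (m / 2). split; [lra|]. intros w Hw.
  destruct (covering h z0 w r m) as [z [Z1 Z2]]; auto.
  exists z. repeat split; auto; [apply Q0|]; lra.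
Qed.

(** The slope function of the inverse is the reciprocal of that of [h], composed with the inverse;
    [univalent_derive_neq_0] makes it finite at the base point. *)
Lemma cderiv_inverse_on (V : C -> Prop) (h : C -> C) (z0 : C) :
  nbhd_set V -> hol V h -> injective_on V h -> V z0 ->
  cderiv (inverse_on V h) (h z0) (/ C_derive h z0)%C.
Proof.
  intros HV Hh Hi Hz. set (k := inverse_on V h).
  pose proof (univalent_derive_neq_0 V h z0 HV Hh Hi Hz) as N.
  assert (Kz : k (h z0) = z0) by (apply inverse_on_spec; auto).
  assert (Kc : ccont k (h z0)).
  { intros e He. destruct (univalent_open V h z0 e HV Hh Hi Hz He) as [d [P Q]].
    exists d. split; auto. unfold idC. intros w Hw. destruct (Q w Hw) as [z [Z1 [Z2 <-]]].
    unfold k. rewrite !inverse_on_spec; auto. }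
  assert (Qc : ccont (quot h z0) z0) by (apply diff_at_cont; apply (hol_quot V); auto).
  apply factor_deriv with (fun w => / quot h z0 (k w))%C.
  - rewrite Kz, quot_self. reflexivity.
  - apply cont_inv; [|rewrite Kz, quot_self; auto].
    apply (cont_compose idC k (quot h z0)); auto. rewrite Kz. auto.
  - destruct (univalent_open V h z0 1 HV Hh Hi Hz ltac:(lra)) as [d [P Q]].
    exists d. split; auto. unfold idC. intros w Hw. destruct (Q w Hw) as [z [Z1 [_ <-]]].
    unfold k. rewrite !inverse_on_spec by auto.
    pose proof (quot_spec h z0 z) as S.
    assert (Nq : quot h z0 z <> 0%C).
    { destruct (excluded_middle_informative (z = z0)) as [->|Nz]; [rewrite quot_self; auto|].
      intros E. apply Nz, Hi; auto. rewrite S, E. ring. }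
    rewrite S. field. auto.
Qed.

(** The bound on [G'] passes to [quot G 0], which is entire; Schwarz's lemma on discs of radius
    [/ e] with [e] tending to [0] makes it constant. *)
Lemma entire_bounded_derive (G : C -> C) (M : R) :
  (forall z, diff_at G z) -> (forall z, Cmod (C_derive G z) <= M) ->
  forall z, G z = (G 0 + z * C_derive G 0)%C.
Proof.
  intros HG HM z.
  set (T := fun _ : C => True).
  assert (NT : nbhd_set T) by (intros y _; exists 1; split; [lra|constructor]).
  assert (HT : hol T G) by (intros y _; auto).
  assert (Hq : hol T (quot G 0)) by (apply hol_quot; auto).
  assert (Bq : forall y, Cmod (quot G 0 y) <= M).
  { intros y. destruct (excluded_middle_informative (y = 0%C)) as [->|N].
    - rewrite quot_self. auto.
    - rewrite quot_neq, Cmod_div by (auto; apply Cminus_neq; auto).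
      pose proof (Cmod_pos_neq _ _ N). apply Rmult_le_reg_r with (Cmod (y - 0)); auto.
      unfold Rdiv. rewrite Rmult_assoc, Rinv_l, Rmult_1_r by lra.
      apply (mean_value_ineq G T); auto. intros; split; [constructor|auto]. }
  assert (E : (quot G 0 z - quot G 0 0)%C = 0%C).
  { apply Cmod_small_0 with (2 * M * Cmod (z - 0)) (/ (Cmod (z - 0) + 1)).
    - apply Rinv_0_lt_compat. pose proof (Cmod_ge_0 (z - 0)). lra.
    - intros e [e0 e1].
      assert (L : Cmod (z - 0) < / e).
      { pose proof (Cmod_ge_0 (z - 0)). apply Rlt_trans with (Cmod (z - 0) + 1); [lra|].
        rewrite <- (Rinv_inv (Cmod (z - 0) + 1)). apply Rinv_lt_contravar; auto.
        apply Rmult_lt_0_compat; auto. apply Rinv_0_lt_compat. lra. }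
      assert (S : Cmod (quot G 0 z - quot G 0 0) * / e <= 2 * M * Cmod (z - 0)).
      { apply (schwarz (fun y => quot G 0 y - quot G 0 0)%C 0 z (/ e) (2 * M)); auto; [| |ring].
        - intros y Hy. apply diff_at_minus; [apply Hq; constructor|apply diff_at_const].
        - intros y Hy. eapply Rle_trans; [apply Cmod_triangle|]. rewrite Cmod_opp.
          pose proof (Bq y). pose proof (Bq 0%C). lra. }
      apply (Rmult_le_compat_r e) in S; [|lra]. rewrite Rmult_assoc, Rinv_l, Rmult_1_r in S by lra. exact S. }
  rewrite (quot_spec G 0 z), <- (quot_self G 0).
  replace (quot G 0 z) with (quot G 0 z - quot G 0 0 + quot G 0 0)%C by ring. rewrite E. ring.
Qed.

(** * Maps commuting with [phi] *)

(** Compactness of a square containing the disc: each point has a neighbourhood that one shift sends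
    into [W], and invariance under [+ 1] makes every larger shift work too. *)
Lemma translates_absorb_discs (W : C -> Prop) :
  (forall w, W w -> exists d, 0 < d /\ forall y, Cmod (y - w) < d -> W y) ->
  (forall w, W w -> W (w + 1)%C) ->
  (forall w, exists n, W (w + INR n)%C) ->
  forall R0, exists N, forall n w, (N <= n)%nat -> Cmod w < R0 -> W (w + INR n)%C.
Proof.
  intros Wo Ws Wc R0.
  assert (Wm : forall n m w, (n <= m)%nat -> W (w + INR n)%C -> W (w + INR m)%C).
  { intros n m w L H. induction L; auto. rewrite S_INR, RtoC_plus, Cplus_assoc. apply Ws, IHL. }
  (* The compactness lemma returns only a positive lower bound [d] for the gauges used. Requiring
     [INR n <= / delta] records the shift in the gauge, so that bound also bounds all the shifts. *)
  assert (Hd : forall p : R * R, exists d : posreal, exists n, INR n <= / d /\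
     forall x y, Rabs (x - fst p) < d -> Rabs (y - snd p) < d -> W ((x, y) + INR n)%C).
  { intros [u v]. destruct (Wc (u, v)) as [n Hn]. destruct (Wo _ Hn) as [d [P Q]].
    pose proof (pos_INR n).
    assert (E : 0 < Rmin (d / 2) (/ (INR n + 1))) by (apply Rmin_pos; [lra|apply Rinv_0_lt_compat; lra]).
    exists (mkposreal _ E), n. simpl. split.
    - apply Rle_trans with (/ / (INR n + 1)); [rewrite Rinv_inv; lra|].
      apply Rinv_le_contravar; [exact E|apply Rmin_r].
    - intros x y Hx Hy. apply Q.
      replace ((x, y) + INR n - ((u, v) + INR n))%C with ((x, y) - (u, v))%C by ring.
      eapply Rle_lt_trans; [apply Cmod_le_Re_Im|]. unfold Re, Im; simpl.
      pose proof (Rmin_l (d / 2) (/ (INR n + 1))). unfold Rminus in *. lra. }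
  set (delta := fun u v => proj1_sig (constructive_indefinite_description _ (Hd (u, v)))).
  assert (Hdelta : forall u v, exists n, INR n <= / delta u v /\
     forall x y, Rabs (x - u) < delta u v -> Rabs (y - v) < delta u v -> W ((x, y) + INR n)%C).
  { intros u v. unfold delta. destruct constructive_indefinite_description as [d Hd']. exact Hd'. }
  destruct (compactness_value_2d (- R0) R0 (- R0) R0 delta) as [d Hcd].
  destruct (nfloor_ex (/ d)) as [N [_ HN]].
  { apply Rlt_le, Rinv_0_lt_compat, cond_pos. }
  exists (S N). intros n w Hn Hw.
  pose proof (re_le_Cmod w) as A. pose proof (im_le_Cmod w) as B.
  apply Rabs_le_between in A, B.
  (* The covering provided by [compactness_value_2d] is stated under a double negation. *)
  apply NNPP. intros NW. apply (Hcd (Re w) (Im w)); [lra|lra|].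
  intros [u [v [_ [_ [H1 [H2 H3]]]]]]. apply NW.
  destruct (Hdelta u v) as [m [M1 M2]].
  apply (Wm m).
  - apply INR_le. apply Rle_trans with (/ d); [|apply Rle_trans with (INR N + 1); [lra|]].
    + eapply Rle_trans; [exact M1|]. apply Rinv_le_contravar; [apply cond_pos|exact H3].
    + rewrite <- S_INR. apply le_INR. lia.
  - replace w with (Re w, Im w) by (symmetry; apply surjective_pairing). apply M2; auto.
Qed.

Section Centralizer.

Variables (phi h : C -> C) (V : C -> Prop).
Hypothesis Hphi : holomorphic_self_map phi.
Hypothesis Hh : holomorphic_on unit_disc h.
Hypothesis Hfun : forall z, unit_disc z -> h (phi z) = (h z + 1)%C.
Hypothesis Hsurj : forall w : C, exists (n : nat) (z : C), unit_disc z /\ w = (h z - RtoC (INR n))%C.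
Hypothesis HV : absorbing phi V.
Hypothesis Hinj : injective_on V h.

Lemma iterate_S (f : C -> C) (n : nat) (z : C) : iterate f (S n) z = f (iterate f n z).
Proof. reflexivity. Qed.

Lemma iterate_in (U : C -> Prop) (f : C -> C) (n : nat) (z : C) :
  maps_into U U f -> U z -> U (iterate f n z).
Proof. intros H Hz. induction n; auto. rewrite iterate_S. apply H, IHn. Qed.

Lemma iterate_plus (f : C -> C) (n m : nat) (z : C) : iterate f (n + m) z = iterate f n (iterate f m z).
Proof.
  induction n; auto. change (f (iterate f (n + m) z) = f (iterate f n (iterate f m z))).
  rewrite IHn. reflexivity.
Qed.

Lemma absorbing_late (U : C -> Prop) (z : C) :
  absorbing phi U -> unit_disc z -> exists N, forall n, (N <= n)%nat -> U (iterate phi n z).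
Proof.
  intros [_ [_ [HU Ha]]] Hz. destruct (Ha z Hz) as [N HN]. exists N. intros n Hn.
  replace n with ((n - N) + N)%nat by lia. rewrite iterate_plus. apply iterate_in; auto.
Qed.

Lemma phi_in (n : nat) (z : C) : unit_disc z -> unit_disc (iterate phi n z).
Proof. apply iterate_in. apply Hphi. Qed.

Lemma koenigs_iterate (n : nat) (z : C) : unit_disc z -> h (iterate phi n z) = (h z + INR n)%C.
Proof.
  intros Hz. induction n.
  - simpl. ring.
  - rewrite iterate_S, Hfun, IHn, S_INR, RtoC_plus by (apply phi_in; auto). ring.
Qed.

Lemma centralizer_iterate (psi : C -> C) (n : nat) (z : C) :
  centralizer phi psi -> unit_disc z -> psi (iterate phi n z) = iterate phi n (psi z).
Proof.
  intros [_ Hc] Hz. induction n; auto. rewrite !iterate_S, Hc, IHn by (apply phi_in; auto). reflexivity.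
Qed.

Lemma koenigs_eventual_eq (z w : C) : unit_disc z -> unit_disc w -> h z = h w ->
  exists N, forall n, (N <= n)%nat -> iterate phi n z = iterate phi n w.
Proof.
  intros Hz Hw E.
  destruct (absorbing_late V z HV Hz) as [N1 H1]. destruct (absorbing_late V w HV Hw) as [N2 H2].
  exists (max N1 N2). intros n Hn. apply Hinj; [apply H1; lia|apply H2; lia|].
  rewrite !koenigs_iterate by auto. rewrite E. reflexivity.
Qed.

(** Equal values of [h] give equal late iterates, and injectivity of [phi] on the invariant set [U]
    undoes the common iterate one step at a time. *)
Lemma koenigs_injective (U : C -> Prop) :
  (forall z, U z -> unit_disc z) -> maps_into U U phi -> injective_on U phi -> injective_on U h.
Proof.
  intros HU Hm Hi z w Hz Hw E.
  destruct (koenigs_eventual_eq z w (HU z Hz) (HU w Hw) E) as [N HN].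
  specialize (HN N (Nat.le_refl N)). clear E.
  induction N; auto. apply IHN. apply Hi; auto; apply iterate_in; auto.
Qed.

Let V_disc (z : C) : V z -> unit_disc z.
Proof. apply HV. Qed.
Let V_nbhd : nbhd_set V.
Proof. apply open_nbhd, HV. Qed.
Let h_hol : hol unit_disc h.
Proof. apply holomorphic_on_hol, Hh. Qed.
Let h_hol_V : hol V h.
Proof. intros z Hz. apply h_hol, V_disc, Hz. Qed.

Let image (w : C) : Prop := exists z, V z /\ h z = w.

Lemma koenigs_image_shift (w : C) : exists n, image (w + INR n)%C.
Proof.
  destruct (Hsurj w) as [n [z [Hz ->]]]. destruct (absorbing_late V z HV Hz) as [N HN].
  exists (N + n)%nat, (iterate phi N z). split; [apply HN; lia|].
  rewrite koenigs_iterate by auto. rewrite plus_INR, RtoC_plus. ring.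
Qed.

Lemma koenigs_image_absorbs_discs (R0 : R) :
  exists N, forall n w, (N <= n)%nat -> Cmod w < R0 -> image (w + INR n)%C.
Proof.
  apply translates_absorb_discs.
  - intros w [z [Hz <-]].
    destruct (univalent_open V h z 1 V_nbhd h_hol_V Hinj Hz ltac:(lra)) as [d [P Q]].
    exists d. split; auto. intros y Hy. destruct (Q y Hy) as [z' [H1 [_ H2]]]. exists z'. auto.
  - intros w [z [Hz <-]]. exists (phi z). split; [apply HV, Hz|apply Hfun, V_disc, Hz].
  - apply koenigs_image_shift.
Qed.

(** * The map induced by a commuting map in the Koenigs coordinate *)

Section LiftedMap.

Variable psi : C -> C.
Hypothesis Hpsi : centralizer phi psi.

Let psi_disc (z : C) : unit_disc z -> unit_disc (psi z).
Proof. apply Hpsi. Qed.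
Let psi_hol : hol unit_disc psi.
Proof. apply holomorphic_on_hol, Hpsi. Qed.

(** A point [w] need not lie in [h (V)], but some translate [w + n] does: the value is computed
    there and shifted back by [n]. The choice made by [epsilon] is immaterial by [lift_eq]. *)
Let lift_rel (w x : C) : Prop :=
  exists n z, V z /\ h z = (w + INR n)%C /\ x = (h (psi z) - INR n)%C.
Let G (w : C) : C := epsilon (inhabits (RtoC 0)) (lift_rel w).
Let k : C -> C := inverse_on V h.

(** For witnesses [z] at level [n] and [y] at level [m], the points [phi^m z] and [phi^n y] lie in
    [V] and have the same image under [h], so they are equal. Applying [psi], which commutes with
    the iterates, and then [h] equates the two values. *)
Lemma lift_eq (n : nat) (w z : C) : V z -> h z = (w + INR n)%C -> G w = (h (psi z) - INR n)%C.
Proof.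
  intros Hz E.
  destruct (epsilon_spec (inhabits (RtoC 0)) (lift_rel w)) as [m [y [Hy [Ey X]]]].
  { exists (h (psi z) - INR n)%C, n, z. auto. }
  fold (G w) in X. rewrite X.
  assert (F : iterate phi n y = iterate phi m z).
  { apply Hinj; try (apply iterate_in; auto; apply HV).
    rewrite !koenigs_iterate, Ey, E by auto. ring. }
  apply (f_equal psi) in F. rewrite !centralizer_iterate in F by auto.
  apply (f_equal h) in F. rewrite !koenigs_iterate in F by auto.
  replace (h (psi y) - INR m)%C with (h (psi y) + INR n - INR m - INR n)%C by ring. rewrite F. ring.
Qed.

Lemma lift_koenigs (z : C) : unit_disc z -> h (psi z) = G (h z).
Proof.
  intros Hz. destruct (absorbing_late V z HV Hz) as [N HN].
  rewrite (lift_eq N (h z) (iterate phi N z)).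
  - rewrite centralizer_iterate, koenigs_iterate by auto. ring.
  - apply HN. lia.
  - apply koenigs_iterate; auto.
Qed.

Lemma lift_shift (w : C) : G (w + 1)%C = (G w + 1)%C.
Proof.
  destruct (koenigs_image_shift w) as [n [z [Hz E]]].
  rewrite (lift_eq n w z) by auto.
  rewrite (lift_eq n (w + 1)%C (phi z)).
  - destruct Hpsi as [_ Hc]. rewrite Hc, Hfun by auto. ring.
  - apply HV, Hz.
  - rewrite Hfun, E by auto. ring.
Qed.

(** Since [h (V)] is open, the same [n] serves for all points near [w], and [G] is there the
    composition of [h], [psi] and a shifted inverse branch. *)
Lemma lift_deriv (n : nat) (w z : C) : V z -> h z = (w + INR n)%C ->
  cderiv G w (C_derive h (psi z) * (C_derive psi z * / C_derive h z))%C.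
Proof.
  intros Hz E.
  assert (Kz : k (w + INR n)%C = z) by (rewrite <- E; apply inverse_on_spec; auto).
  apply deriv_ext_loc with (fun y => h (psi (k (y + INR n))) - INR n)%C.
  - destruct (univalent_open V h z 1 V_nbhd h_hol_V Hinj Hz ltac:(lra)) as [d [P Q]].
    exists d. split; auto. unfold idC. intros y Hy.
    destruct (Q (y + INR n)%C) as [x [Hx [_ Ex]]].
    { rewrite E. replace (y + INR n - (w + INR n))%C with (y - w)%C by ring. auto. }
    rewrite (lift_eq n y x) by auto. rewrite <- Ex. unfold k. rewrite inverse_on_spec; auto.
  - assert (DK : cderiv (fun y => k (y + INR n)%C) w (/ C_derive h z * (1 + 0))%C).
    { apply (deriv_comp idC (fun y => y + INR n)%C k).
      - apply deriv_plus; [apply (deriv_embed idC)|apply deriv_const].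
      - rewrite <- E. apply cderiv_inverse_on; auto. }
    eapply deriv_eq.
    + apply deriv_minus; [|apply deriv_const].
      apply (deriv_comp idC (fun y => psi (k (y + INR n)))%C h).
      * apply (deriv_comp idC (fun y => k (y + INR n))%C psi); [exact DK|].
        rewrite Kz. apply diff_at_D; auto.
      * cbv beta. rewrite Kz. apply diff_at_D; auto.
    + ring.
Qed.

Lemma branch_deriv (n : nat) (w z : C) : V z -> h z = (w + INR n)%C ->
  cderiv (fun y => k (y + INR n)%C) w (/ C_derive h z)%C.
Proof.
  intros Hz E. eapply deriv_eq.
  - apply (deriv_comp idC (fun y => y + INR n)%C k).
    + apply deriv_plus; [apply (deriv_embed idC)|apply deriv_const].
    + rewrite <- E. apply cderiv_inverse_on; auto.
  - ring.
Qed.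

(* On larger and larger discs the branch [k (. + n)] of the inverse of [h] is
   univalent, so it has bounded distortion between [w] and [G w]; there it
   conjugates [G] to the hyperbolic contraction [psi]. *)
Lemma lift_derive_bound (w : C) : Cmod (C_derive G w) <= 4 * (1280 * exp 1281).
Proof.
  (* This puts [w] and [G w] within [R0 / 8] of [0], as the distortion bound requires, and makes
     [|G w - w|] at most [R0 / 16], small against the disc of radius [R0 / 2] around [w]. *)
  set (R0 := 16 * (Cmod w + Cmod (G w) + 1)).
  pose proof (Cmod_ge_0 w) as w0. pose proof (Cmod_ge_0 (G w)) as w0'.
  destruct (koenigs_image_absorbs_discs R0) as [N HN].
  destruct (koenigs_image_shift w) as [n0 [z [Hz Ez]]].
  destruct (absorbing_late V (psi z) HV (psi_disc z (V_disc z Hz))) as [N' HN'].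
  (* [n0] brings [w] into the image of [V], [N] makes the branch defined on the whole disc of radius
     [R0], and [N'] brings [psi a] into [V]. *)
  set (j := (N + N')%nat). set (n := (j + n0)%nat).
  set (a := iterate phi j z).
  assert (Va : V a) by (apply iterate_in; auto; apply HV).
  assert (Ea : h a = (w + INR n)%C).
  { unfold a, n. rewrite koenigs_iterate, Ez, plus_INR, RtoC_plus by auto. ring. }
  assert (Vb : V (psi a)).
  { unfold a. rewrite centralizer_iterate by auto. apply HN'. unfold j. lia. }
  assert (Eb : h (psi a) = (G w + INR n)%C) by (rewrite (lift_eq n w a) by auto; ring).
  set (kn := fun y => k (y + INR n)%C).
  assert (Him : forall y, odisc 0 R0 y -> exists x, V x /\ h x = (y + INR n)%C).
  { intros y Hy. apply HN; [unfold n, j; lia|]. unfold odisc in Hy.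
    replace (y - 0)%C with y in Hy by ring. auto. }
  assert (Kn : forall y x, V x -> h x = (y + INR n)%C -> kn y = x).
  { intros y x Hx E. unfold kn. rewrite <- E. apply inverse_on_spec; auto. }
  assert (Kh : hol (odisc 0 R0) kn).
  { intros y Hy. destruct (Him y Hy) as [x [Hx E]]. eexists. apply (branch_deriv n y x); auto. }
  assert (Ki : injective_on (odisc 0 R0) kn).
  { intros y1 y2 H1 H2 E. destruct (Him y1 H1) as [x1 [V1 E1]]. destruct (Him y2 H2) as [x2 [V2 E2]].
    rewrite (Kn y1 x1), (Kn y2 x2) in E by auto. subst x2. rewrite E1 in E2.
    replace y1 with (y1 + INR n - INR n)%C by ring. rewrite E2. ring. }
  assert (Kd : forall y, odisc 0 R0 y -> unit_disc (kn y)).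
  { intros y Hy. destruct (Him y Hy) as [x [Hx E]]. rewrite (Kn y x); auto. }
  assert (Ka : kn w = a) by (apply Kn; auto).
  assert (Kb : kn (G w) = psi a) by (apply Kn; auto).
  pose proof (univalent_distortion kn R0 w (G w) Kh Ki ltac:(unfold R0; lra) ltac:(unfold R0; lra)) as Dist.
  rewrite (cderiv_D_eq kn w _ (branch_deriv n w a Va Ea)),
    (cderiv_D_eq kn (G w) _ (branch_deriv n (G w) (psi a) Vb Eb)) in Dist.
  rewrite (cderiv_D_eq _ _ _ (lift_deriv n w a Va Ea)).
  pose proof (univalent_derive_neq_0 V h (psi a) V_nbhd h_hol_V Hinj Vb) as Nb.
  pose proof (univalent_derive_neq_0 V h a V_nbhd h_hol_V Hinj Va) as Na.
  (* Schwarz-Pick for the branch [kn], not for [psi]: [a] and [psi a] are the images of [w] and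
     [G w], at pseudo-hyperbolic distance at most [(R0 / 16) / (R0 / 2)], well below [/ 2]. *)
  assert (Ratio : 1 - Cmod (psi a) ^ 2 <= 4 * (1 - Cmod a ^ 2)).
  { apply pseudo_close_ratio; auto.
    assert (Sub : forall y, odisc w (R0 / 2) y -> odisc 0 R0 y).
    { intros y Hy. unfold odisc in *. pose proof (Cmod_triangle (y - w) w) as T.
      replace (y - w + w)%C with (y - 0)%C in T by ring. unfold R0 in *. lra. }
    assert (Hd : Cmod (G w - w) <= R0 / 16).
    { eapply Rle_trans; [apply Cmod_triangle|]. rewrite Cmod_opp. unfold R0. lra. }
    assert (SP : Cmod (kn w - kn (G w)) * (R0 / 2) <= Cmod (1 - Cconj (kn w) * kn (G w)) * Cmod (G w - w)).
    { apply schwarz_pick_center; auto.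
      - intros y Hy. apply Kh, Sub, Hy.
      - unfold odisc, R0 in *. lra. }
    rewrite Ka, Kb in SP.
    assert (RP : 0 < R0) by (unfold R0; lra).
    pose proof (Cmod_ge_0 (1 - Cconj a * psi a)).
    apply Rmult_le_reg_r with (R0 / 2); [lra|]. eapply Rle_trans; [exact SP|].
    rewrite (Rmult_comm (/ 2)), Rmult_assoc. apply Rmult_le_compat_l; lra. }
  assert (Psi4 : Cmod (C_derive psi a) <= 4).
  { pose proof (schwarz_pick_deriv psi a psi_hol psi_disc (V_disc a Va)) as SP.
    pose proof (V_disc a Va) as Da. unfold unit_disc in Da. pose proof (Cmod_ge_0 a).
    apply Rmult_le_reg_r with (1 - Cmod a ^ 2); [nra|lra]. }
  rewrite !Cmod_inv in Dist by auto. rewrite !Cmod_mult, Cmod_inv by auto.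
  assert (Pb : 0 < Cmod (C_derive h (psi a))) by (apply Cmod_gt_0; auto).
  assert (Pa : 0 < Cmod (C_derive h a)) by (apply Cmod_gt_0; auto).
  (* The derivatives of [kn] at [w] and [G w] are the inverses of [h' a] and [h' (psi a)], so this
     is the distortion bound. *)
  assert (X : Cmod (C_derive h (psi a)) * / Cmod (C_derive h a) <= 1280 * exp 1281).
  { apply (Rmult_le_compat_l (Cmod (C_derive h (psi a)))) in Dist; [|lra].
    eapply Rle_trans; [exact Dist|]. right. field. lra. }
  replace (Cmod (C_derive h (psi a)) * (Cmod (C_derive psi a) * / Cmod (C_derive h a)))
    with (Cmod (C_derive psi a) * (Cmod (C_derive h (psi a)) * / Cmod (C_derive h a))) by ring.
  apply Rmult_le_compat; auto; [apply Cmod_ge_0|].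
  apply Rmult_le_pos; [lra|apply Rlt_le, Rinv_0_lt_compat; auto].
Qed.

Lemma centralizer_translation : exists c : C, forall z, unit_disc z -> h (psi z) = (h z + c)%C.
Proof.
  assert (HG : forall w, diff_at G w).
  { intros w. destruct (koenigs_image_shift w) as [n [z [Hz E]]]. eexists. apply (lift_deriv n w z); auto. }
  pose proof (entire_bounded_derive G _ HG lift_derive_bound) as A.
  pose proof (lift_shift 0) as S. rewrite Cplus_0_l, (A 1%C) in S.
  assert (E : C_derive G 0 = 1%C).
  { replace (C_derive G 0) with (G 0 + 1 * C_derive G 0 - G 0)%C by ring. rewrite S. ring. }
  exists (G 0). intros z Hz. rewrite lift_koenigs, A, E by auto. ring.
Qed.

End LiftedMap.

(** * Univalence and commutativity from the translation formula *)

Lemma centralizer_injective (psi : C -> C) (U : C -> Prop) :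
  centralizer phi psi -> (forall z, U z -> unit_disc z) -> maps_into U U psi ->
  maps_into U U phi -> univalent_on U phi -> univalent_on U psi.
Proof.
  intros Hp HU Hm Hmp [_ Hi]. split.
  - intros z Hz. apply Hp. auto.
  - intros z w Hz Hw E. destruct (centralizer_translation psi Hp) as [c Hc].
    apply (koenigs_injective U HU Hmp Hi); auto.
    apply (f_equal h) in E. rewrite !Hc in E by auto.
    replace (h z) with (h z + c - c)%C by ring. rewrite E. ring.
Qed.

(** Under [h] both compositions become [h + c1 + c2], but [h] is known to be injective only on [V].
    Far along the orbit of [z], at [b], both compositions take values in [V], and by openness also
    near [b]; there they agree, and the identity theorem gives equality on the disc. *)
Lemma centralizer_commutes (psi1 psi2 : C -> C) (z : C) :
  centralizer phi psi1 -> centralizer phi psi2 -> unit_disc z -> psi1 (psi2 z) = psi2 (psi1 z).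
Proof.
  intros H1 H2 Hz.
  destruct (centralizer_translation psi1 H1) as [c1 C1]. destruct (centralizer_translation psi2 H2) as [c2 C2].
  assert (M1 : forall y, unit_disc y -> unit_disc (psi1 y)) by apply H1.
  assert (M2 : forall y, unit_disc y -> unit_disc (psi2 y)) by apply H2.
  assert (D1 : hol unit_disc psi1) by (apply holomorphic_on_hol, H1).
  assert (D2 : hol unit_disc psi2) by (apply holomorphic_on_hol, H2).
  assert (D12 : hol unit_disc (fun y => psi1 (psi2 y))) by (intros y Hy; apply (diff_at_comp psi1 psi2); auto).
  assert (D21 : hol unit_disc (fun y => psi2 (psi1 y))) by (intros y Hy; apply (diff_at_comp psi2 psi1); auto).
  destruct (absorbing_late V (psi1 (psi2 z)) HV ltac:(auto)) as [N1 A1].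
  destruct (absorbing_late V (psi2 (psi1 z)) HV ltac:(auto)) as [N2 A2].
  set (n := (N1 + N2)%nat). set (b := iterate phi n z).
  assert (Hb : unit_disc b) by (apply phi_in; auto).
  assert (B1 : V (psi1 (psi2 b))).
  { unfold b. rewrite (centralizer_iterate psi2), (centralizer_iterate psi1) by auto. apply A1. unfold n; lia. }
  assert (B2 : V (psi2 (psi1 b))).
  { unfold b. rewrite (centralizer_iterate psi1), (centralizer_iterate psi2) by auto. apply A2. unfold n; lia. }
  destruct (V_nbhd _ B1) as [r1 [P1 Q1]]. destruct (V_nbhd _ B2) as [r2 [P2 Q2]].
  destruct (nbhd_unit_disc b Hb) as [r3 [P3 Q3]].
  destruct (diff_at_cont _ b (D12 b Hb) r1 P1) as [d1 [E1 F1]].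
  destruct (diff_at_cont _ b (D21 b Hb) r2 P2) as [d2 [E2 F2]].
  unfold idC in F1, F2.
  assert (Z : forall y, unit_disc y -> (psi1 (psi2 y) - psi2 (psi1 y))%C = 0%C).
  { apply (identity_unit_disc _ b (Rmin (Rmin d1 d2) r3)); auto.
    - repeat apply Rmin_pos; auto.
    - intros y Hy. apply diff_at_minus; [apply D12|apply D21]; auto.
    - intros y Hy. apply Rmin_Rgt in Hy. destruct Hy as [Hy Y3]. apply Rmin_Rgt in Hy. destruct Hy as [Y1 Y2].
      apply Rgt_lt in Y1, Y2, Y3.
      assert (Dy : unit_disc y) by (apply Q3; lra).
      assert (E : psi1 (psi2 y) = psi2 (psi1 y)).
      { apply Hinj.
        - apply Q1. apply Rlt_le, F1, Y1.
        - apply Q2. apply Rlt_le, F2, Y2.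
        - rewrite C1, C2, C2, C1 by auto. ring. }
      rewrite E. ring. }
  replace (psi1 (psi2 z)) with (psi1 (psi2 z) - psi2 (psi1 z) + psi2 (psi1 z))%C by ring.
  rewrite Z by auto. ring.
Qed.

End Centralizer.

Theorem theorem4p5 (phi h psi : C -> C)
  (hphi : parabolic phi)
  (hstep : zero_hyperbolic_step phi)
  (hkoenigs : koenigs_function phi h)
  (hpsi : centralizer phi psi) :
  (univalent_on unit_disc phi -> univalent_on unit_disc psi) /\
  (forall V : C -> Prop,
     simply_connected_domain V -> absorbing phi V ->
     maps_into V V psi -> univalent_on V phi -> univalent_on V psi) /\
  (exists c : C, forall z : C, unit_disc z -> h (psi z) = (h z + c)%C) /\
  (forall psi1 psi2 : C -> C,
     centralizer phi psi1 -> centralizer phi psi2 ->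
     forall z : C, unit_disc z -> psi1 (psi2 z) = psi2 (psi1 z)).
Proof.
  destruct hphi as [Hphi _]. destruct hkoenigs as [Hh [_ [Hfun [Hsurj [W [HW Hinj]]]]]].
  split; [|split; [|split]].
  - intros Hu. apply (centralizer_injective phi h W Hphi Hh Hfun Hsurj HW Hinj psi unit_disc); auto.
    + apply hpsi.
    + apply Hphi.
  - intros V _ HV Hm Hu. apply (centralizer_injective phi h W Hphi Hh Hfun Hsurj HW Hinj psi V); auto; apply HV.
  - exact (centralizer_translation phi h W Hphi Hh Hfun Hsurj HW Hinj psi hpsi).
  - intros psi1 psi2 H1 H2 z Hz.
    exact (centralizer_commutes phi h W Hphi Hh Hfun Hsurj HW Hinj psi1 psi2 z H1 H2 Hz).
Qed.
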